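(* Let $k$ be a field, $A,B,C$ central simple $k$-algebras, and $E:\mathrm{dgcat}(k)\to\mathrm{D}$ an additive invariant with values in an additive category $\mathrm{D}$. Assume that $\mathrm{ind}(A)$ and $\mathrm{ind}(B)$ are coprime. Then there is an isomorphism $$E(C)\oplus E(A\otimes B\otimes C)\simeq E(A\otimes C)\oplus E(B\otimes C)$$ in $\mathrm{D}$.
   Context: Tensor products are over $k$; $\mathrm{ind}$ denotes the index of a central simple algebra. $\mathrm{dgcat}(k)$ is the category of (small) dg categories over $k$ (categories enriched over cochain complexes of $k$-vector spaces); a $k$-algebra is viewed as a dg category with one object. A dg functor $\mathcal{A}\to\mathcal{B}$ is a Morita equivalence if it induces an equivalence $\mathcal{D}(\mathcal{A})\simeq\mathcal{D}(\mathcal{B})$ of derived categories of right modules. For a dg category $\mathcal{A}$, $T(\mathcal{A})$ is the dg category of pairs $(i,x)$, $i\in\{1,2\}$, $x\in\mathcal{A}$, with morphism complex from $(i,x)$ to $(i',x')$ equal to $\mathcal{A}(x,x')$ if $i'\ge i$ and zero otherwise, and composition induced by $\mathcal{A}$; there are two inclusions $i_1,i_2:\mathcal{A}\hookrightarrow T(\mathcal{A})$. A functor $E:\mathrm{dgcat}(k)\to\mathrm{D}$ with values in an additive category is an additive invariant if it sends Morita equivalences to isomorphisms and, for every $\mathcal{A}$, $i_1$ and $i_2$ induce an isomorphism $E(\mathcal{A})\oplus E(\mathcal{A})\simeq E(T(\mathcal{A}))$. *)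

(* Defs.v *)
From HB Require Import structures.
From mathcomp Require Import all_boot all_order all_algebra all_field.
From mathcomp Require Import boolp classical_sets.

Set Implicit Arguments.
Unset Strict Implicit.
Unset Printing Implicit Defensive.

Import GRing.Theory.
Local Open Scope ring_scope.

(* Over a field, every ring-theoretic two-sided ideal of a unital algebra is a
   subspace; a falgType is nonzero by construction. *)
Definition simple_algebra (k : fieldType) (A : falgType k) : Prop :=
  forall I : {vspace A},
    (fullv * I <= I)%VS -> (I * fullv <= I)%VS -> I = 0%VS \/ I = fullv.

Definition central_simple (k : fieldType) (A : falgType k) : Prop :=
  'Z({:A})%VS = 1%VS /\ simple_algebra A.

Definition division_algebra (k : fieldType) (D : falgType k) : Prop :=
  forall x : D, x != 0 -> x \is a GRing.unit.

(* A is isomorphic to M_(n+1)(D) as a k-algebra. As D need not be commutative,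
   MathComp gives 'M[D]_n.+1 only a ring and a left D-module structure, so k
   acts on it through c |-> c%:A : D. *)
Definition matrix_algebra_over
    (k : fieldType) (A D : falgType k) (n : nat) : Prop :=
  exists2 phi : {rmorphism A -> 'M[D]_n.+1},
    bijective phi & forall (c : k) (a : A), phi (c *: a) = c%:A *: phi a.

(* The degree, i.e. the square root of the dimension, of the division algebra D
   in the Wedderburn decomposition of A. *)
Definition is_index (k : fieldType) (A : falgType k) (d : nat) : Prop :=
  exists (D : falgType k) (n : nat),
    [/\ division_algebra D, matrix_algebra_over A D n & \dim {:D} = (d ^ 2)%N].

(* By Wedderburn's theorem the default value 0 is never taken when A is central
   simple. *)
Definition ind (k : fieldType) (A : falgType k) : nat := xget 0%N (is_index A).

Lemma linear_sumZ (k : fieldType) (V W : lmodType k) (f : V -> W) (I : Type)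
    (r : seq I) (c : I -> k) (v : I -> V) :
  linear f -> f (\sum_(i <- r) c i *: v i) = \sum_(i <- r) c i *: f (v i).
Proof.
move=> lf; have lfD u w : f (u + w) = f u + f w.
  by rewrite -[u in LHS]scale1r lf scale1r.
have lf0 : f 0 = 0 by apply: (addIr (f 0)); rewrite -lfD !add0r.
have lfZ x u : f (x *: u) = x *: f u by rewrite -[_ *: u]addr0 lf lf0 addr0.
by elim/big_rec2: _ => // i _ w _ <-; rewrite lfD lfZ.
Qed.

(* An element of A ⊗ B is encoded by its matrix of coordinates in the tensor
   product of the bases underlying [v2r]; [tens a b] is a ⊗ b, and [tens_mulE]
   is the rule (a ⊗ b)(a' ⊗ b') = aa' ⊗ bb'. *)
Section Tensor.
Import VectorInternalTheory.
Variables (k : fieldType) (A B : falgType k).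

Definition tensor : predArgType := 'M[k]_(dim A, dim B).

HB.instance Definition _ := Vector.on tensor.

Definition tens (a : A) (b : B) : tensor := (v2r a)^T *m v2r b.

Definition tens_basis (i : 'I_(dim A)) (j : 'I_(dim B)) : tensor :=
  tens (r2v (delta_mx 0 i)) (r2v (delta_mx 0 j)).

Definition tens_one : tensor := tens 1 1.

Definition tens_mul (x y : tensor) : tensor :=
  \sum_i \sum_j \sum_i' \sum_j' (x i j * y i' j') *:
    tens (r2v (delta_mx 0 i) * r2v (delta_mx 0 i'))
         (r2v (delta_mx 0 j) * r2v (delta_mx 0 j')).

Lemma tens_linearl b : linear (tens^~ b).
Proof. by move=> c a a'; rewrite /tens !linearP /= mulmxDl -scalemxAl. Qed.

Lemma tens_linearr a : linear (tens a).
Proof. by move=> c b b'; rewrite /tens linearP /= mulmxDr -scalemxAr. Qed.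

Lemma tens_basisE i j : tens_basis i j = delta_mx i j.
Proof. by rewrite /tens_basis /tens !r2vK trmx_delta mul_delta_mx. Qed.

Lemma tensE (x : tensor) : x = \sum_i \sum_j x i j *: tens_basis i j.
Proof.
rewrite {1}[x]matrix_sum_delta.
by apply: eq_bigr => i _; apply: eq_bigr => j _; rewrite tens_basisE.
Qed.

Lemma tens_mul_linearl y : linear (tens_mul^~ y).
Proof.
move=> c x x'; rewrite /tens_mul scaler_sumr -big_split; apply: eq_bigr => i _.
rewrite /= scaler_sumr -big_split; apply: eq_bigr => j _.
rewrite /= scaler_sumr -big_split; apply: eq_bigr => i' _.
rewrite /= scaler_sumr -big_split; apply: eq_bigr => j' _ /=.
by rewrite scalerA -scalerDl mulrA -mulrDl !mxE.
Qed.

Lemma tens_mul_linearr x : linear (tens_mul x).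
Proof.
move=> c y y'; rewrite /tens_mul scaler_sumr -big_split; apply: eq_bigr => i _.
rewrite /= scaler_sumr -big_split; apply: eq_bigr => j _.
rewrite /= scaler_sumr -big_split; apply: eq_bigr => i' _.
rewrite /= scaler_sumr -big_split; apply: eq_bigr => j' _ /=.
by rewrite scalerA -scalerDl mulrCA -mulrDr !mxE.
Qed.

Lemma v2r_sum (vT : vectType k) (a : vT) :
  a = \sum_i v2r a 0 i *: r2v (delta_mx 0 i).
Proof.
rewrite -{1}[a]v2rK {1}[v2r a]row_sum_delta linear_sum /=.
by apply: eq_bigr => i _; rewrite linearZ.
Qed.

Lemma tens_mulE (a a' : A) (b b' : B) :
  tens_mul (tens a b) (tens a' b') = tens (a * a') (b * b').
Proof.
have Al c c' x : tens (c * c') x =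
    \sum_i v2r c 0 i *: tens (r2v (delta_mx 0 i) * c') x.
  rewrite {1}[c]v2r_sum (linear_sumZ (f := fun z => tens (z * c') x)) //.
  by move=> u z z'; rewrite mulrDl -scalerAl tens_linearl.
have Ar c c' x : tens (c * c') x =
    \sum_i v2r c' 0 i *: tens (c * r2v (delta_mx 0 i)) x.
  rewrite {1}[c']v2r_sum (linear_sumZ (f := fun z => tens (c * z) x)) //.
  by move=> u z z'; rewrite mulrDr -scalerAr tens_linearl.
have Bl x d d' : tens x (d * d') =
    \sum_i v2r d 0 i *: tens x (r2v (delta_mx 0 i) * d').
  rewrite {1}[d]v2r_sum (linear_sumZ (f := fun z => tens x (z * d'))) //.
  by move=> u z z'; rewrite mulrDl -scalerAl tens_linearr.
have Br x d d' : tens x (d * d') =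
    \sum_i v2r d' 0 i *: tens x (d * r2v (delta_mx 0 i)).
  rewrite {1}[d']v2r_sum (linear_sumZ (f := fun z => tens x (d * z))) //.
  by move=> u z z'; rewrite mulrDr -scalerAr tens_linearr.
rewrite Al; apply: eq_bigr => i _; rewrite Bl scaler_sumr.
apply: eq_bigr => j _; rewrite Ar !scaler_sumr; apply: eq_bigr => i' _.
rewrite Br !scaler_sumr; apply: eq_bigr => j' _; rewrite !scalerA.
by congr (_ *: _); rewrite !mxE !big_ord1 !mxE !mulrA.
Qed.

Lemma tens_ind (P : tensor -> Prop) :
  (forall c x y, P x -> P y -> P (c *: x + y)) ->
  (forall a b, P (tens a b)) -> forall x, P x.
Proof.
move=> PD Pt x; rewrite (tensE x).
have P0 : P 0.
  by rewrite -(subrr (tens 0 0)) addrC -scaleN1r; apply: PD; apply: Pt.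
elim/big_rec: _ => // i y _ Py; elim/big_rec: _ => [|j z _ Pz].
  by rewrite add0r.
by rewrite -addrA; apply: PD => //; apply: Pt.
Qed.

Lemma tens_mulA : associative tens_mul.
Proof.
move=> x y z; move: x; apply: tens_ind => [c x x' IHx IHx'|a b].
  by rewrite !tens_mul_linearl IHx IHx'.
move: y; apply: tens_ind => [c y y' IHy IHy'|a' b'].
  by rewrite tens_mul_linearl !tens_mul_linearr tens_mul_linearl IHy IHy'.
move: z; apply: tens_ind => [c z z' IHz IHz'|a'' b''].
  by rewrite !tens_mul_linearr IHz IHz'.
by rewrite !tens_mulE !mulrA.
Qed.

Lemma tens_mul1l : left_id tens_one tens_mul.
Proof.
apply: tens_ind => [c x x' IHx IHx'|a b].
  by rewrite tens_mul_linearr IHx IHx'.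
by rewrite tens_mulE !mul1r.
Qed.

Lemma tens_mul1r : right_id tens_one tens_mul.
Proof.
apply: tens_ind => [c x x' IHx IHx'|a b].
  by rewrite tens_mul_linearl IHx IHx'.
by rewrite tens_mulE !mulr1.
Qed.

Lemma tens_mulDl : left_distributive tens_mul +%R.
Proof.
by move=> x y z; rewrite -[x in LHS]scale1r tens_mul_linearl scale1r.
Qed.

Lemma tens_mulDr : right_distributive tens_mul +%R.
Proof.
by move=> z x y; rewrite -[x in LHS]scale1r tens_mul_linearr scale1r.
Qed.

Lemma tens_one_neq0 : tens_one != 0.
Proof.
have nz (vT : falgType k) : exists i, v2r (1 : vT) 0 i != 0.
  apply/rV0Pn; rewrite -(linear0 (@v2r _ vT)) (can_eq v2rK).
  exact: oner_neq0.
have [i nzi] := nz A; have [j nzj] := nz B.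
apply/eqP => /matrixP/(_ i j)/eqP.
by rewrite !mxE big_ord1 !mxE mulf_eq0 (negPf nzi) (negPf nzj).
Qed.

HB.instance Definition _ := GRing.Zmodule_isNzRing.Build tensor
  tens_mulA tens_mul1l tens_mul1r tens_mulDl tens_mulDr tens_one_neq0.

Lemma tens_scaleAl (c : k) (x y : tensor) : c *: (x * y) = (c *: x) * y.
Proof.
rewrite -[c *: x]addr0 [RHS](tens_mul_linearl y c x 0).
by rewrite [tens_mul 0 y](mul0r y) addr0.
Qed.

Lemma tens_scaleAr (c : k) (x y : tensor) : c *: (x * y) = x * (c *: y).
Proof.
rewrite -[c *: y]addr0 [RHS](tens_mul_linearr x c y 0).
by rewrite [tens_mul x 0](mulr0 x) addr0.
Qed.

HB.instance Definition _ :=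
  GRing.Lmodule_isLalgebra.Build k tensor tens_scaleAl.
HB.instance Definition _ :=
  GRing.Lalgebra_isAlgebra.Build k tensor
    tens_scaleAr.
HB.instance Definition _ := Algebra_isFalgebra.Build k tensor.

End Tensor.

Notation "A ⊗ B" := (tensor A B) (at level 40, left associativity) : type_scope.

Record category := Category {
  cat_ob :> Type;
  cat_hom : cat_ob -> cat_ob -> Type;
  cat_id : forall X, cat_hom X X;
  cat_comp : forall X Y Z, cat_hom Y Z -> cat_hom X Y -> cat_hom X Z;
  cat_idl : forall X Y (f : cat_hom X Y), cat_comp (cat_id Y) f = f;
  cat_idr : forall X Y (f : cat_hom X Y), cat_comp f (cat_id X) = f;
  cat_assoc : forall X Y Z W
      (h : cat_hom Z W) (g : cat_hom Y Z) (f : cat_hom X Y),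
    cat_comp h (cat_comp g f) = cat_comp (cat_comp h g) f }.

Arguments cat_id {c} X.
Arguments cat_comp {c X Y Z} g f.

Definition is_iso (C : category) (X Y : C) (f : cat_hom X Y) : Prop :=
  exists g : cat_hom Y X, cat_comp g f = cat_id X /\ cat_comp f g = cat_id Y.

Definition isomorphic (C : category) (X Y : C) : Prop :=
  exists f : cat_hom X Y, is_iso f.

Record functor (C D : category) := Functor {
  fun_ob :> C -> D;
  fun_hom : forall X Y, cat_hom X Y -> cat_hom (fun_ob X) (fun_ob Y);
  fun_id : forall X, fun_hom (cat_id X) = cat_id (fun_ob X);
  fun_comp : forall X Y Z (g : cat_hom Y Z) (f : cat_hom X Y),
    fun_hom (cat_comp g f) = cat_comp (fun_hom g) (fun_hom f) }.

Definition functor_id (C : category) : functor C C :=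
  @Functor C C id (fun _ _ f => f) (fun _ => erefl) (fun _ _ _ _ _ => erefl).

Program Definition functor_comp (C D E : category)
    (G : functor D E) (F : functor C D) : functor C E :=
  @Functor C E (fun X => G (F X)) (fun _ _ f => fun_hom G (fun_hom F f)) _ _.
Next Obligation. by rewrite !fun_id. Qed.
Next Obligation. by rewrite !fun_comp. Qed.

Definition naturally_isomorphic (C D : category) (F G : functor C D) : Prop :=
  exists2 t : forall X, cat_hom (F X) (G X),
    forall X Y (f : cat_hom X Y),
      cat_comp (t Y) (fun_hom F f) = cat_comp (fun_hom G f) (t X)
  & forall X, is_iso (t X).

Definition is_equivalence (C D : category) (F : functor C D) : Prop :=
  exists G : functor D C,
    naturally_isomorphic (functor_comp G F) (functor_id C)
    /\ naturally_isomorphic (functor_comp F G) (functor_id D).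

(* A category enriched in abelian groups, with a zero object and a choice of
   binary biproducts. *)
Record additive_category := AdditiveCategory {
  add_ob :> Type;
  add_hom : add_ob -> add_ob -> zmodType;
  add_id : forall X, add_hom X X;
  add_comp : forall X Y Z, add_hom Y Z -> add_hom X Y -> add_hom X Z;
  add_idl : forall X Y (f : add_hom X Y), add_comp (add_id Y) f = f;
  add_idr : forall X Y (f : add_hom X Y), add_comp f (add_id X) = f;
  add_assoc : forall X Y Z W
      (h : add_hom Z W) (g : add_hom Y Z) (f : add_hom X Y),
    add_comp h (add_comp g f) = add_comp (add_comp h g) f;
  add_compDl : forall X Y Z (g g' : add_hom Y Z) (f : add_hom X Y),
    add_comp (g + g') f = add_comp g f + add_comp g' f;
  add_compDr : forall X Y Z (g : add_hom Y Z) (f f' : add_hom X Y),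
    add_comp g (f + f') = add_comp g f + add_comp g f';
  add_zero : add_ob;
  add_zeroP : add_id add_zero = 0;
  add_sum : add_ob -> add_ob -> add_ob;
  add_in1 : forall X Y, add_hom X (add_sum X Y);
  add_in2 : forall X Y, add_hom Y (add_sum X Y);
  add_pr1 : forall X Y, add_hom (add_sum X Y) X;
  add_pr2 : forall X Y, add_hom (add_sum X Y) Y;
  add_pr1in1 : forall X Y, add_comp (add_pr1 X Y) (add_in1 X Y) = add_id X;
  add_pr2in2 : forall X Y, add_comp (add_pr2 X Y) (add_in2 X Y) = add_id Y;
  add_pr1in2 : forall X Y, add_comp (add_pr1 X Y) (add_in2 X Y) = 0;
  add_pr2in1 : forall X Y, add_comp (add_pr2 X Y) (add_in1 X Y) = 0;
  add_inpr : forall X Y,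
    add_comp (add_in1 X Y) (add_pr1 X Y) + add_comp (add_in2 X Y) (add_pr2 X Y)
    = add_id (add_sum X Y) }.

Notation "X ⊕ Y" := (add_sum X Y) (at level 50, left associativity).

Definition additive_cat (D : additive_category) : category :=
  Category (@add_idl D) (@add_idr D) (@add_assoc D).

Coercion additive_cat : additive_category >-> category.

Definition copair (D : additive_category) (X Y Z : D)
    (f : add_hom X Z) (g : add_hom Y Z) : add_hom (X ⊕ Y) Z :=
  add_comp f (add_pr1 X Y) + add_comp g (add_pr2 X Y).

(* C[W^-1]: the objects of C, and as morphisms the formal composites of
   morphisms of C and of inverses of morphisms of W, modulo the relations which
   make C -> C[W^-1] a functor inverting W. *)

Definition morphism_class (C : category) :=
  forall X Y : C, cat_hom X Y -> Prop.

Section Localization.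
Variables (C : category) (W : morphism_class C).

Inductive word : C -> C -> Type :=
| word_of X Y : cat_hom X Y -> word X Y
| word_inv X Y (w : cat_hom X Y) : W w -> word Y X
| word_comp X Y Z : word Y Z -> word X Y -> word X Z.

Inductive word_eq : forall X Y, word X Y -> word X Y -> Prop :=
| word_refl X Y (a : word X Y) : word_eq a a
| word_sym X Y (a b : word X Y) : word_eq a b -> word_eq b a
| word_trans X Y (b a c : word X Y) :
    word_eq a b -> word_eq b c -> word_eq a c
| word_congr X Y Z (b b' : word Y Z) (a a' : word X Y) :
    word_eq b b' -> word_eq a a' -> word_eq (word_comp b a) (word_comp b' a')
| word_idl X Y (a : word X Y) :
    word_eq (word_comp (word_of (cat_id Y)) a) a
| word_idr X Y (a : word X Y) :
    word_eq (word_comp a (word_of (cat_id X))) a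
| word_assoc X Y Z T (c : word Z T) (b : word Y Z) (a : word X Y) :
    word_eq (word_comp c (word_comp b a)) (word_comp (word_comp c b) a)
| word_ofM X Y Z (g : cat_hom Y Z) (f : cat_hom X Y) :
    word_eq (word_of (cat_comp g f)) (word_comp (word_of g) (word_of f))
| word_invl X Y (w : cat_hom X Y) (Ww : W w) :
    word_eq (word_comp (word_inv Ww) (word_of w)) (word_of (cat_id X))
| word_invr X Y (w : cat_hom X Y) (Ww : W w) :
    word_eq (word_comp (word_of w) (word_inv Ww)) (word_of (cat_id Y)).

Definition loc_hom X Y := {P : word X Y -> Prop | exists a, P = word_eq a}.

Definition loc_class X Y (a : word X Y) : loc_hom X Y :=
  exist _ (word_eq a) (ex_intro _ a erefl).

Definition loc_repr X Y (q : loc_hom X Y) : word X Y := sval (cid (svalP q)).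

Lemma loc_classP X Y (a b : word X Y) :
  loc_class a = loc_class b <-> word_eq a b.
Proof.
split=> [[ab] | ab]; first by rewrite ab; apply: word_refl.
apply/eq_exist/funext => c; apply/propext; split.
  exact: word_trans (word_sym ab).
exact: word_trans ab.
Qed.

Lemma loc_reprK X Y (q : loc_hom X Y) : loc_class (loc_repr q) = q.
Proof.
by case: q => P aP; apply: eq_exist; rewrite /loc_repr; case: cid => a /= ->.
Qed.

Lemma word_repr X Y (a : word X Y) : word_eq (loc_repr (loc_class a)) a.
Proof. by apply/loc_classP; rewrite loc_reprK. Qed.

Definition loc_id X : loc_hom X X := loc_class (word_of (cat_id X)).

Definition loc_comp X Y Z (q : loc_hom Y Z) (p : loc_hom X Y) : loc_hom X Z :=
  loc_class (word_comp (loc_repr q) (loc_repr p)).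

Lemma loc_idl X Y (p : loc_hom X Y) : loc_comp (loc_id Y) p = p.
Proof.
rewrite -[RHS]loc_reprK; apply/loc_classP.
apply: word_trans (word_idl _); apply: word_congr; last exact: word_refl.
exact: word_repr.
Qed.

Lemma loc_idr X Y (p : loc_hom X Y) : loc_comp p (loc_id X) = p.
Proof.
rewrite -[RHS]loc_reprK; apply/loc_classP.
apply: word_trans (word_idr _); apply: word_congr; first exact: word_refl.
exact: word_repr.
Qed.

Lemma loc_assoc X Y Z T
    (r : loc_hom Z T) (q : loc_hom Y Z) (p : loc_hom X Y) :
  loc_comp r (loc_comp q p) = loc_comp (loc_comp r q) p.
Proof.
apply/loc_classP; apply: (word_trans (b := word_comp (loc_repr r)
  (word_comp (loc_repr q) (loc_repr p)))).
  by apply: word_congr; [exact: word_refl | exact: word_repr].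
apply: word_trans (word_assoc _ _ _) _; apply: word_congr.
  by apply: word_sym; apply: word_repr.
exact: word_refl.
Qed.

Definition localization : category := Category loc_idl loc_idr loc_assoc.

End Localization.

Section LocalizedFunctor.
Variables (C D : category) (W : morphism_class C) (V : morphism_class D).
Variables (F : functor C D).
Hypothesis FW : forall X Y (f : cat_hom X Y), W f -> V (fun_hom F f).

Fixpoint word_map X Y (a : word W X Y) : word V (F X) (F Y) :=
  match a with
  | word_of _ _ f => word_of V (fun_hom F f)
  | word_inv _ _ _ Ww => word_inv (FW Ww)
  | word_comp _ _ _ b a => word_comp (word_map b) (word_map a)
  end.

Lemma word_map_eq X Y (a b : word W X Y) :
  word_eq a b -> word_eq (word_map a) (word_map b).
Proof.
elim=> {X Y a b} /=; try by [move=> *; constructor].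
- by move=> X Y b a c _ ab _ bc; apply: word_trans ab bc.
- by move=> X Y a; rewrite fun_id; apply: word_idl.
- by move=> X Y a; rewrite fun_id; apply: word_idr.
- by move=> X Y Z g f; rewrite fun_comp; apply: word_ofM.
- by move=> X Y w Ww; rewrite fun_id; apply: word_invl.
- by move=> X Y w Ww; rewrite fun_id; apply: word_invr.
Qed.

Definition loc_map (X Y : localization W) (q : cat_hom X Y) :
    @cat_hom (localization V) (F X) (F Y) :=
  loc_class (word_map (loc_repr q)).

Lemma loc_map_id X :
  loc_map (cat_id X) = @cat_id (localization V) (F X).
Proof.
apply/loc_classP; rewrite -(fun_id F X).
exact: (word_map_eq (word_repr (word_of W (@cat_id C X)))).
Qed.

Lemma loc_map_comp (X Y Z : localization W)
    (q : cat_hom Y Z) (p : cat_hom X Y) :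
  loc_map (cat_comp q p) = cat_comp (loc_map q) (loc_map p).
Proof.
apply/loc_classP; apply: word_trans (word_map_eq (word_repr _)) _.
by apply: word_congr; apply: word_sym; apply: word_repr.
Qed.

Definition localized_functor : functor (localization W) (localization V) :=
  Functor loc_map_id loc_map_comp.

End LocalizedFunctor.

Record complex (k : fieldType) := Complex {
  cx_deg :> int -> lmodType k;
  cx_d : forall n, {linear cx_deg n -> cx_deg (n + 1)};
  cx_dd : forall n (x : cx_deg n), cx_d (n + 1) (cx_d n x) = 0 }.

Arguments cx_d {k c} n.

Definition cx_trivial (k : fieldType) : lmodType k := 'rV[k]_0.

Program Definition cx0 (k : fieldType) : complex k :=
  @Complex k (fun _ => cx_trivial k) (fun _ => \0) _.

Definition is_chain_map (k : fieldType) (V W : complex k)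
    (f : forall n, V n -> W n) : Prop :=
  (forall n, linear (f n)) /\ forall n x, f (n + 1) (cx_d n x) = cx_d n (f n x).

(* f induces a bijection on the cohomology in degree n + 1, for all n : int. *)
Definition is_quasi_iso (k : fieldType) (V W : complex k)
    (f : forall n, V n -> W n) : Prop :=
  forall n,
    (forall z : V (n + 1), cx_d _ z = 0 ->
       (exists w : W n, f _ z = cx_d _ w) -> exists v : V n, z = cx_d _ v)
    /\ (forall w : W (n + 1), cx_d _ w = 0 ->
         exists2 z : V (n + 1), cx_d _ z = 0 &
         exists w' : W n, w = f _ z + cx_d _ w').

Definition ksign (k : fieldType) (m : int) : k := (-1) ^ m.

(* To avoid casts along equalities of degrees, a composition of degrees m and n
   takes values in any degree p with a proof of m + n = p. *)
Record dgcat (k : fieldType) := DGCat {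
  dg_ob :> Type;
  dg_hom : dg_ob -> dg_ob -> complex k;
  dg_id : forall x, dg_hom x x 0;
  dg_comp : forall x y z (m n p : int), m + n = p ->
    dg_hom y z m -> dg_hom x y n -> dg_hom x z p;
  dg_compl : forall x y z (m n p : int) (e : m + n = p) (f : dg_hom x y n),
    linear (fun g : dg_hom y z m => dg_comp e g f);
  dg_compr : forall x y z (m n p : int) (e : m + n = p) (g : dg_hom y z m),
    linear (fun f : dg_hom x y n => dg_comp e g f);
  dg_idl : forall x y (n : int) (e : 0 + n = n) (f : dg_hom x y n),
    dg_comp e (dg_id y) f = f;
  dg_idr : forall x y (n : int) (e : n + 0 = n) (f : dg_hom x y n),
    dg_comp e f (dg_id x) = f;
  dg_assoc : forall x y z t (l m n lm mn p : int)
      (e1 : m + n = mn) (e2 : l + mn = p) (e3 : l + m = lm) (e4 : lm + n = p)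
      (h : dg_hom z t l) (g : dg_hom y z m) (f : dg_hom x y n),
    dg_comp e2 h (dg_comp e1 g f) = dg_comp e4 (dg_comp e3 h g) f;
  dg_d_id : forall x, cx_d 0 (dg_id x) = 0;
  dg_leibniz : forall x y z (m n p : int) (e : m + n = p)
      (e1 : m + 1 + n = p + 1) (e2 : m + (n + 1) = p + 1)
      (g : dg_hom y z m) (f : dg_hom x y n),
    cx_d p (dg_comp e g f) =
      dg_comp e1 (cx_d m g) f + ksign k m *: dg_comp e2 g (cx_d n f) }.

Record is_dgfunctor (k : fieldType) (A B : dgcat k) (F : A -> B)
    (Fh : forall x y n, dg_hom x y n -> dg_hom (F x) (F y) n) : Prop := {
  dgf_chain : forall x y, is_chain_map (Fh x y);
  dgf_id : forall x, Fh x x 0 (dg_id x) = dg_id (F x);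
  dgf_comp : forall x y z (m n p : int) (e : m + n = p)
      (g : dg_hom y z m) (f : dg_hom x y n),
    Fh x z p (dg_comp e g f) = dg_comp e (Fh y z m g) (Fh x y n f) }.

Record dgfunctor (k : fieldType) (A B : dgcat k) := DGFunctor {
  dgf_ob :> A -> B;
  dgf_hom : forall x y n, dg_hom x y n -> dg_hom (dgf_ob x) (dgf_ob y) n;
  dgfP : is_dgfunctor dgf_hom }.

Section DGCatCategory.
Variable k : fieldType.

Lemma dgfunctor_id_subproof (A : dgcat k) :
  is_dgfunctor (F := id) (fun (x y : A) n (f : dg_hom x y n) => f).
Proof. by []. Qed.

Definition dgfunctor_id (A : dgcat k) : dgfunctor A A :=
  DGFunctor (dgfunctor_id_subproof A).

Lemma dgfunctor_comp_subproof (A B C : dgcat k)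
    (G : dgfunctor B C) (F : dgfunctor A B) :
  is_dgfunctor (F := fun x => G (F x))
    (fun x y n (f : dg_hom x y n) => dgf_hom G (dgf_hom F f)).
Proof.
have [Fc F1 FM] := dgfP F; have [Gc G1 GM] := dgfP G.
split=> [x y | x | x y z m n p e g f].
- have [Fl Fd] := Fc x y; have [Gl Gd] := Gc (F x) (F y).
  by split=> [n c u v | n u]; rewrite ?Fl ?Gl ?Fd ?Gd.
- by rewrite F1 G1.
- by rewrite FM GM.
Qed.

Definition dgfunctor_comp (A B C : dgcat k)
    (G : dgfunctor B C) (F : dgfunctor A B) : dgfunctor A C :=
  DGFunctor (dgfunctor_comp_subproof G F).

Program Definition dgcat_category : category :=
  @Category (dgcat k) (@dgfunctor k) dgfunctor_id dgfunctor_comp _ _ _.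
Next Obligation. by case: f => F Fh FP; congr DGFunctor. Qed.
Next Obligation. by case: f => F Fh FP; congr DGFunctor. Qed.
Next Obligation. by congr DGFunctor. Qed.

End DGCatCategory.

Section AlgebraDGCat.
Variables (k : fieldType) (A : algType k).

Definition alg_deg (n : int) : lmodType k :=
  if n is Posz 0 then A : lmodType k else cx_trivial k.

Program Definition alg_complex : complex k :=
  @Complex k alg_deg (fun _ => \0) _.

(* [alg_out] and [alg_in] vanish outside degree 0; they spare [alg_comp] a
   dependent match on the degrees. *)
Definition alg_out (n : int) : alg_deg n -> A :=
  match n return alg_deg n -> A with
  | Posz 0 => id
  | _ => fun _ => 0
  end.

Definition alg_in (n : int) : A -> alg_deg n :=
  match n return A -> alg_deg n with
  | Posz 0 => id
  | _ => fun _ => 0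
  end.

Lemma alg_out_linear n : linear (@alg_out n).
Proof. by case: n => [[|n]|n] c u v //=; rewrite scaler0 addr0. Qed.

Lemma alg_in_linear n : linear (alg_in n).
Proof. by case: n => [[|n]|n] c u v //=; rewrite scaler0 addr0. Qed.

(* The composite of g and f is g * f, so that the right dg modules over
   [alg_dgcat] are the complexes of right A-modules. *)
Definition alg_comp (_ _ _ : unit) (m n p : int) (_ : m + n = p)
    (g : alg_complex m) (f : alg_complex n) : alg_complex p :=
  alg_in p (alg_out g * alg_out f).

Definition alg_id (_ : unit) : alg_complex 0 := 1 : A.

Lemma alg_inK n (x : alg_deg n) : alg_in n (alg_out x) = x.
Proof. by case: n x => [[|n]|n] //= x; apply/rowP => -[]. Qed.

Lemma alg_out_neq0 n (x : alg_deg n) : n != 0 -> alg_out x = 0.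
Proof. by case: n x => [[|n]|n]. Qed.

Lemma alg_outM (m n p : int) (g : alg_deg m) (f : alg_deg n) : m + n = p ->
  alg_out (alg_in p (alg_out g * alg_out f)) = alg_out g * alg_out f.
Proof.
move=> e; have [p0 | p0] := eqVneq p 0; first by rewrite p0.
rewrite alg_out_neq0 //; have [m0 | m0] := eqVneq m 0; last first.
  by rewrite (alg_out_neq0 g m0) mul0r.
by rewrite (alg_out_neq0 f) ?mulr0 //; rewrite m0 add0r in e; rewrite e.
Qed.

Lemma alg_compl (x y z : unit) (m n p : int) (e : m + n = p)
    (f : alg_complex n) :
  linear (fun g : alg_complex m => alg_comp x y z e g f).
Proof.
move=> c g g'; rewrite /alg_comp alg_out_linear mulrDl -scalerAl.
exact: alg_in_linear.
Qed.

Lemma alg_compr (x y z : unit) (m n p : int) (e : m + n = p)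
    (g : alg_complex m) :
  linear (fun f : alg_complex n => alg_comp x y z e g f).
Proof.
move=> c f f'; rewrite /alg_comp alg_out_linear mulrDr -scalerAr.
exact: alg_in_linear.
Qed.

Lemma alg_idl (x y : unit) n (e : 0 + n = n) (f : alg_complex n) :
  alg_comp x y y e (alg_id y) f = f.
Proof. by rewrite /alg_comp mul1r alg_inK. Qed.

Lemma alg_idr (x y : unit) n (e : n + 0 = n) (f : alg_complex n) :
  alg_comp x x y e f (alg_id x) = f.
Proof. by rewrite /alg_comp mulr1 alg_inK. Qed.

Lemma alg_assoc (x y z t : unit) (l m n lm mn p : int) (e1 : m + n = mn)
    (e2 : l + mn = p) (e3 : l + m = lm) (e4 : lm + n = p)
    (h : alg_complex l) (g : alg_complex m) (f : alg_complex n) :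
  alg_comp x z t e2 h (alg_comp x y z e1 g f) =
  alg_comp x y t e4 (alg_comp y z t e3 h g) f.
Proof. by rewrite /alg_comp !alg_outM // mulrA. Qed.

Lemma alg_leibniz (x y z : unit) (m n p : int) (e : m + n = p)
    (e1 : m + 1 + n = p + 1) (e2 : m + (n + 1) = p + 1)
    (g : alg_complex m) (f : alg_complex n) :
  cx_d p (alg_comp x y z e g f) =
  alg_comp x y z e1 (cx_d m g) f + ksign k m *: alg_comp x y z e2 g (cx_d n f).
Proof.
have out0 q : alg_out (0 : alg_deg q) = 0 by case: q => [[]|].
have in0 q : alg_in q 0 = 0 by case: q => [[]|].
by rewrite /alg_comp /= !out0 mul0r mulr0 !in0 scaler0 addr0.
Qed.

Definition alg_dgcat : dgcat k :=
  DGCat alg_compl alg_compr alg_idl alg_idr alg_assoc (fun _ => erefl)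
    alg_leibniz.

End AlgebraDGCat.

Section Triangular.
Variables (k : fieldType) (A : dgcat k).

(* The index i in {1, 2} is encoded as [false] for 1 and [true] for 2, so that
   [i ==> i'] means i <= i'. *)
Definition tri_hom (X Y : bool * A) : complex k :=
  if X.1 ==> Y.1 then dg_hom X.2 Y.2 else cx0 k.

Definition tri_id (X : bool * A) : tri_hom X X 0 :=
  match X return tri_hom X X 0 with
  | (false, x) => dg_id x
  | (true, x) => dg_id x
  end.

Definition tri_comp (X Y Z : bool * A) (m n p : int) (e : m + n = p) :
    tri_hom Y Z m -> tri_hom X Y n -> tri_hom X Z p :=
  match X, Y, Z
    return tri_hom Y Z m -> tri_hom X Y n -> tri_hom X Z p with
  | (false, x), (false, y), (false, z) => fun g f => dg_comp e g f
  | (false, x), (false, y), (true, z) => fun g f => dg_comp e g f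
  | (false, x), (true, y), (true, z) => fun g f => dg_comp e g f
  | (true, x), (true, y), (true, z) => fun g f => dg_comp e g f
  | _, _, _ => fun _ _ => 0
  end.

Lemma tri_compl X Y Z (m n p : int) (e : m + n = p) (f : tri_hom X Y n) :
  linear (fun g : tri_hom Y Z m => tri_comp e g f).
Proof.
case: X Y Z f => [[] x] [[] y] [[] z] f c g g' /=;
  by rewrite ?scaler0 ?addr0 ?dg_compl.
Qed.

Lemma tri_compr X Y Z (m n p : int) (e : m + n = p) (g : tri_hom Y Z m) :
  linear (fun f : tri_hom X Y n => tri_comp e g f).
Proof.
case: X Y Z g => [[] x] [[] y] [[] z] g c f f' /=;
  by rewrite ?scaler0 ?addr0 ?dg_compr.
Qed.

Lemma cx0_eq0 n (x : cx0 k n) : x = 0.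
Proof. by apply/rowP => -[]. Qed.

Lemma tri_idl X Y (n : int) (e : 0 + n = n) (f : tri_hom X Y n) :
  tri_comp e (tri_id Y) f = f.
Proof.
by case: X Y f => [[] x] [[] y] f /=; rewrite ?dg_idl // [f]cx0_eq0.
Qed.

Lemma tri_idr X Y (n : int) (e : n + 0 = n) (f : tri_hom X Y n) :
  tri_comp e f (tri_id X) = f.
Proof.
by case: X Y f => [[] x] [[] y] f /=; rewrite ?dg_idr // [f]cx0_eq0.
Qed.

Lemma dg_comp0l (x y z : A) (m n p : int) (e : m + n = p) (f : dg_hom x y n) :
  dg_comp e (0 : dg_hom y z m) f = 0.
Proof.
have := dg_compl e f (-1) (0 : dg_hom y z m) 0.
by rewrite scaler0 addr0 scaleN1r addNr.
Qed.

Lemma dg_comp0r (x y z : A) (m n p : int) (e : m + n = p) (g : dg_hom y z m) :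
  dg_comp e g (0 : dg_hom x y n) = 0.
Proof.
have := dg_compr e g (-1) (0 : dg_hom x y n) 0.
by rewrite scaler0 addr0 scaleN1r addNr.
Qed.

Lemma tri_assoc X Y Z T (l m n lm mn p : int)
    (e1 : m + n = mn) (e2 : l + mn = p) (e3 : l + m = lm) (e4 : lm + n = p)
    (h : tri_hom Z T l) (g : tri_hom Y Z m) (f : tri_hom X Y n) :
  tri_comp e2 h (tri_comp e1 g f) = tri_comp e4 (tri_comp e3 h g) f.
Proof.
case: X Y Z T h g f => [[] x] [[] y] [[] z] [[] t] h g f //=;
  by rewrite ?dg_comp0l ?dg_comp0r // (dg_assoc e1 e2 e3 e4).
Qed.

Lemma tri_d_id X : cx_d 0 (tri_id X) = 0.
Proof. by case: X => -[] x; apply: dg_d_id. Qed.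

Lemma tri_leibniz X Y Z (m n p : int) (e : m + n = p)
    (e1 : m + 1 + n = p + 1) (e2 : m + (n + 1) = p + 1)
    (g : tri_hom Y Z m) (f : tri_hom X Y n) :
  cx_d p (tri_comp e g f) =
  tri_comp e1 (cx_d m g) f + ksign k m *: tri_comp e2 g (cx_d n f).
Proof.
case: X Y Z g f => [[] x] [[] y] [[] z] g f;
  first [exact: dg_leibniz | by rewrite /= ?linear0 ?scaler0 addr0].
Qed.

Definition tri_dgcat : dgcat k :=
  DGCat tri_compl tri_compr tri_idl tri_idr tri_assoc tri_d_id tri_leibniz.

Lemma tri_incl_subproof (i : bool) :
  is_dgfunctor (B := tri_dgcat) (F := pair i)
    (fun x y n => match i return dg_hom x y n -> tri_hom (i, x) (i, y) n with
                  | false => id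
                  | true => id
                  end).
Proof. by case: i; split. Qed.

Definition tri_incl (i : bool) : dgfunctor A tri_dgcat :=
  DGFunctor (tri_incl_subproof i).

End Triangular.

(* Right dg modules, i.e. dg functors from the opposite of A to complexes,
   written as right actions M(y) ⊗ A(x, y) -> M(x). *)
Record dgmod (k : fieldType) (A : dgcat k) := DGMod {
  mod_at :> A -> complex k;
  mod_act : forall (x y : A) (m n p : int), m + n = p ->
    mod_at y m -> dg_hom x y n -> mod_at x p;
  mod_actl : forall x y (m n p : int) (e : m + n = p) (a : dg_hom x y n),
    linear (fun u : mod_at y m => mod_act e u a);
  mod_actr : forall x y (m n p : int) (e : m + n = p) (u : mod_at y m),
    linear (fun a : dg_hom x y n => mod_act e u a);
  mod_act1 : forall x (n : int) (e : n + 0 = n) (u : mod_at x n),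
    mod_act e u (dg_id x) = u;
  mod_actM : forall x y z (l m n lm mn p : int)
      (e1 : m + n = mn) (e2 : l + mn = p) (e3 : l + m = lm) (e4 : lm + n = p)
      (u : mod_at z l) (b : dg_hom y z m) (a : dg_hom x y n),
    mod_act e2 u (dg_comp e1 b a) = mod_act e4 (mod_act e3 u b) a;
  mod_leibniz : forall x y (m n p : int) (e : m + n = p)
      (e1 : m + 1 + n = p + 1) (e2 : m + (n + 1) = p + 1)
      (u : mod_at y m) (a : dg_hom x y n),
    cx_d p (mod_act e u a) =
      mod_act e1 (cx_d m u) a + ksign k m *: mod_act e2 u (cx_d n a) }.

Record is_dgmod_map (k : fieldType) (A : dgcat k) (M N : dgmod A)
    (f : forall x n, M x n -> N x n) : Prop := {
  modm_chain : forall x, is_chain_map (f x);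
  modm_act : forall x y (m n p : int) (e : m + n = p)
      (u : M y m) (a : dg_hom x y n),
    f x p (mod_act e u a) = mod_act e (f y m u) a }.

Record dgmod_map (k : fieldType) (A : dgcat k) (M N : dgmod A) := DGModMap {
  modm :> forall x n, M x n -> N x n;
  modmP : is_dgmod_map modm }.

Section DGModules.
Variables (k : fieldType) (A : dgcat k).

Lemma dgmod_id_subproof (M : dgmod A) :
  is_dgmod_map (fun x n (u : M x n) => u).
Proof. by []. Qed.

Definition dgmod_id (M : dgmod A) : dgmod_map M M :=
  DGModMap (dgmod_id_subproof M).

Lemma dgmod_comp_subproof (M N P : dgmod A)
    (g : dgmod_map N P) (f : dgmod_map M N) :
  is_dgmod_map (fun x n (u : M x n) => g x n (f x n u)).
Proof.
have [fc fA] := modmP f; have [gc gA] := modmP g.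
split=> [x | x y m n p e u a]; last by rewrite fA gA.
have [fl fd] := fc x; have [gl gd] := gc x.
by split=> [n c u v | n u]; rewrite ?fl ?gl ?fd ?gd.
Qed.

Definition dgmod_comp (M N P : dgmod A)
    (g : dgmod_map N P) (f : dgmod_map M N) : dgmod_map M P :=
  DGModMap (dgmod_comp_subproof g f).

Lemma dgmod_idl (M N : dgmod A) (f : dgmod_map M N) :
  dgmod_comp (dgmod_id N) f = f.
Proof. by case: f => f fP; congr DGModMap. Qed.

Lemma dgmod_idr (M N : dgmod A) (f : dgmod_map M N) :
  dgmod_comp f (dgmod_id M) = f.
Proof. by case: f => f fP; congr DGModMap. Qed.

Lemma dgmod_assoc (M N P Q : dgmod A)
    (h : dgmod_map P Q) (g : dgmod_map N P) (f : dgmod_map M N) :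
  dgmod_comp h (dgmod_comp g f) = dgmod_comp (dgmod_comp h g) f.
Proof. by congr DGModMap. Qed.

Definition dgmod_category : category :=
  Category dgmod_idl dgmod_idr dgmod_assoc.

Definition mod_quasi_iso : morphism_class dgmod_category :=
  fun M N (f : dgmod_map M N) => forall x, is_quasi_iso (f x).

Definition derived_category : category := localization mod_quasi_iso.

End DGModules.

Section Restriction.
Variables (k : fieldType) (A B : dgcat k) (F : dgfunctor A B).

Program Definition restrict_mod (M : dgmod B) : dgmod A :=
  @DGMod k A (fun x => M (F x))
    (fun x y m n p e u a => mod_act e u (dgf_hom F a)) _ _ _ _ _.
Next Obligation. by move=> c u v; rewrite mod_actl. Qed.
Next Obligation.
by have [Fl _] := dgf_chain (dgfP F) x y; move=> c a b; rewrite Fl mod_actr.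
Qed.
Next Obligation. by rewrite (dgf_id (dgfP F)) mod_act1. Qed.
Next Obligation. by rewrite (dgf_comp (dgfP F)); apply: mod_actM. Qed.
Next Obligation.
have [_ Fd] := dgf_chain (dgfP F) x y.
by rewrite Fd; apply: mod_leibniz.
Qed.

Lemma restrict_map_subproof (M N : dgmod B) (f : dgmod_map M N) :
  is_dgmod_map (M := restrict_mod M) (N := restrict_mod N)
    (fun x n u => f (F x) n u).
Proof.
have [fc fA] := modmP f; split=> [x | x y m n p e u a]; last exact: fA.
exact: fc (F x).
Qed.

Definition restrict_map (M N : dgmod B) (f : dgmod_map M N) :
    dgmod_map (restrict_mod M) (restrict_mod N) :=
  DGModMap (restrict_map_subproof f).

Program Definition restriction :
    functor (dgmod_category B) (dgmod_category A) :=
  @Functor (dgmod_category B) (dgmod_category A) restrict_mod restrict_map _ _.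
Next Obligation. by congr DGModMap. Qed.
Next Obligation. by congr DGModMap. Qed.

Lemma restriction_quasi_iso (M N : dgmod_category B) (f : cat_hom M N) :
  mod_quasi_iso f -> mod_quasi_iso (fun_hom restriction f).
Proof. by move=> qf x; apply: (qf (F x)). Qed.

(* Restriction along F : A -> B preserves quasi-isomorphisms, hence passes to
   the derived categories. It is right adjoint to the derived extension of
   scalars, so that one is an equivalence if and only if the other is. *)
Definition derived_restriction :
    functor (derived_category B) (derived_category A) :=
  localized_functor restriction_quasi_iso.

Definition morita_equivalence : Prop := is_equivalence derived_restriction.

End Restriction.

Definition additive_invariant (k : fieldType) (D : additive_category)
    (E : functor (dgcat_category k) D) : Prop :=
  (forall (A B : dgcat k) (F : dgfunctor A B),
      morita_equivalence F -> is_iso (fun_hom E F))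
  /\ forall A : dgcat k,
      is_iso (C := D) (copair (D := D) (fun_hom E (tri_incl A false))
                                       (fun_hom E (tri_incl A true))).

(* Main.v *)
(* A free bimodule, i.e. an algebra map R -> M_I(S), acts on an additive invariant
   E through R -> Mat(S) <- S, where the second functor is a Morita equivalence;
   this action is compatible with composition and sums, and depends only on the
   isomorphism class of the bimodule. If D is a central division algebra of
   dimension n, the inclusion of X in D ⊗ X and the regular representation
   D ⊗ X -> M_n(X) give maps u, v between E(X) and E(D ⊗ X) with v u = n and
   u v = n; the latter because D ⊗ D is isomorphic to D^n as a D-bimodule. By
   Morita invariance A and B may be replaced by division algebras of coprime
   dimensions m and n; in the square formed by E(C), E(A ⊗ C), E(B ⊗ C) and
   E(A ⊗ B ⊗ C), a Bezout relation p m + q n = 1 then yields mutually inverse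
   2 x 2 matrices. *)
From HB Require Import structures.
Require Import Defs.
From mathcomp Require Import all_boot all_order all_algebra all_field.
From mathcomp Require Import boolp functions.
From mathcomp Require classical_sets.

Set Implicit Arguments.
Unset Strict Implicit.
Unset Printing Implicit Defensive.

Import GRing.Theory.
Local Open Scope ring_scope.

(** * Localization of equivalences *)

(** [E] sees only dg functors, up to strict equality, so a bimodule acts only once it is written as
    an actual functor; this is why bimodules are kept free with a chosen basis, and why invariance
    under change of basis needs an argument. Derived categories enter only through a criterion under
    which restriction is already an equivalence on dg modules. Additivity is given for [T(A)] alone.
    Direct sums are obtained from block triangular matrices over S: the functor to the total matrix
    and the two functors to the diagonal blocks are compared on the generators coming from the two
    inclusions. The vanishing of [E] on a zero category is extracted from the same axiom. The number
    n is the dimension of D, the square of the index, which does not affect coprimality. The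
    isomorphism of D ⊗ D with D^n is made explicit by one invertible matrix over D; its
    invertibility is the injectivity of the map from D ⊗ D^op to the k-linear endomorphisms of D. In
    the square, only the faces mixing an inclusion with a regular representation are compared on
    bimodules. The difference in each of the other two is killed by both m and n. *)

Lemma natural_word (C D : category) (W : morphism_class C) (V : morphism_class D)
    (F G : functor C D)
    (FW : forall X Y (f : cat_hom X Y), W X Y f -> V _ _ (fun_hom F f))
    (GW : forall X Y (f : cat_hom X Y), W X Y f -> V _ _ (fun_hom G f))
    (t : forall X, cat_hom (F X) (G X)) :
  (forall X Y (f : cat_hom X Y),
    cat_comp (t Y) (fun_hom F f) = cat_comp (fun_hom G f) (t X)) ->
  forall X Y (a : word W X Y),
  word_eq (word_comp (word_of V (t Y)) (word_map FW a))
          (word_comp (word_map GW a) (word_of V (t X))).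
Proof.
move=> tn X Y a; elim: a => {X Y} [X Y f|X Y w Ww|X Y Z b IHb a IHa] /=.
- apply: word_trans (word_sym (word_ofM _ _ _)) _.
  by rewrite tn; apply: word_ofM.
(* The naturality square of [w], composed on the left with the inverse of G w and on the right with
   the inverse of F w, is the square for the formal inverse. *)
- have h : word_eq (word_comp (word_of V (t Y)) (word_of V (fun_hom F w)))
            (word_comp (word_of V (fun_hom G w)) (word_of V (t X))).
    apply: word_trans (word_sym (word_ofM _ _ _)) _.
    by rewrite tn; apply: word_ofM.
  apply: word_trans (word_sym (word_idl _)) _.
  apply: word_trans (word_congr (word_sym (word_invl (GW _ _ _ Ww)))
    (word_refl _)) _.
  apply: word_trans (word_sym (word_assoc _ _ _)) _.
  apply: word_congr; first exact: word_refl.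
  apply: word_trans (word_assoc _ _ _) _.
  apply: word_trans (word_congr (word_sym h) (word_refl _)) _.
  apply: word_trans (word_sym (word_assoc _ _ _)) _.
  apply: word_trans (word_congr (word_refl _) (word_invr _)) _.
  exact: word_idr.
- apply: word_trans (word_assoc _ _ _) _.
  apply: word_trans (word_congr IHb (word_refl _)) _.
  apply: word_trans (word_sym (word_assoc _ _ _)) _.
  apply: word_trans (word_congr (word_refl _) IHa) _.
  exact: word_assoc.
Qed.

Lemma word_map_id (C : category) (W : morphism_class C)
    (iW : forall X Y (f : cat_hom X Y), W X Y f ->
      W _ _ (fun_hom (functor_id C) f)) X Y (a : word W X Y) :
  word_map iW a = a.
Proof.
elim: a => {X Y} [X Y f|X Y w Ww|X Y Z b IHb a IHa] //=.
  by congr word_inv; apply: Prop_irrelevance.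
by rewrite IHb IHa.
Qed.

Lemma word_map_comp (C D B : category) (W : morphism_class C)
    (V : morphism_class D) (U : morphism_class B)
    (F : functor C D) (G : functor D B)
    (FW : forall X Y (f : cat_hom X Y), W X Y f -> V _ _ (fun_hom F f))
    (GV : forall X Y (f : cat_hom X Y), V X Y f -> U _ _ (fun_hom G f))
    X Y (a : word W X Y) :
  word_map GV (word_map FW a) =
  word_map (F := functor_comp G F) (V := U)
    (fun X Y f Wf => GV _ _ _ (FW X Y f Wf)) a.
Proof. by elim: a => {X Y} /= [X Y f|X Y w Ww|X Y Z b -> a ->]. Qed.

Lemma loc_comp_class (C : category) (W : morphism_class C) X Y Z
    (b : word W Y Z) (a : word W X Y) :
  loc_comp (loc_class b) (loc_class a) = loc_class (word_comp b a).
Proof. by apply/loc_classP/word_congr; apply: word_repr. Qed.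

Lemma loc_is_iso (C : category) (W : morphism_class C) (X Y : C)
    (f : cat_hom X Y) :
  is_iso f ->
  is_iso (C := localization W) (X := X) (Y := Y) (loc_class (word_of W f)).
Proof.
case=> g [gf fg]; exists (loc_class (word_of W g)).
split; rewrite /= loc_comp_class; apply/loc_classP.
  by rewrite -gf; apply/word_sym/word_ofM.
by rewrite -fg; apply/word_sym/word_ofM.
Qed.

Lemma localized_natural (C D : category)
    (W : morphism_class C) (V : morphism_class D) (F : functor C D)
    (G : functor D C)
    (FW : forall X Y (f : cat_hom X Y), W X Y f -> V _ _ (fun_hom F f))
    (GV : forall X Y (f : cat_hom X Y), V X Y f -> W _ _ (fun_hom G f)) :
  naturally_isomorphic (functor_comp G F) (functor_id C) ->
  naturally_isomorphic
    (functor_comp (localized_functor GV) (localized_functor FW))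
    (functor_id (localization W)).
Proof.
case=> t tn ti.
exists (fun X => loc_class (word_of W (t X))) => [X Y f|X]; last first.
  exact: (loc_is_iso W (ti X)).
pose GFW X Y (f : cat_hom X Y) (Wf : W X Y f) := GV _ _ _ (FW _ _ _ Wf).
pose iW X Y (f : cat_hom X Y) (Wf : W X Y f) := Wf.
have := natural_word (F := functor_comp G F) (G := functor_id C) GFW iW tn.
move=> /(_ _ _ (loc_repr f)); rewrite word_map_id => h.
rewrite /= -[f in RHS]loc_reprK loc_comp_class /loc_map.
rewrite loc_comp_class; apply/loc_classP.
refine (word_trans _ h); apply: word_congr; first exact: word_refl.
have := word_map_eq GV (word_repr (word_map FW (loc_repr f))).
by move=> e; refine (word_trans e _); rewrite word_map_comp; apply: word_refl.
Qed.

Lemma localized_equivalence (C D : category)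
    (W : morphism_class C) (V : morphism_class D) (F : functor C D)
    (G : functor D C)
    (FW : forall X Y (f : cat_hom X Y), W X Y f -> V _ _ (fun_hom F f)) :
  (forall X Y (f : cat_hom X Y), V X Y f -> W _ _ (fun_hom G f)) ->
  naturally_isomorphic (functor_comp G F) (functor_id C) ->
  naturally_isomorphic (functor_comp F G) (functor_id D) ->
  is_equivalence (localized_functor FW).
Proof.
by move=> GV GF FG; exists (localized_functor GV); split;
  apply: localized_natural.
Qed.

(** * A criterion for Morita equivalence *)

Section LinearFacts.
Variables (k : fieldType) (V W : lmodType k) (f : V -> W).
Hypothesis lf : linear f.

Lemma linD u v : f (u + v) = f u + f v.
Proof. by rewrite -[u in LHS]scale1r lf scale1r. Qed.

Lemma lin0 : f 0 = 0.
Proof. by apply: (addIr (f 0)); rewrite -linD !add0r. Qed.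

Lemma linZ c u : f (c *: u) = c *: f u.
Proof. by rewrite -[_ *: u]addr0 lf lin0 addr0. Qed.

Lemma lin_sum (I : Type) (r : seq I) (P : pred I) (F : I -> V) :
  f (\sum_(i <- r | P i) F i) = \sum_(i <- r | P i) f (F i).
Proof. exact: (big_morph f linD lin0). Qed.

End LinearFacts.

(** * Products of modules and images of idempotents *)

Section DependentProduct.
Variables (k : fieldType) (I : Type) (V : I -> lmodType k).

Definition pi_mod : Type := forall i, V i.

HB.instance Definition _ := gen_eqMixin pi_mod.
HB.instance Definition _ := gen_choiceMixin pi_mod.

Implicit Types u v w : pi_mod.

Definition pi_zero : pi_mod := fun _ => 0.
Definition pi_opp u : pi_mod := fun i => - u i.
Definition pi_add u v : pi_mod := fun i => u i + v i.
Definition pi_scale (c : k) u : pi_mod := fun i => c *: u i.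

Lemma pi_addA : associative pi_add.
Proof. by move=> u v w; apply: functional_extensionality_dep => i; apply: addrA. Qed.
Lemma pi_addC : commutative pi_add.
Proof. by move=> u v; apply: functional_extensionality_dep => i; apply: addrC. Qed.
Lemma pi_add0 : left_id pi_zero pi_add.
Proof. by move=> u; apply: functional_extensionality_dep => i; apply: add0r. Qed.
Lemma pi_addN : left_inverse pi_zero pi_opp pi_add.
Proof. by move=> u; apply: functional_extensionality_dep => i; apply: addNr. Qed.

HB.instance Definition _ :=
  GRing.isZmodule.Build pi_mod pi_addA pi_addC pi_add0 pi_addN.

Lemma pi_scaleA a b u : pi_scale a (pi_scale b u) = pi_scale (a * b) u.
Proof. by apply: functional_extensionality_dep => i; apply: scalerA. Qed.
Lemma pi_scale1 : left_id 1 pi_scale.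
Proof. by move=> u; apply: functional_extensionality_dep => i; apply: scale1r. Qed.
Lemma pi_scaleDr : right_distributive pi_scale +%R.
Proof. by move=> c u v; apply: functional_extensionality_dep => i; apply: scalerDr. Qed.
Lemma pi_scaleDl u : {morph pi_scale^~ u : a b / a + b}.
Proof. by move=> a b; apply: functional_extensionality_dep => i; apply: scalerDl. Qed.

HB.instance Definition _ := GRing.Zmodule_isLmodule.Build k pi_mod
  pi_scaleA pi_scale1 pi_scaleDr pi_scaleDl.

Lemma pi_linP (c : k) u v i : (c *: u + v) i = c *: u i + v i.
Proof. by []. Qed.

End DependentProduct.

Section FixedModule.
Variables (k : fieldType) (V : lmodType k) (f : V -> V) (lf : linear f).

(* [lf] is an argument so that canonical structure inference can find it. *)
Definition fixed_by (_ : linear f) : pred V := fun v => f v == v.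

Lemma fixed_by_closed : submod_closed (fixed_by lf).
Proof.
split; first by rewrite /in_mem /= /fixed_by lin0.
by move=> c u v /eqP uf /eqP vf; rewrite /in_mem /= /fixed_by lf uf vf.
Qed.

HB.instance Definition _ := GRing.isSubmodClosed.Build k V (fixed_by lf)
  fixed_by_closed.

(** For an idempotent [f] the fixed vectors are its image; this is how idempotents are split
    below. *)
Definition fixed_mod := {v | fixed_by lf v}.
HB.instance Definition _ := SubChoice.on fixed_mod.
HB.instance Definition _ := [SubChoice_isSubLmodule of fixed_mod by <:].

Lemma fixed_modP (u : fixed_mod) : f (val u) = val u.
Proof. exact/eqP/(valP u). Qed.

Lemma fix_valE (u v : fixed_mod) c : val (u + c *: v) = val u + c *: val v.
Proof. by rewrite addrC linearP addrC. Qed.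

Definition fix_mod (v : V) (fv : f v = v) : fixed_mod :=
  exist _ v (introT eqP fv).

End FixedModule.

Lemma dgmod_map_eq (k : fieldType) (A : dgcat k) (M N : dgmod A)
    (f g : dgmod_map M N) :
  (forall x n (u : M x n), f x n u = g x n u) -> f = g.
Proof.
case: f g => [f fP] [g gP] /= fg; have {}fg : f = g.
  by do 3![apply: functional_extensionality_dep => ?]; apply: fg.
by rewrite fg in fP *; congr DGModMap; apply: Prop_irrelevance.
Qed.

Lemma dgmod_is_iso (k : fieldType) (A : dgcat k) (M N : dgmod A)
    (f : dgmod_map M N) (h : forall x n, N x n -> M x n) :
  (forall x n, cancel (@f x n) (@h x n)) ->
  (forall x n, cancel (@h x n) (@f x n)) ->
  is_iso (C := dgmod_category A) f.
Proof.
move=> fK hK; have [fc fA] := modmP f.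
have hP : is_dgmod_map h.
  split=> [x | x y m n p e u c]; last first.
    by apply: (can_inj (@fK x p)); rewrite fA !hK.
  have [fl fd] := fc x; split=> [n c u v | n u].
    by apply: (can_inj (@fK x n)); rewrite fl !hK.
  by apply: (can_inj (@fK x (n + 1))); rewrite fd !hK.
exists (DGModMap hP : @cat_hom (dgmod_category A) N M).
by split; apply: dgmod_map_eq => x n u /=; rewrite ?fK ?hK.
Qed.

(* The inverse of restriction along F sends M to the module whose value at y is
   the image of the idempotent with entries a_j b_i in the product of the
   M (ob i). *)
Section Extension.
Variables (k : fieldType) (A B : dgcat k) (F : dgfunctor A B).
Variable g : forall x y n, dg_hom (F x) (F y) n -> dg_hom x y n.
Hypothesis gK : forall x y n, cancel (@g x y n) (@dgf_hom _ _ _ F x y n).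
Hypothesis Kg : forall x y n, cancel (@dgf_hom _ _ _ F x y n) (@g x y n).
Variable idx : B -> finType.
Variable ob : forall y, idx y -> A.
Variable a : forall y i, dg_hom y (F (@ob y i)) 0.
Variable b : forall y i, dg_hom (F (@ob y i)) y 0.
Hypothesis da : forall y i, cx_d 0 (@a y i) = 0.
Hypothesis db : forall y i, cx_d 0 (@b y i) = 0.
Hypothesis ba : forall y, \sum_i dg_comp (addr0 0) (b i) (a i) = dg_id y.

Let FL x y n := (dgf_chain (dgfP F) x y).1 n.

Let Finj x y n (u v : dg_hom x y n) : dgf_hom F u = dgf_hom F v -> u = v.
Proof. exact: (can_inj (@Kg x y n)). Qed.

(** Matrix entry of [c] when [y'] and [y] are viewed as summands of sums of objects F (ob i), pulled
    back to A by full faithfulness. *)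
Definition comps (y' y : B) n (c : dg_hom y' y n) (i : idx y') (j : idx y) :
    dg_hom (ob i) (ob j) n :=
  g (dg_comp (add0r n) (a j) (dg_comp (addr0 n) c (b i))).

Lemma comps_linear y' y n i j :
  linear (fun c : dg_hom y' y n => comps c i j).
Proof.
move=> s c c'; apply: Finj; rewrite FL !gK.
by rewrite dg_compl dg_compr.
Qed.

(** Inserting [ba] between [d] and [c] makes the matrices multiply. The matrix of an identity,
    however, is only an idempotent, with entries a_j b_i. *)
Lemma compsM (x y z : B) (m n p : int) (e : m + n = p)
    (d : dg_hom y z m) (c : dg_hom x y n) i j :
  comps (dg_comp e d c) i j = \sum_l dg_comp e (comps d l j) (comps c i l).
Proof.
apply: Finj; rewrite gK (lin_sum (@FL _ _ _)).
under eq_bigr => l _.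
  rewrite (dgf_comp (dgfP F)) !gK.
  rewrite -(dg_assoc e (add0r p) (add0r m) e).
  rewrite -(dg_assoc (add0r n) e (addr0 m) e).
  rewrite (dg_assoc (add0r n) (add0r n) (addr0 0) (add0r n)).
  over.
rewrite -(lin_sum (dg_compr (add0r p) (a j))).
rewrite -(lin_sum (dg_compr e d)).
rewrite -(lin_sum (fun s u v => dg_compl (add0r n) (dg_comp (addr0 n) c (b i)) s u v)).
by rewrite ba dg_idl (dg_assoc (addr0 n) e e (addr0 p)).
Qed.

Lemma comps_d y' y n (c : dg_hom y' y n) i j :
  cx_d n (comps c i j) = comps (cx_d n c) i j.
Proof.
apply: Finj; rewrite (dgf_chain (dgfP F) _ _).2 !gK.
have e0 : 0 + 1 + n = n + 1 by rewrite add0r addrC.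
rewrite (dg_leibniz (add0r n) e0 (add0r (n + 1))) da dg_comp0l add0r.
rewrite /ksign expr0z scale1r; congr dg_comp.
have e1 : n + (0 + 1) = n + 1 by rewrite add0r.
rewrite (dg_leibniz (addr0 n) (addr0 (n + 1)) e1) db dg_comp0r scaler0.
by rewrite addr0.
Qed.

Section ExtensionModule.
Variable M : dgmod A.

Definition family (y : B) (n : int) : lmodType k :=
  pi_mod (fun i : idx y => M (ob i) n).

(** This action is associative but not unital: [dg_id y] acts as the idempotent. Unitality is
    recovered in [ext_deg] by restricting to the families it fixes. *)
Definition fam_act (x y : B) (m n p : int) (e : m + n = p)
    (u : family y m) (c : dg_hom x y n) : family x p :=
  fun i => \sum_j mod_act e (u j) (comps c i j).

Lemma fam_actl x y (m n p : int) (e : m + n = p) (c : dg_hom x y n) :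
  linear (fun u : family y m => fam_act e u c).
Proof.
move=> s u v; apply: functional_extensionality_dep => i.
rewrite pi_linP /fam_act scaler_sumr -big_split; apply: eq_bigr => j _.
by rewrite pi_linP mod_actl.
Qed.

Lemma fam_actr x y (m n p : int) (e : m + n = p) (u : family y m) :
  linear (fun c : dg_hom x y n => fam_act e u c).
Proof.
move=> s c c'; apply: functional_extensionality_dep => i.
rewrite pi_linP /fam_act scaler_sumr -big_split; apply: eq_bigr => j _.
by rewrite comps_linear mod_actr.
Qed.

Lemma fam_actM x y z (l m n lm mn p : int)
    (e1 : m + n = mn) (e2 : l + mn = p) (e3 : l + m = lm) (e4 : lm + n = p)
    (u : family z l) (d : dg_hom y z m) (c : dg_hom x y n) :
  fam_act e2 u (dg_comp e1 d c) = fam_act e4 (fam_act e3 u d) c.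
Proof.
apply: functional_extensionality_dep => i; rewrite /fam_act.
under eq_bigr => j _.
  rewrite compsM (lin_sum (mod_actr e2 (u j))).
  under eq_bigr => q _ do rewrite (mod_actM e1 e2 e3 e4).
  over.
rewrite exchange_big; apply: eq_bigr => q _.
by rewrite (lin_sum (fun s v w => mod_actl e4 (comps c i q) s v w)).
Qed.

Definition fam_d y n (u : family y n) : family y (n + 1) :=
  fun i => cx_d n (u i).

Lemma fam_leibniz x y (m n p : int) (e : m + n = p)
    (e1 : m + 1 + n = p + 1) (e2 : m + (n + 1) = p + 1)
    (u : family y m) (c : dg_hom x y n) :
  fam_d (fam_act e u c) =
    fam_act e1 (fam_d u) c + ksign k m *: fam_act e2 u (cx_d n c).
Proof.
apply: functional_extensionality_dep => i.
transitivity (fam_act e1 (fam_d u) c i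
  + ksign k m *: fam_act e2 u (cx_d n c) i); last by [].
rewrite /fam_act /fam_d linear_sum scaler_sumr -big_split.
by apply: eq_bigr => j _; rewrite (mod_leibniz e e1 e2) comps_d.
Qed.

Lemma fam_d_id y n (u : family y n) :
  fam_d (fam_act (addr0 n) u (dg_id y)) =
  fam_act (addr0 (n + 1)) (fam_d u) (dg_id y).
Proof.
have e1 : n + (0 + 1) = n + 1 by rewrite add0r.
rewrite (fam_leibniz (addr0 n) (addr0 (n + 1)) e1) dg_d_id.
by rewrite (lin0 (fam_actr e1 u)) scaler0 addr0.
Qed.

(** The action always lands in the image of the idempotent. For [c] an identity this is idempotency
    itself, so that any family can be projected into [ext_deg]. *)
Lemma fam_id_act y n (u : family y n) x m (c : dg_hom x y m)
    p (e' : n + m = p) (e : p + 0 = p) :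
  fam_act e (fam_act e' u c) (dg_id x) = fam_act e' u c.
Proof. by rewrite -(fam_actM (addr0 m) e') dg_idr. Qed.

Definition ext_deg (y : B) (n : int) : lmodType k :=
  fixed_mod (fam_actl (addr0 n) (dg_id y)).

Lemma ext_d_subproof y n (u : ext_deg y n) :
  fam_act (addr0 (n + 1)) (fam_d (val u)) (dg_id y) = fam_d (val u).
Proof. by rewrite -fam_d_id (fixed_modP u). Qed.

Definition ext_d_fun y n (u : ext_deg y n) : ext_deg y (n + 1) :=
  fix_mod _ (ext_d_subproof u).

Lemma ext_d_linear y n : linear (@ext_d_fun y n).
Proof.
move=> s u v; apply: val_inj; rewrite linearP /=.
by apply: functional_extensionality_dep => i; rewrite pi_linP /fam_d linearP.
Qed.

HB.instance Definition _ y n :=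
  GRing.isLinear.Build k (ext_deg y n) (ext_deg y (n + 1)) _ (@ext_d_fun y n)
    (@ext_d_linear y n).

Lemma ext_dd y n (u : ext_deg y n) : ext_d_fun (ext_d_fun u) = 0.
Proof.
by apply: val_inj; apply: functional_extensionality_dep => i; apply: cx_dd.
Qed.

Definition ext_complex (y : B) : complex k :=
  @Complex k (ext_deg y) (fun n => @ext_d_fun y n) (@ext_dd y).

Definition ext_act (x y : B) (m n p : int) (e : m + n = p)
    (u : ext_complex y m) (c : dg_hom x y n) : ext_complex x p :=
  fix_mod _ (fam_id_act (val u) c e (addr0 p)).

Lemma ext_actl x y (m n p : int) (e : m + n = p) (c : dg_hom x y n) :
  linear (fun u : ext_complex y m => ext_act e u c).
Proof.
move=> s u v; apply: val_inj; rewrite linearP -[RHS]fam_actl.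
by congr fam_act; rewrite linearP.
Qed.

Lemma ext_actr x y (m n p : int) (e : m + n = p) (u : ext_complex y m) :
  linear (fun c : dg_hom x y n => ext_act e u c).
Proof. by move=> s c c'; apply: val_inj; rewrite linearP; apply: fam_actr. Qed.

Lemma ext_act1 x (n : int) (e : n + 0 = n) (u : ext_complex x n) :
  ext_act e u (dg_id x) = u.
Proof.
apply: val_inj; rewrite /= (Prop_irrelevance e (addr0 n)).
exact: (fixed_modP u).
Qed.

Definition ext_mod : dgmod B.
Proof.
refine (@DGMod k B ext_complex ext_act ext_actl ext_actr ext_act1 _ _).
- by move=> *; apply: val_inj; apply: fam_actM.
- by move=> *; apply: val_inj; rewrite fix_valE; apply: fam_leibniz.
Defined.

End ExtensionModule.


Lemma mod_closed0 (D : dgcat k) (M : dgmod D) x y n (u : M y n)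
    (c : dg_hom x y 0) : cx_d 0 c = 0 ->
  cx_d n (mod_act (addr0 n) u c) = mod_act (addr0 (n + 1)) (cx_d n u) c.
Proof.
move=> dc; have e1 : n + (0 + 1) = n + 1 by rewrite add0r.
rewrite (mod_leibniz (addr0 n) (addr0 (n + 1)) e1) dc.
by rewrite (lin0 (mod_actr e1 u)) scaler0 addr0.
Qed.

Section ExtensionMap.
Variables (M N : dgmod A) (f : dgmod_map M N).

Definition fam_map y n (u : family M y n) : family N y n :=
  fun i => f (ob i) n (u i).

Let fl x n : linear (f x n) := (modm_chain (modmP f) x).1 n.

Lemma fam_map_act x y (m n p : int) (e : m + n = p)
    (u : family M y m) (c : dg_hom x y n) :
  fam_act e (fam_map u) c = fam_map (fam_act e u c).
Proof.
apply: functional_extensionality_dep => i.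
rewrite /fam_map (lin_sum (@fl _ _)); apply: eq_bigr => j _.
by rewrite (modm_act (modmP f)).
Qed.

Lemma fam_map_d y n (u : family M y n) : fam_map (fam_d u) = fam_d (fam_map u).
Proof.
apply: functional_extensionality_dep => i.
exact: (modm_chain (modmP f) (ob i)).2.
Qed.

Lemma ext_map_subproof y n (u : ext_mod M y n) :
  fam_act (addr0 n) (fam_map (val u)) (dg_id y) = fam_map (val u).
Proof. by rewrite fam_map_act (fixed_modP u). Qed.

Definition ext_map_fun y n (u : ext_mod M y n) : ext_mod N y n :=
  fix_mod _ (ext_map_subproof u).

Lemma ext_map_funP : is_dgmod_map (M := ext_mod M) (N := ext_mod N) ext_map_fun.
Proof.
split=> [y | x y m n p e u c]; last by apply: val_inj; rewrite /= fam_map_act.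
split=> [n c u v | n u]; apply: val_inj; last exact: fam_map_d.
by apply: functional_extensionality_dep => i; apply: (@fl _ _ c).
Qed.

Definition ext_map : dgmod_map (ext_mod M) (ext_mod N) := DGModMap ext_map_funP.

(** Preimages are chosen component by component, which needs only that the index type is finite.
    They need not be fixed by the idempotent, so they are projected by it; nothing is lost because
    the idempotent commutes with the differentials and with [f] and fixes the given cycles. *)
Lemma ext_quasi_iso :
  mod_quasi_iso (f : @cat_hom (dgmod_category A) M N) ->
  mod_quasi_iso (ext_map : @cat_hom (dgmod_category B) _ _).
Proof.
move=> qf y n; split=> [z dz [w fz]|w dw].
- have h i : exists v : M (ob i) n, val z i = cx_d n v.
    apply: (qf (ob i) n).1; last first.
      exists (val w i); exact: (congr1 (fun t : ext_mod N y _ => val t i) fz).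
    exact: (congr1 (fun t : ext_mod M y _ => val t i) dz).
  have [v vP] := fin_all_exists h.
  have v1 := fam_id_act (M := M) v (dg_id y) (addr0 n) (addr0 n).
  exists (fix_mod _ v1 : ext_mod M y n); apply: val_inj => /=.
  rewrite fam_d_id -[LHS](fixed_modP z); congr fam_act.
  exact: functional_extensionality_dep.
- have h i : exists z : M (ob i) (n + 1) * N (ob i) n,
      cx_d _ z.1 = 0 /\ val w i = f _ _ z.1 + cx_d _ z.2.
    have dwi : cx_d _ (val w i) = 0.
      exact: (congr1 (fun t : ext_mod N y _ => val t i) dw).
    by have [z dz [w' e]] := (qf (ob i) n).2 _ dwi; exists (z, w').
  have {h}[zw zwP] := fin_all_exists h.
  pose z : family M y (n + 1) := fun i => (zw i).1.
  pose w' : family N y n := fun i => (zw i).2.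
  have dz : fam_d z = 0.
    by apply: functional_extensionality_dep => i; apply: (zwP i).1.
  have zfix := fam_id_act z (dg_id y) (addr0 (n + 1)) (addr0 (n + 1)).
  have wfix := fam_id_act w' (dg_id y) (addr0 n) (addr0 n).
  exists (fix_mod _ zfix : ext_mod M y (n + 1)).
    apply: val_inj => /=; rewrite fam_d_id dz.
    by rewrite (lin0 (@fam_actl M y y _ _ _ _ (dg_id y))).
  exists (fix_mod _ wfix : ext_mod N y n); apply: val_inj.
  rewrite -[cx_d _ _]scale1r fix_valE scale1r /=.
  rewrite -fam_map_act fam_d_id -[LHS](fixed_modP w).
  rewrite -(linD (@fam_actl N y y _ _ _ _ (dg_id y))); congr fam_act.
  by apply: functional_extensionality_dep => i; apply: (zwP i).2.
Qed.

End ExtensionMap.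

Definition extension : functor (dgmod_category A) (dgmod_category B).
Proof.
refine (@Functor (dgmod_category A) (dgmod_category B) ext_mod ext_map _ _).
- by move=> M; apply: dgmod_map_eq => x n u; apply: val_inj.
- by move=> M N P f h; apply: dgmod_map_eq => x n u; apply: val_inj.
Defined.

Section Counit.
Variable N : dgmod B.

Definition counit_fun y n (u : ext_mod (restrict_mod F N) y n) : N y n :=
  \sum_i mod_act (addr0 n) (val u i : N (F (ob i)) n) (a i).

Lemma counitP : is_dgmod_map counit_fun.
Proof.
split=> [y | x y m n p e u c].
  split=> [n s u v | n u]; rewrite /counit_fun.
    rewrite scaler_sumr -big_split; apply: eq_bigr => i _ /=.
    by rewrite -[RHS]mod_actl.
  by rewrite linear_sum; apply: eq_bigr => i _; rewrite mod_closed0.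
rewrite /counit_fun (lin_sum (fun s v w => mod_actl e c s v w)).
under eq_bigr => i _ do
  rewrite (lin_sum (fun s v w => mod_actl (addr0 p) (a i) s v w)).
rewrite exchange_big; apply: eq_bigr => j _ /=.
under eq_bigr => i _ do
  rewrite gK -(mod_actM (addr0 n) e) -(dg_assoc (addr0 n) (add0r n) (add0r n))
    -(dg_assoc (addr0 0) (addr0 n) (addr0 n)).
rewrite -(lin_sum (mod_actr e _)) -(lin_sum (dg_compr (add0r n) (a j))).
rewrite -(lin_sum (dg_compr (addr0 n) c)) ba dg_idr.
exact: mod_actM.
Qed.

Lemma unit_subproof y n (v : N y n) :
  fam_act (M := restrict_mod F N) (addr0 n)
    (fun i => mod_act (addr0 n) v (b i)) (dg_id y) =
  fun i => mod_act (addr0 n) v (b i).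
Proof.
apply: functional_extensionality_dep => i; rewrite /fam_act /= .
under eq_bigr => j _ do rewrite gK -(mod_actM (addr0 0) (addr0 n)) dg_idl
  (dg_assoc (add0r 0) (addr0 0) (addr0 0) (add0r 0)).
rewrite -(lin_sum (mod_actr (addr0 n) v)).
rewrite -(lin_sum (fun s u w => dg_compl (add0r 0) (b i) s u w)) ba.
by rewrite dg_idl.
Qed.

(** The inverse sends v to the family of the v b_i. One composite is the idempotent, which fixes
    [u]; the other is the action of the sum of the b_i a_i, which is the identity by [ba]. *)
Lemma counit_iso :
  is_iso (C := dgmod_category B) (DGModMap counitP).
Proof.
pose h y n (v : N y n) : ext_mod (restrict_mod F N) y n :=
  fix_mod _ (unit_subproof v).
apply: (dgmod_is_iso (h := h)) => y n u /=; rewrite /h /counit_fun.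
  apply: val_inj; apply: functional_extensionality_dep => i.
  rewrite -[in RHS](fixed_modP u) /= /fam_act.
  rewrite (lin_sum (fun s v w => mod_actl (addr0 n) (b i) s v w)).
  apply: eq_bigr => j _ /=.
  by rewrite gK dg_idl (mod_actM (add0r 0) (addr0 n) (addr0 n) (addr0 n)).
under eq_bigr => i _ do rewrite -(mod_actM (addr0 0) (addr0 n)).
by rewrite -(lin_sum (mod_actr (addr0 n) u)) ba mod_act1.
Qed.

End Counit.


Section Retraction.
Variable M : dgmod A.

Let ga x (i : idx (F x)) : dg_hom x (ob i) 0 := g (a i).
Let gb x (i : idx (F x)) : dg_hom (ob i) x 0 := g (b i).

Let dga x (i : idx (F x)) : cx_d 0 (ga i) = 0.
Proof.
by apply: Finj; rewrite (dgf_chain (dgfP F) _ _).2 gK da (lin0 (@FL _ _ _)).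
Qed.

Let comps_F x y n (c : dg_hom x y n) (i : idx (F x)) (j : idx (F y)) :
  comps (dgf_hom F c) i j = dg_comp (add0r n) (ga j) (dg_comp (addr0 n) c (gb i)).
Proof. by apply: Finj; rewrite gK !(dgf_comp (dgfP F)) !gK. Qed.

Let comps_id x (i j : idx (F x)) :
  comps (dg_id (F x)) i j = dg_comp (add0r 0) (ga j) (gb i).
Proof. by rewrite -(dgf_id (dgfP F)) comps_F dg_idl. Qed.

Let gba x : \sum_(i : idx (F x)) dg_comp (addr0 0) (gb i) (ga i) = dg_id x.
Proof.
apply: Finj; rewrite (lin_sum (@FL _ _ _)) (dgf_id (dgfP F)) -ba.
by apply: eq_bigr => i _; rewrite (dgf_comp (dgfP F)) !gK.
Qed.

(** As F is fully faithful, the presentation of F x as a summand pulls back to one of x in A, with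
    structure maps [ga] and [gb]; the argument for the counit then applies inside A. *)
Definition retract_fun x n (u : restrict_mod F (ext_mod M) x n) : M x n :=
  \sum_i mod_act (addr0 n) (val u i : M (ob i) n) (ga i).

Lemma retractP : is_dgmod_map retract_fun.
Proof.
split=> [y | x y m n p e u c].
  split=> [n s u v | n u]; rewrite /retract_fun.
    rewrite scaler_sumr -big_split; apply: eq_bigr => i _ /=.
    by rewrite -[RHS]mod_actl.
  by rewrite linear_sum; apply: eq_bigr => i _; rewrite mod_closed0.
rewrite /retract_fun (lin_sum (fun s v w => mod_actl e c s v w)).
under eq_bigr => i _ do
  rewrite (lin_sum (fun s v w => mod_actl (addr0 p) (ga i) s v w)).
rewrite exchange_big; apply: eq_bigr => j _ /=.
under eq_bigr => i _ do
  rewrite comps_F -(mod_actM (addr0 n) e)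
    -(dg_assoc (addr0 n) (add0r n) (add0r n))
    -(dg_assoc (addr0 0) (addr0 n) (addr0 n)).
rewrite -(lin_sum (mod_actr e _)) -(lin_sum (dg_compr (add0r n) (ga j))).
rewrite -(lin_sum (dg_compr (addr0 n) c)) gba dg_idr.
exact: mod_actM.
Qed.

Lemma section_subproof x n (v : M x n) :
  fam_act (M := M) (addr0 n)
    (fun i => mod_act (addr0 n) v (gb i)) (dg_id (F x)) =
  fun i => mod_act (addr0 n) v (gb i).
Proof.
apply: functional_extensionality_dep => i; rewrite /fam_act /= .
under eq_bigr => j _ do rewrite comps_id -(mod_actM (addr0 0) (addr0 n))
  (dg_assoc (add0r 0) (addr0 0) (addr0 0) (add0r 0)).
rewrite -(lin_sum (mod_actr (addr0 n) v)).
rewrite -(lin_sum (fun s u w => dg_compl (add0r 0) (gb i) s u w)) gba.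
by rewrite dg_idl.
Qed.

Lemma retract_iso : is_iso (C := dgmod_category A) (DGModMap retractP).
Proof.
pose h x n (v : M x n) : restrict_mod F (ext_mod M) x n :=
  fix_mod _ (section_subproof v).
apply: (dgmod_is_iso (h := h)) => y n u /=; rewrite /h /retract_fun.
  apply: val_inj; apply: functional_extensionality_dep => i.
  rewrite -[in RHS](fixed_modP u) /= /fam_act.
  rewrite (lin_sum (fun s v w => mod_actl (addr0 n) (gb i) s v w)).
  apply: eq_bigr => j _ /=.
  by rewrite comps_id (mod_actM (add0r 0) (addr0 n) (addr0 n) (addr0 n)).
under eq_bigr => i _ do rewrite -(mod_actM (addr0 0) (addr0 n)).
by rewrite -(lin_sum (mod_actr (addr0 n) u)) gba mod_act1.
Qed.

End Retraction.

Lemma extension_restriction_id :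
  naturally_isomorphic (functor_comp extension (restriction F))
    (functor_id (dgmod_category B)).
Proof.
exists (fun N => DGModMap (counitP N)); last exact: counit_iso.
move=> M N f; apply: dgmod_map_eq => x n u /=; rewrite /counit_fun /=.
have [fc fA] := modmP f.
rewrite (lin_sum ((fc x).1 n)); apply: eq_bigr => i _.
by rewrite fA.
Qed.

Lemma restriction_extension_id :
  naturally_isomorphic (functor_comp (restriction F) extension)
    (functor_id (dgmod_category A)).
Proof.
exists (fun M => DGModMap (retractP M)); last exact: retract_iso.
move=> M N f; apply: dgmod_map_eq => x n u /=; rewrite /retract_fun /=.
have [fc fA] := modmP f.
rewrite (lin_sum ((fc x).1 n)); apply: eq_bigr => i _.
by rewrite fA.
Qed.

End Extension.

(* y is a direct summand of the finite direct sum of the F (sm_ob i). *)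
Record summand (k : fieldType) (A B : dgcat k) (F : dgfunctor A B) (y : B) :=
  Summand {
    sm_idx : finType;
    sm_ob : sm_idx -> A;
    sm_to : forall i, dg_hom y (F (sm_ob i)) 0;
    sm_from : forall i, dg_hom (F (sm_ob i)) y 0;
    sm_d_to : forall i, cx_d 0 (sm_to i) = 0;
    sm_d_from : forall i, cx_d 0 (sm_from i) = 0;
    sm_sum : \sum_i dg_comp (addr0 0) (sm_from i) (sm_to i) = dg_id y }.

(** Restriction and its inverse are quasi-inverse on dg modules themselves and both preserve
    quasi-isomorphisms, so the equivalence descends to the localizations without derived
    functors. *)
Lemma morita_of_summands (k : fieldType) (A B : dgcat k) (F : dgfunctor A B) :
  (forall x y n, bijective (@dgf_hom _ _ _ F x y n)) ->
  (forall y, summand F y) -> morita_equivalence F.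
Proof.
move=> Fbij S.
have h x y n : {g | cancel (@dgf_hom _ _ _ F x y n) g
                  & cancel g (@dgf_hom _ _ _ F x y n)}.
  by apply: cid2; case: (Fbij x y n) => g; exists g.
pose g x y n := s2val (h x y n).
have Kg x y n := s2valP (h x y n).
have gK x y n := s2valP' (h x y n).
pose da y := sm_d_to (s := S y).
pose db y := sm_d_from (s := S y).
pose ba y := sm_sum (S y).
rewrite /morita_equivalence /derived_restriction.
refine (localized_equivalence (G := extension gK Kg da db ba) _ _ _ _).
- by move=> M N f; apply: ext_quasi_iso.
- exact: extension_restriction_id.
- exact: restriction_extension_id.
Qed.

(** * Linear categories as dg categories *)

Record lincat (k : fieldType) := LinCat {
  lin_ob :> Type;
  lin_hom : lin_ob -> lin_ob -> lmodType k;
  lin_id : forall x, lin_hom x x;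
  lin_comp : forall x y z, lin_hom y z -> lin_hom x y -> lin_hom x z;
  lin_compl : forall x y z (f : lin_hom x y),
    linear (fun g : lin_hom y z => lin_comp g f);
  lin_compr : forall x y z (g : lin_hom y z),
    linear (fun f : lin_hom x y => lin_comp g f);
  lin_idl : forall x y (f : lin_hom x y), lin_comp (lin_id y) f = f;
  lin_idr : forall x y (f : lin_hom x y), lin_comp f (lin_id x) = f;
  lin_assoc : forall x y z t
      (h : lin_hom z t) (g : lin_hom y z) (f : lin_hom x y),
    lin_comp h (lin_comp g f) = lin_comp (lin_comp h g) f }.

Section Degree0.
Variables (k : fieldType) (V : lmodType k).

(** Same shape as [alg_deg], so that the dg category of an algebra is recovered on the nose in
    [alg_dgcatE]. *)
Definition deg0 (n : int) : lmodType k :=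
  if n is Posz 0 then V else cx_trivial k.

Program Definition deg0_complex : complex k :=
  @Complex k deg0 (fun _ => \0) _.

Definition deg0_out (n : int) : deg0 n -> V :=
  match n return deg0 n -> V with
  | Posz 0 => id
  | _ => fun _ => 0
  end.

Definition deg0_in (n : int) : V -> deg0 n :=
  match n return V -> deg0 n with
  | Posz 0 => id
  | _ => fun _ => 0
  end.

Lemma deg0_out_linear n : linear (@deg0_out n).
Proof. by case: n => [[|n]|n] c u v //=; rewrite scaler0 addr0. Qed.

Lemma deg0_in_linear n : linear (deg0_in n).
Proof. by case: n => [[|n]|n] c u v //=; rewrite scaler0 addr0. Qed.

Lemma deg0_outK n (x : deg0 n) : deg0_in n (deg0_out x) = x.
Proof. by case: n x => [[|n]|n] //= x; apply/rowP => -[]. Qed.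

Lemma deg0_out_neq0 n (x : deg0 n) : n != 0 -> deg0_out x = 0.
Proof. by case: n x => [[|n]|n]. Qed.

Lemma deg0_out0 n : deg0_out (0 : deg0 n) = 0.
Proof. exact: lin0 (@deg0_out_linear n). Qed.

Lemma deg0_in0 n : deg0_in n 0 = 0.
Proof. exact: lin0 (@deg0_in_linear n). Qed.

End Degree0.

Section LinDGCat.
Variables (k : fieldType) (L : lincat k).

Definition lin_complex (x y : L) : complex k := deg0_complex (lin_hom x y).

Definition lin_dg_comp (x y z : L) (m n p : int) (_ : m + n = p)
    (g : lin_complex y z m) (f : lin_complex x y n) : lin_complex x z p :=
  deg0_in p (lin_comp (deg0_out g) (deg0_out f)).

Lemma lin_comp0l (x y z : L) (f : lin_hom x y) :
  lin_comp (0 : lin_hom y z) f = 0.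
Proof. exact: lin0 (fun s u v => lin_compl f s u v). Qed.

Lemma lin_comp0r (x y z : L) (g : lin_hom y z) :
  lin_comp g (0 : lin_hom x y) = 0.
Proof. exact: lin0 (fun s u v => lin_compr g s u v). Qed.

Lemma deg0_outM (x y z : L) (m n p : int)
    (g : lin_complex y z m) (f : lin_complex x y n) : m + n = p ->
  deg0_out (deg0_in p (lin_comp (deg0_out g) (deg0_out f))) =
  lin_comp (deg0_out g) (deg0_out f).
Proof.
move=> e; have [p0 | p0] := eqVneq p 0; first by rewrite p0.
rewrite deg0_out_neq0 //; have [m0 | m0] := eqVneq m 0; last first.
  by rewrite (deg0_out_neq0 g m0) lin_comp0l.
by rewrite (deg0_out_neq0 f) ?lin_comp0r //; rewrite m0 add0r in e; rewrite e.
Qed.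

Definition lin_dgcat : dgcat k.
Proof.
refine (@DGCat k L lin_complex (fun x => lin_id x) lin_dg_comp _ _ _ _ _ _ _).
- move=> x y z m n p e f c g g'.
  by rewrite /lin_dg_comp deg0_out_linear lin_compl; apply: deg0_in_linear.
- move=> x y z m n p e g c f f'.
  by rewrite /lin_dg_comp deg0_out_linear lin_compr; apply: deg0_in_linear.
- by move=> x y n e f; rewrite /lin_dg_comp lin_idl deg0_outK.
- by move=> x y n e f; rewrite /lin_dg_comp lin_idr deg0_outK.
- move=> x y z t l m n lm mn p e1 e2 e3 e4 h g f.
  by rewrite /lin_dg_comp !deg0_outM // lin_assoc.
- by [].
- move=> x y z m n p e e1 e2 g f; rewrite /lin_dg_comp /=.
  rewrite !deg0_out0 lin_comp0l lin_comp0r !deg0_in0.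
  by rewrite scaler0 addr0.
Defined.

End LinDGCat.

Record linfunctor (k : fieldType) (L M : lincat k) := LinFunctor {
  lf_ob :> L -> M;
  lf_hom : forall x y, lin_hom x y -> lin_hom (lf_ob x) (lf_ob y);
  lf_lin : forall x y, linear (@lf_hom x y);
  lf_id : forall x, lf_hom (lin_id x) = lin_id (lf_ob x);
  lf_comp : forall x y z (g : lin_hom y z) (f : lin_hom x y),
    lf_hom (lin_comp g f) = lin_comp (lf_hom g) (lf_hom f) }.

Section LinDGFunctor.
Variables (k : fieldType).

Definition deg0_map (V W : lmodType k) (f : V -> W) n (x : deg0 V n) :
  deg0 W n := deg0_in n (f (deg0_out x)).

Lemma deg0_mapE (V W : lmodType k) (f : V -> W) n (x : deg0 V n) :
  f 0 = 0 -> deg0_out (deg0_map f x) = f (deg0_out x).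
Proof.
move=> f0; have [n0 | n0] := eqVneq n 0; first by move: x; rewrite n0.
by rewrite !deg0_out_neq0.
Qed.

Lemma deg0_map_can (V W : lmodType k) (f : V -> W) (g : W -> V) n :
  cancel f g -> f 0 = 0 ->
  cancel (fun x : deg0 V n => deg0_map f x) (fun y => deg0_map g y).
Proof.
by move=> fK f0 x; rewrite [LHS]/deg0_map deg0_mapE // fK deg0_outK.
Qed.

Lemma lin_dgfunctor_subproof (L M : lincat k) (F : linfunctor L M) :
  is_dgfunctor (A := lin_dgcat L) (B := lin_dgcat M)
    (fun x y => deg0_map (@lf_hom _ _ _ F x y)).
Proof.
have F0 x y := lin0 (@lf_lin _ _ _ F x y).
split=> [x y | x | x y z m n p e g f].
- split=> [n c u v | n u]; rewrite /deg0_map.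
    by rewrite deg0_out_linear lf_lin; apply: deg0_in_linear.
  by rewrite deg0_out0 F0 deg0_in0.
- exact: lf_id.
- rewrite /= /lin_dg_comp [in LHS]/deg0_map deg0_outM // lf_comp.
  by rewrite !deg0_mapE.
Qed.

Definition lin_dgfunctor (L M : lincat k) (F : linfunctor L M) :
    dgfunctor (lin_dgcat L) (lin_dgcat M) :=
  DGFunctor (lin_dgfunctor_subproof F).

Definition linfunctor_id (L : lincat k) : linfunctor L L :=
  @LinFunctor k L L id (fun _ _ f => f) (fun _ _ _ _ _ => erefl)
    (fun _ => erefl) (fun _ _ _ _ _ => erefl).

Definition linfunctor_comp (L M N : lincat k)
    (G : linfunctor M N) (F : linfunctor L M) : linfunctor L N.
Proof.
refine (@LinFunctor k L N (fun x => G (F x)) (fun x y f => lf_hom G (lf_hom F f))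
  _ _ _).
- by move=> x y c u v; rewrite lf_lin lf_lin.
- by move=> x; rewrite !lf_id.
- by move=> *; rewrite !lf_comp.
Defined.

Lemma dgfunctor_eq (A B : dgcat k) (F : A -> B) Fh Gh P Q :
  (forall x y n (f : dg_hom x y n), Fh x y n f = Gh x y n f) ->
  @DGFunctor k A B F Fh P = @DGFunctor k A B F Gh Q.
Proof.
move=> FG; have e : Fh = Gh.
  by do 4![apply: functional_extensionality_dep => ?]; apply: FG.
by rewrite e in P *; congr DGFunctor; apply: Prop_irrelevance.
Qed.

Lemma lin_dgfunctor_id (L : lincat k) :
  lin_dgfunctor (linfunctor_id L) = dgfunctor_id (lin_dgcat L).
Proof. by apply: dgfunctor_eq => x y n f; apply: deg0_outK. Qed.

Lemma lin_dgfunctor_comp (L M N : lincat k)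
    (G : linfunctor M N) (F : linfunctor L M) :
  lin_dgfunctor (linfunctor_comp G F) =
  dgfunctor_comp (lin_dgfunctor G) (lin_dgfunctor F).
Proof.
apply: dgfunctor_eq => x y n f; apply: (congr1 (@deg0_in _ _ n)) => /=.
by rewrite deg0_mapE //; apply: lin0 (@lf_lin _ _ _ F x y).
Qed.

Lemma lin_dgfunctor_eq (L M : lincat k) (F : L -> M) Fh Gh Fl F1 FM Gl G1 GM :
  (forall x y (f : lin_hom x y), Fh x y f = Gh x y f) ->
  lin_dgfunctor (@LinFunctor k L M F Fh Fl F1 FM) =
  lin_dgfunctor (@LinFunctor k L M F Gh Gl G1 GM).
Proof. by move=> FG; apply: dgfunctor_eq => x y n f; rewrite /deg0_map /= FG. Qed.

Record lin_summand (L M : lincat k) (F : linfunctor L M) (y : M) :=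
  LinSummand {
    ls_idx : finType;
    ls_ob : ls_idx -> L;
    ls_to : forall i, lin_hom y (F (ls_ob i));
    ls_from : forall i, lin_hom (F (ls_ob i)) y;
    ls_sum : \sum_i lin_comp (ls_from i) (ls_to i) = lin_id y }.

Lemma lin_morita (L M : lincat k) (F : linfunctor L M) :
  (forall x y, bijective (@lf_hom _ _ _ F x y)) ->
  (forall y, lin_summand F y) -> morita_equivalence (lin_dgfunctor F).
Proof.
move=> Fbij S; apply: morita_of_summands => [x y n | y].
  have [g fK gK] := Fbij x y.
  have F0 := lin0 (@lf_lin _ _ _ F x y).
  exists (@deg0_map _ _ g n); [exact: deg0_map_can | apply: deg0_map_can gK _].
  by rewrite -[0 in LHS]F0 fK.
exact: (@Summand k (lin_dgcat L) (lin_dgcat M) (lin_dgfunctor F) y _ _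
  (@ls_to _ _ _ _ (S y)) (@ls_from _ _ _ _ (S y)) (fun=> erefl) (fun=> erefl)
  (ls_sum (S y))).
Qed.

End LinDGFunctor.

Section AlgebraLinCat.
Variables (k : fieldType) (R : algType k).

Definition alg_lin : lincat k.
Proof.
refine (@LinCat k unit (fun _ _ => R) (fun _ => 1) (fun _ _ _ g f => g * f)
  _ _ _ _ _).
- by move=> _ _ _ f c g g'; rewrite mulrDl scalerAl.
- by move=> _ _ _ g c f f'; rewrite mulrDr scalerAr.
- by move=> _ _ f; apply: mul1r.
- by move=> _ _ f; apply: mulr1.
- by move=> *; apply: mulrA.
Defined.

(** The data agree by conversion and only the proofs differ. This turns the goal of the theorem into
    one about linear categories. *)
Lemma alg_dgcatE : alg_dgcat R = lin_dgcat alg_lin.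
Proof.
rewrite /alg_dgcat /lin_dgcat /=.
have e : alg_complex R = deg0_complex R.
  by rewrite /alg_complex /deg0_complex; congr Complex; apply: Prop_irrelevance.
congr DGCat; try exact: Prop_irrelevance.
Qed.

End AlgebraLinCat.

(** * Matrices over an algebra *)

Section Matrices.
Variables (k : fieldType) (S : algType k).

(* Matrices indexed by finite types; unlike ['M[S]_(m, n)] they form a k-module
   even when S is not commutative. *)
Definition mat (I J : finType) : lmodType k := I -> J -> S.

Definition mmul (I J K : finType) (f : mat I J) (g : mat J K) : mat I K :=
  fun i l => \sum_j f i j * g j l.

Definition mone (I : finType) : mat I I := fun i j => (i == j)%:R.
Arguments mone : clear implicits.

Lemma matP (I J : finType) (f g : mat I J) : (forall i j, f i j = g i j) -> f = g.
Proof. by move=> fg; apply/funext => i; apply/funext => j. Qed.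

Lemma mat_linE (I J : finType) (c : k) (f g : mat I J) i j :
  (c *: f + g) i j = c *: f i j + g i j.
Proof. by []. Qed.

Lemma mat_addE (I J : finType) (f g : mat I J) i j : (f + g) i j = f i j + g i j.
Proof. by []. Qed.

Lemma mat_sumE (I J : finType) (T : Type) (r : seq T) (P : pred T)
    (F : T -> mat I J) i j :
  (\sum_(t <- r | P t) F t) i j = \sum_(t <- r | P t) F t i j.
Proof. by elim/big_rec2: _ => // t u v _ <-. Qed.

Lemma mmul_linl (I J K : finType) (g : mat J K) :
  linear (fun f : mat I J => mmul f g).
Proof.
move=> c f f'; apply: matP => i l; rewrite mat_linE /mmul scaler_sumr -big_split.
by apply: eq_bigr => j _; rewrite mat_linE mulrDl scalerAl.
Qed.

Lemma mmul_linr (I J K : finType) (f : mat I J) :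
  linear (fun g : mat J K => mmul f g).
Proof.
move=> c g g'; apply: matP => i l; rewrite mat_linE /mmul scaler_sumr -big_split.
by apply: eq_bigr => j _; rewrite mat_linE mulrDr scalerAr.
Qed.

Lemma mmul1l (I J : finType) (f : mat I J) : mmul (mone I) f = f.
Proof.
apply: matP => i j; rewrite /mmul (bigD1 i) //= /mone eqxx mul1r big1 ?addr0 //.
by move=> l li; rewrite eq_sym (negPf li) mul0r.
Qed.

Lemma mmul1r (I J : finType) (f : mat I J) : mmul f (mone J) = f.
Proof.
apply: matP => i j; rewrite /mmul (bigD1 j) //= /mone eqxx mulr1 big1 ?addr0 //.
by move=> l lj; rewrite (negPf lj) mulr0.
Qed.

Lemma mmulA (I J K L : finType) (f : mat I J) (g : mat J K) (h : mat K L) :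
  mmul f (mmul g h) = mmul (mmul f g) h.
Proof.
apply: matP => i l; rewrite /mmul.
under eq_bigr => j _ do rewrite mulr_sumr.
rewrite exchange_big; apply: eq_bigr => q _ /=; rewrite mulr_suml.
by apply: eq_bigr => j _; rewrite mulrA.
Qed.

(** The category of free right S-modules of finite rank: a morphism from I to J is a J by I matrix
    acting on columns. *)
Definition mat_lin : lincat k :=
  @LinCat k finType (fun I J => mat J I) (fun I => mone I)
    (fun I J K g f => mmul g f) (fun I J K f => @mmul_linl K J I f)
    (fun I J K g => @mmul_linr K J I g)
    (fun I J f => mmul1l f) (fun I J f => mmul1r f)
    (fun I J K L h g f => mmulA h g f).

Definition mat0 (I J : finType) : mat I J := fun _ _ => 0.
Arguments mat0 : clear implicits.

Definition mblock (I I' J J' : finType)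
    (a : mat I I') (b : mat I J') (c : mat J I') (d : mat J J') :
    mat (I + J)%type (I' + J')%type :=
  fun x y => match x, y with
    | inl i, inl i' => a i i' | inl i, inr j' => b i j'
    | inr j, inl i' => c j i' | inr j, inr j' => d j j' end.

Lemma mblock_lin (I I' J J' : finType) (s : k)
    (a a' : mat I I') (b b' : mat I J') (c c' : mat J I') (d d' : mat J J') :
  mblock (s *: a + a') (s *: b + b') (s *: c + c') (s *: d + d') =
  s *: mblock a b c d + mblock a' b' c' d'.
Proof. by apply: matP => [[i|j] [i'|j']]. Qed.

Lemma mblock1 (I J : finType) :
  mblock (mone I) (mat0 I J) (mat0 J I) (mone J) = mone (I + J)%type.
Proof. by apply: matP => [[i|j] [i'|j']]. Qed.

Lemma mmul_block (I I' I'' J J' J'' : finType)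
    (a : mat I I') (b : mat I J') (c : mat J I') (d : mat J J')
    (a' : mat I' I'') (b' : mat I' J'') (c' : mat J' I'') (d' : mat J' J'') :
  mmul (mblock a b c d) (mblock a' b' c' d') =
  mblock (mmul a a' + mmul b c') (mmul a b' + mmul b d')
         (mmul c a' + mmul d c') (mmul c b' + mmul d d').
Proof.
by apply: matP => [[i|j] [i'|j']]; rewrite /mmul big_sumType.
Qed.

End Matrices.

Arguments mone {k S} I _ _.
Arguments mat0 {k S} I J _ _.

(** * Additive hull of T(S) *)

Lemma sum_unit (V : nmodType) (F : unit -> V) : \sum_j F j = F tt.
Proof. by rewrite (big_pred1 tt) // => -[]. Qed.

Lemma sum_void (V : nmodType) (F : void -> V) : \sum_j F j = 0.
Proof. by apply: big1 => -[]. Qed.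

Lemma sum_delta (R : pzSemiRingType) (I : finType) (i j : I) :
  \sum_l (i == l)%:R * (j == l)%:R = (i == j)%:R :> R.
Proof.
rewrite (bigD1 j) //= eqxx mulr1 big1 ?addr0 // => l lj.
by rewrite [j == l]eq_sym (negPf lj) mulr0.
Qed.

Section TriangularMatrices.
Variables (k : fieldType) (S : algType k).

(* The endomorphisms of (I, J) are the block lower triangular matrices
   [[a, 0], [c, b]], written (a, b, c). *)
Definition tri_mat (X Y : finType * finType) : lmodType k :=
  (mat S Y.1 X.1 * mat S Y.2 X.2 * mat S Y.2 X.1)%type.

Definition tri_mone (X : finType * finType) : tri_mat X X :=
  (mone X.1, mone X.2, mat0 X.2 X.1).

Definition tri_mmul (X Y Z : finType * finType)
    (g : tri_mat Y Z) (f : tri_mat X Y) : tri_mat X Z :=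
  (mmul g.1.1 f.1.1, mmul g.1.2 f.1.2, mmul g.2 f.1.1 + mmul g.1.2 f.2).

Definition tri_mat_lin : lincat k.
Proof.
refine (@LinCat k (finType * finType)%type tri_mat tri_mone tri_mmul _ _ _ _ _).
- move=> X Y Z [[a b] d] s [[a1 b1] d1] [[a2 b2] d2].
  transitivity (mmul (s *: a1 + a2) a, mmul (s *: b1 + b2) b,
    mmul (s *: d1 + d2) a + mmul (s *: b1 + b2) d); first by [].
  rewrite !mmul_linl; apply: (congr1 (pair _)).
  by rewrite /= scalerDr addrACA.
- move=> X Y Z [[a b] d] s [[a1 b1] d1] [[a2 b2] d2].
  transitivity (mmul a (s *: a1 + a2), mmul b (s *: b1 + b2),
    mmul d (s *: a1 + a2) + mmul b (s *: d1 + d2)); first by [].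
  rewrite !mmul_linr; apply: (congr1 (pair _)).
  by rewrite /= scalerDr addrACA.
- move=> X Y [[a b] c]; rewrite /tri_mmul /= !mmul1l.
  by rewrite (lin0 (fun s u v => mmul_linl a s u v)) add0r.
- move=> X Y [[a b] c]; rewrite /tri_mmul /= !mmul1r.
  by rewrite (lin0 (fun s u v => mmul_linr b s u v)) addr0.
- move=> X Y Z T [[a b] c] [[a' b'] c'] [[a'' b''] c''].
  rewrite /tri_mmul /= !mmulA; congr (_, _, _).
  rewrite (linD (mmul_linr b)) (linD (fun s u v => mmul_linl a'' s u v)).
  by rewrite !mmulA addrA.
Defined.

Lemma tri_sumE (X Y : finType * finType) (I : Type) (r : seq I)
    (F : I -> tri_mat X Y) :
  \sum_(i <- r) F i = (\sum_(i <- r) (F i).1.1, \sum_(i <- r) (F i).1.2,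
    \sum_(i <- r) (F i).2).
Proof.
elim: r => [|i r IHr]; first by rewrite !big_nil.
by rewrite !big_cons IHr; case: (F i) => [[a b] c].
Qed.

Definition tri_pr1 : linfunctor tri_mat_lin (mat_lin S) :=
  @LinFunctor k tri_mat_lin (mat_lin S) (fun X => X.1) (fun _ _ f => f.1.1)
    (fun _ _ _ _ _ => erefl) (fun _ => erefl) (fun _ _ _ _ _ => erefl).

Definition tri_pr2 : linfunctor tri_mat_lin (mat_lin S) :=
  @LinFunctor k tri_mat_lin (mat_lin S) (fun X => X.2) (fun _ _ f => f.1.2)
    (fun _ _ _ _ _ => erefl) (fun _ => erefl) (fun _ _ _ _ _ => erefl).

Lemma mmul0l (I J K : finType) (f : mat S J K) : mmul (0 : mat S I J) f = 0.
Proof. exact: lin0 (fun s u v => mmul_linl f s u v). Qed.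

Lemma mmul0r (I J K : finType) (f : mat S I J) : mmul f (0 : mat S J K) = 0.
Proof. exact: lin0 (mmul_linr f). Qed.

(** On [T(S)] this forgets the index in {1, 2}. Hence it restricts to isomorphic functors along the
    two inclusions, which lets it add up the two diagonal components. *)
Definition tri_total : linfunctor tri_mat_lin (mat_lin S).
Proof.
refine (@LinFunctor k tri_mat_lin (mat_lin S) (fun X => (X.1 + X.2)%type : finType)
  (fun X Y f => mblock f.1.1 0 f.2 f.1.2) _ _ _).
- move=> X Y s [[a b] d] [[a' b'] d'].
  transitivity (mblock (s *: a + a') (s *: 0 + 0) (s *: d + d') (s *: b + b')).
    by rewrite scaler0 addr0.
  by rewrite mblock_lin.
- by move=> X; apply: mblock1.
- move=> X Y Z [[a b] d] [[a' b'] d']; rewrite /= mmul_block.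
  by rewrite !mmul0l !mmul0r !addr0 add0r.
Defined.

End TriangularMatrices.

Section TriangularHull.
Variables (k : fieldType) (S : algType k).
Let T : dgcat k := tri_dgcat (lin_dgcat (alg_lin S)).

Definition hull_ob (X : T) : tri_mat_lin S :=
  if X.1 then (void : finType, unit : finType) else (unit : finType, void : finType).

(* Only one of the three blocks is indexed by nonempty types. *)
Definition hull_emb (X Y : T) (s : S) : lin_hom (hull_ob X) (hull_ob Y) :=
  ((fun _ _ => s), (fun _ _ => s), (fun _ _ => s)).

(** In [T] the morphisms from index 2 to index 1 form the complex [cx0], so [T] is not literally of
    the form [lin_dgcat] and its morphisms are read case by case. *)
Definition hull_out (X Y : T) n : dg_hom X Y n -> S :=
  match X, Y return tri_hom X Y n -> S with
  | (false, x), (false, y) => fun s => deg0_out s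
  | (false, x), (true, y) => fun s => deg0_out s
  | (true, x), (true, y) => fun s => deg0_out s
  | _, _ => fun _ => 0
  end.

Definition hull_in (X Y : T) n : S -> dg_hom X Y n :=
  match X, Y return S -> tri_hom X Y n with
  | (false, x), (false, y) => deg0_in n
  | (false, x), (true, y) => deg0_in n
  | (true, x), (true, y) => deg0_in n
  | _, _ => fun _ => 0
  end.

Definition hull_hom (X Y : T) n (f : dg_hom X Y n) :
    dg_hom (hull_ob X : lin_dgcat (tri_mat_lin S)) (hull_ob Y) n :=
  deg0_in n (hull_emb X Y (hull_out f)).

Lemma hull_emb_lin X Y : linear (@hull_emb X Y).
Proof. by []. Qed.

Lemma hull_out_lin X Y n : linear (@hull_out X Y n).
Proof.
case: X Y => [[] x] [[] y] c u v /=; rewrite ?scaler0 ?addr0 //;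
  exact: deg0_out_linear.
Qed.

Lemma hull_out_neq0 X Y n (f : dg_hom X Y n) : n != 0 -> hull_out f = 0.
Proof. by case: X Y f => [[] x] [[] y] f //=; apply: deg0_out_neq0. Qed.

Lemma hull_homE X Y n (f : dg_hom X Y n) :
  deg0_out (hull_hom f) = hull_emb X Y (hull_out f).
Proof.
case: (eqVneq n 0) f => [-> // | n0] f.
by rewrite (hull_out_neq0 f n0) deg0_out_neq0.
Qed.

Lemma tri_mat_eq (X Y : tri_mat_lin S) (f g : lin_hom X Y) :
  (forall i j, f.1.1 i j = g.1.1 i j) -> (forall i j, f.1.2 i j = g.1.2 i j) ->
  (forall i j, f.2 i j = g.2 i j) -> f = g.
Proof.
by case: f g => [[a b] c] [[a' b'] c'] /= /matP-> /matP-> /matP->.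
Qed.

Lemma hull_hom_subproof : is_dgfunctor (B := lin_dgcat (tri_mat_lin S)) hull_hom.
Proof.
split=> [X Y | X | X Y Z m n p e g f].
- split=> [n c u v | n u]; rewrite /hull_hom.
    by rewrite hull_out_lin hull_emb_lin; apply: deg0_in_linear.
  have -> : hull_out (cx_d n u) = 0.
    by case: X Y u => [[] x] [[] y] u //=; apply: deg0_out0.
  exact: deg0_in0.
- by case: X => [[] []]; apply: tri_mat_eq => -[] [].
- rewrite /= /lin_dg_comp !hull_homE; apply: (congr1 (@deg0_in _ _ p)).
  case: X Y Z g f => [[] []] [[] []] [[] []] g f; apply: tri_mat_eq => -[] [] //=;
    rewrite /mmul ?mat_addE ?sum_unit ?sum_void ?addr0 ?add0r ?mulr0 ?mul0r //;
    first [exact: (@deg0_outM _ (alg_lin S) tt tt tt m n p g f e)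
          | exact: deg0_out0].
Qed.

Definition hull : dgfunctor T (lin_dgcat (tri_mat_lin S)) :=
  DGFunctor hull_hom_subproof.

(** The object (I, J) is the direct sum of I copies of the first object of [T(S)] and J copies of
    the second, with [to] and [from] the coordinate projections and inclusions. Full faithfulness
    holds because between images of objects of [T] at most one block is nonempty, and it has size
    one. *)
Lemma hull_morita : morita_equivalence hull.
Proof.
apply: morita_of_summands => [X Y n | [I J]].
  pose h (y : dg_hom (hull X) (hull Y) n) : dg_hom X Y n :=
    hull_in X Y n (match X, Y
      return tri_mat S (hull_ob X) (hull_ob Y) -> S with
      | (false, _), (false, _) => fun f => f.1.1 tt tt
      | (false, _), (true, _) => fun f => f.2 tt tt
      | (true, _), (true, _) => fun f => f.1.2 tt tt
      | _, _ => fun _ => 0 end (deg0_out y)).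
  exists h => u; rewrite /h.
    rewrite hull_homE; case: X Y u {h} => [[] x] [[] y] u /=;
      rewrite ?deg0_outK //; exact/esym/cx0_eq0.
  rewrite /= /hull_hom -[RHS]deg0_outK; congr (deg0_in n _).
  case: (eqVneq n 0) u {h} => [-> | n0] u; last first.
    by rewrite (deg0_out_neq0 u n0); case: X Y u => [[] x] [[] y] u /=;
      rewrite ?(deg0_out_neq0 _ n0).
  by case: X Y u => [[] []] [[] []] u; apply: tri_mat_eq => -[] [].
pose x (l : (I + J)%type) : T := (if l is inl _ then false else true, tt).
pose to l : tri_mat S (I, J) (hull_ob (x l)) :=
  match l with
  | inl i => (fun _ i' => (i' == i)%:R, fun _ _ => 0, fun _ _ => 0)
  | inr j => (fun _ _ => 0, fun _ j' => (j' == j)%:R, fun _ _ => 0)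
  end.
pose from l : tri_mat S (hull_ob (x l)) (I, J) :=
  match l with
  | inl i => (fun i' _ => (i' == i)%:R, fun _ _ => 0, fun _ _ => 0)
  | inr j => (fun _ _ => 0, fun j' _ => (j' == j)%:R, fun _ _ => 0)
  end.
apply: (@Summand k T (lin_dgcat (tri_mat_lin S)) hull (I, J) _ x to from) => //.
rewrite [RHS]/= -[LHS]/(\sum_l tri_mmul (from l) (to l)) tri_sumE.
apply: tri_mat_eq => i j; rewrite /= mat_sumE big_sumType /=.
- rewrite [X in _ + X]big1 ?addr0 => [|l _]; last by rewrite /mmul sum_void.
  by under eq_bigr => l _ do rewrite /mmul sum_unit; rewrite sum_delta.
- rewrite [X in X + _]big1 ?add0r => [|l _]; last by rewrite /mmul sum_void.
  by under eq_bigr => l _ do rewrite /mmul sum_unit; rewrite sum_delta.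
- by rewrite !big1 ?addr0 // => l _;
    rewrite mat_addE /mmul sum_unit sum_void ?mul0r ?mulr0 addr0.
Qed.
End TriangularHull.

(** * Free bimodules *)

Section AlgebraFunctors.
Variables (k : fieldType) (R : algType k) (M : lincat k) (m : M).
Variable h : R -> lin_hom m m.
Hypotheses (hl : linear h) (h1 : h 1 = lin_id m).
Hypothesis hM : forall x y, h (x * y) = lin_comp (h x) (h y).

Definition alg_functor : linfunctor (alg_lin R) M :=
  @LinFunctor k (alg_lin R) M (fun _ => m) (fun _ _ => h)
    (fun _ _ => hl) (fun _ => h1) (fun _ _ _ => hM).

End AlgebraFunctors.

(* Algebra maps R -> M_I(S), i.e. (R, S)-bimodules which are free of finite rank
   over S. *)
Record rep (k : fieldType) (R S : algType k) := Rep {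
  rep_idx : finType;
  rep_fun :> R -> mat S rep_idx rep_idx;
  rep_lin : linear rep_fun;
  rep1 : rep_fun 1 = mone rep_idx;
  repM : forall x y, rep_fun (x * y) = mmul (rep_fun x) (rep_fun y) }.

Section Representations.
Variable k : fieldType.
Implicit Types R S T : algType k.

Definition rep_functor R S (f : rep R S) : linfunctor (alg_lin R) (mat_lin S) :=
  alg_functor (M := mat_lin S) (@rep_lin _ _ _ f) (rep1 f) (@repM _ _ _ f).

Definition rep_of_alg R S (f : R -> S) (fl : linear f) (f1 : f 1 = 1)
    (fM : forall x y, f (x * y) = f x * f y) : rep R S.
Proof.
refine (@Rep k R S (unit : finType) (fun x _ _ => f x) _ _ _).
- by move=> c x y; rewrite fl.
- by rewrite f1; apply: matP => -[] [].
- by move=> x y; rewrite fM; apply: matP => -[] []; rewrite /mmul sum_unit.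
Defined.

Definition rep_id R : rep R R :=
  @rep_of_alg R R id (fun _ _ _ => erefl) erefl (fun _ _ => erefl).

Definition rep_diag R (I : finType) : rep R R.
Proof.
refine (@Rep k R R I (fun x i j => if i == j then x else 0) _ _ _).
- by move=> c x y; apply: matP => i j; rewrite mat_linE; case: eqP => _;
    rewrite ?scaler0 ?addr0.
- by apply: matP => i j; rewrite /mone; case: eqP.
- move=> x y; apply: matP => i j; rewrite /mmul (bigD1 i) //= eqxx.
  rewrite big1 ?addr0 => [|l li]; last by rewrite eq_sym (negPf li) mul0r.
  by case: eqP; rewrite ?mulr0.
Defined.

Definition rep_zero R S : rep R S.
Proof.
refine (@Rep k R S (void : finType) (fun x _ _ => 0) _ _ _).
- by move=> c x y; apply: matP => -[].
- by apply: matP => -[].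
- by move=> x y; apply: matP => -[].
Defined.

Definition rep_sum R S (f g : rep R S) : rep R S.
Proof.
refine (@Rep k R S (rep_idx f + rep_idx g)%type
  (fun x => mblock (f x) 0 0 (g x)) _ _ _).
- move=> c x y; rewrite !rep_lin -[in RHS]mblock_lin.
  by congr mblock; rewrite scaler0 addr0.
- by rewrite !rep1; apply: mblock1.
- by move=> x y; rewrite mmul_block !mmul0l !mmul0r !addr0 !add0r !repM.
Defined.

(** The functor given by tensoring free R-modules with the bimodule [f], with the blocks of the
    resulting matrices flattened. Accordingly [rep_comp] is the tensor product of bimodules over
    S. *)
Definition mext R S (f : rep R S) (I J : finType) (a : mat R I J) :
    mat S (I * rep_idx f)%type (J * rep_idx f)%type :=
  fun x y => f (a x.1 y.1) x.2 y.2.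
Arguments mext {R S} f {I J} a _ _.

Lemma mext_lin R S (f : rep R S) (I J : finType) : linear (@mext R S f I J).
Proof. by move=> c a b; apply: matP => i j; rewrite /mext !mat_linE rep_lin. Qed.

Lemma mext1 R S (f : rep R S) (I : finType) :
  mext f (mone I) = mone (I * rep_idx f)%type.
Proof.
apply: matP => -[i x] [j y]; rewrite /mext /mone /= xpair_eqE.
have [_|_] := eqVneq i j; first by rewrite rep1.
by rewrite (lin0 (@rep_lin _ _ _ f)).
Qed.

Lemma mextM R S (f : rep R S) (I J K : finType) (a : mat R I J) (b : mat R J K) :
  mext f (mmul a b) = mmul (mext f a) (mext f b).
Proof.
apply: matP => -[i x] [j y]; rewrite /mext /mmul /=.
rewrite (lin_sum (@rep_lin _ _ _ f)) mat_sumE.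
rewrite -(pair_bigA _ (fun l z => f (a i l) x z * f (b l j) z y)) /=.
by apply: eq_bigr => l _; rewrite repM.
Qed.

Definition mext_functor R S (f : rep R S) : linfunctor (mat_lin R) (mat_lin S) :=
  @LinFunctor k (mat_lin R) (mat_lin S) (fun I => (I * rep_idx f)%type : finType)
    (fun I J a => mext f a) (fun I J => @mext_lin R S f J I)
    (fun I => mext1 f I) (fun I J K b a => mextM f b a).

Definition rep_comp R S T (g : rep S T) (f : rep R S) : rep R T.
Proof.
refine (@Rep k R T (rep_idx f * rep_idx g)%type (fun x => mext g (f x)) _ _ _).
- by move=> c x y; rewrite rep_lin mext_lin.
- by rewrite rep1 mext1.
- by move=> x y; rewrite repM mextM.
Defined.

Lemma rep_id_morita R : morita_equivalence (lin_dgfunctor (rep_functor (rep_id R))).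
Proof.
apply: lin_morita => [x y | J].
  exists (fun a : mat R unit unit => a tt tt) => a //=.
  by apply: matP => -[] [].
apply: (@LinSummand k (alg_lin R) (mat_lin R) (rep_functor (rep_id R)) J J
  (fun _ => tt) (fun j => fun _ j' => (j' == j)%:R) (fun j => fun j' _ => (j' == j)%:R)).
apply: matP => i j; rewrite /= mat_sumE.
by under eq_bigr => l _ do rewrite /mmul sum_unit; rewrite sum_delta.
Qed.

(** When the index type is nonempty, the coordinate [i0] exhibits the free module of rank one as a
    summand of the image of the unique object; any J is then a summand of J copies of that image. *)
Lemma rep_morita R S (f : rep R S) :
  (0 < #|rep_idx f|)%N -> bijective f ->
  morita_equivalence (lin_dgfunctor (rep_functor f)).
Proof.
move=> /card_gt0P[i0 _] fbij; apply: lin_morita => [x y | J]; first exact: fbij.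
apply: (@LinSummand k (alg_lin R) (mat_lin S) (rep_functor f) J J
  (fun _ => tt) (fun j => fun i j' => (i0 == i)%:R * (j' == j)%:R)
  (fun j => fun j' i => (j' == j)%:R * (i0 == i)%:R)).
apply: matP => i j; rewrite /= mat_sumE -[RHS]sum_delta.
apply: eq_bigr => l _; rewrite /mmul.
under eq_bigr => q _ do rewrite -mulrA [X in _ * X]mulrA.
rewrite -mulr_sumr -mulr_suml; congr (_ * _).
by rewrite sum_delta eqxx mul1r.
Qed.

End Representations.

Arguments mext {k R S} f {I J} a _ _.

Definition zero_lin (k : fieldType) : lincat k.
Proof.
refine (@LinCat k unit (fun _ _ => cx_trivial k) (fun _ => 0)
  (fun _ _ _ _ _ => 0) _ _ _ _ _).
- by move=> x y z f c u v; apply/rowP => -[].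
- by move=> x y z f c u v; apply/rowP => -[].
- by move=> x y f; apply/rowP => -[].
- by move=> x y f; apply/rowP => -[].
- by [].
Defined.

(** All objects on the right are zero, hence empty direct sums. Together with additivity this makes
    [E] vanish on the zero category. *)
Lemma zero_morita (k : fieldType) :
  morita_equivalence (tri_incl (lin_dgcat (zero_lin k)) false).
Proof.
have z n (u : deg0 (cx_trivial k) n) : u = 0.
  by case: n u => [[|n]|n] u; apply/rowP => -[].
apply: morita_of_summands => [x y n | X].
  by exists id.
pose Z := lin_dgcat (zero_lin k).
apply: (@Summand k Z (tri_dgcat Z) (tri_incl Z false) X (void : finType)
  (fun _ => tt) (fun i => match i with end)
  (fun i => match i with end)) => [[]|[]|].
rewrite big1 => [|[]//]; apply/esym.
by case: X => [[] []]; apply: z.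
Qed.

(** * Isomorphic functors out of an algebra *)

Section Doubling.
Variables (k : fieldType) (R : algType k).

(* Two isomorphic objects with endomorphism algebra R. *)
Definition double_lin : lincat k :=
  @LinCat k bool (fun _ _ => R) (fun _ => 1) (fun _ _ _ g f => g * f)
    (fun _ _ _ => @lin_compl _ (alg_lin R) tt tt tt)
    (fun _ _ _ => @lin_compr _ (alg_lin R) tt tt tt)
    (fun _ _ => @mul1r R) (fun _ _ => @mulr1 R)
    (fun _ _ _ _ => @mulrA R).

Definition double_in (b : bool) : linfunctor (alg_lin R) double_lin :=
  @alg_functor k R double_lin b id (fun _ _ _ => erefl) erefl (fun _ _ => erefl).

Definition double_out : linfunctor double_lin (alg_lin R) :=
  @LinFunctor k double_lin (alg_lin R) (fun _ => tt) (fun _ _ => id)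
    (fun _ _ _ _ _ => erefl) (fun _ => erefl) (fun _ _ _ _ _ => erefl).

Lemma double_morita b : morita_equivalence (lin_dgfunctor (double_in b)).
Proof.
apply: lin_morita => [x y | y]; first by exists id.
apply: (@LinSummand k (alg_lin R) double_lin (double_in b) y unit
  (fun _ => tt) (fun _ => 1) (fun _ => 1)).
by rewrite sum_unit; apply: mulr1.
Qed.

Variables (M : lincat k) (m m' : M).
Variables (h : R -> lin_hom m m) (hl : linear h) (h1 : h 1 = lin_id m).
Hypothesis hM : forall x y, h (x * y) = lin_comp (h x) (h y).
Variables (u : lin_hom m m') (v : lin_hom m' m).
Hypothesis vu : lin_comp v u = lin_id m.
Hypothesis uv : lin_comp u v = lin_id m'.

Let ob (b : bool) : M := if b then m' else m.
Let into b : lin_hom m (ob b) :=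
  if b return lin_hom m (ob b) then u else lin_id m.
Let from b : lin_hom (ob b) m :=
  if b return lin_hom (ob b) m then v else lin_id m.

Let from_into b : lin_comp (from b) (into b) = lin_id m.
Proof. by case: b; rewrite /= ?lin_idl. Qed.

Let into_from b : lin_comp (into b) (from b) = lin_id (ob b).
Proof. by case: b; rewrite /= ?lin_idl. Qed.

(** Packages a functor together with an isomorphism of its value: at [false] it is [h], at [true]
    the conjugate of [h] by [u]. *)
Definition double_functor : linfunctor double_lin M.
Proof.
refine (@LinFunctor k double_lin M ob
  (fun b b' x => lin_comp (into b') (lin_comp (h x) (from b))) _ _ _).
- by move=> b b' c x y; rewrite hl lin_compl lin_compr.
- by move=> b; rewrite h1 lin_idl into_from.
- move=> b b' b'' y x; rewrite hM.
  rewrite -(lin_assoc (into b'')) -!(lin_assoc (h y)) (lin_assoc (from b')).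
  by rewrite from_into lin_idl.
Defined.

End Doubling.

(** * Additive categories *)

Local Notation "g ∘ f" := (add_comp g f) (at level 40, left associativity).

Section AdditiveCategories.
Variable D : additive_category.
Implicit Types X Y Z W : D.

Lemma comp0l X Y Z (f : add_hom X Y) : (0 : add_hom Y Z) ∘ f = 0.
Proof. by apply: (addIr (0 ∘ f)); rewrite -add_compDl !add0r. Qed.

Lemma comp0r X Y Z (g : add_hom Y Z) : g ∘ (0 : add_hom X Y) = 0.
Proof. by apply: (addIr (g ∘ 0)); rewrite -add_compDr !add0r. Qed.

Lemma compNl X Y Z (g : add_hom Y Z) (f : add_hom X Y) : (- g) ∘ f = - (g ∘ f).
Proof. by apply: (addIr (g ∘ f)); rewrite -add_compDl !addNr comp0l. Qed.

Lemma compNr X Y Z (g : add_hom Y Z) (f : add_hom X Y) : g ∘ (- f) = - (g ∘ f).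
Proof. by apply: (addIr (g ∘ f)); rewrite -add_compDr !addNr comp0r. Qed.

Lemma compMnl X Y Z (g : add_hom Y Z) (f : add_hom X Y) n :
  (g *+ n) ∘ f = (g ∘ f) *+ n.
Proof.
elim: n => [|n IHn]; first by rewrite !mulr0n comp0l.
by rewrite !mulrSr add_compDl IHn.
Qed.

Lemma compMnr X Y Z (g : add_hom Y Z) (f : add_hom X Y) n :
  g ∘ (f *+ n) = (g ∘ f) *+ n.
Proof.
elim: n => [|n IHn]; first by rewrite !mulr0n comp0r.
by rewrite !mulrSr add_compDr IHn.
Qed.

Lemma compMzl X Y Z (g : add_hom Y Z) (f : add_hom X Y) (n : int) :
  (g *~ n) ∘ f = (g ∘ f) *~ n.
Proof. by case: n => n; rewrite ?NegzE ?mulrNz ?compNl -!pmulrn compMnl. Qed.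

Lemma compMzr X Y Z (g : add_hom Y Z) (f : add_hom X Y) (n : int) :
  g ∘ (f *~ n) = (g ∘ f) *~ n.
Proof. by case: n => n; rewrite ?NegzE ?mulrNz ?compNr -!pmulrn compMnr. Qed.

(** The 2 by 2 matrix [[a, b], [c, d]], acting on columns. *)
Definition bimap X W Y Z (a : add_hom X Y) (b : add_hom W Y)
    (c : add_hom X Z) (d : add_hom W Z) : add_hom (X ⊕ W) (Y ⊕ Z) :=
  add_in1 Y Z ∘ (a ∘ add_pr1 X W + b ∘ add_pr2 X W)
  + add_in2 Y Z ∘ (c ∘ add_pr1 X W + d ∘ add_pr2 X W).

Lemma bimapM X W Y Z S T (a : add_hom X Y) (b : add_hom W Y)
    (c : add_hom X Z) (d : add_hom W Z)
    (a' : add_hom Y S) (b' : add_hom Z S) (c' : add_hom Y T) (d' : add_hom Z T) :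
  bimap a' b' c' d' ∘ bimap a b c d =
  bimap (a' ∘ a + b' ∘ c) (a' ∘ b + b' ∘ d) (c' ∘ a + d' ∘ c) (c' ∘ b + d' ∘ d).
Proof.
set f := bimap a b c d.
have p1 : add_pr1 Y Z ∘ f = a ∘ add_pr1 X W + b ∘ add_pr2 X W.
  by rewrite add_compDr !add_assoc add_pr1in1 add_pr1in2 add_idl comp0l addr0.
have p2 : add_pr2 Y Z ∘ f = c ∘ add_pr1 X W + d ∘ add_pr2 X W.
  by rewrite add_compDr !add_assoc add_pr2in1 add_pr2in2 add_idl comp0l add0r.
rewrite add_compDl -!add_assoc !add_compDl -!add_assoc p1 p2.
by rewrite /bimap !add_compDl !add_compDr !add_assoc; congr (_ + _); exact: addrACA.
Qed.

Lemma bimap1 X Y : bimap (add_id X) 0 0 (add_id Y) = add_id (X ⊕ Y).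
Proof. by rewrite /bimap !comp0l !add_idl addr0 add0r add_inpr. Qed.

Lemma sum_isoC X Y : @isomorphic D (X ⊕ Y) (Y ⊕ X).
Proof.
exists (bimap 0 (add_id Y) (add_id X) 0), (bimap 0 (add_id X) (add_id Y) 0).
by split; rewrite /= bimapM !comp0l !comp0r !add_idl !add0r !addr0 bimap1.
Qed.

Lemma sum_iso X X' Y Y' :
  @isomorphic D X X' -> @isomorphic D Y Y' -> @isomorphic D (X ⊕ Y) (X' ⊕ Y').
Proof.
case=> f [g [gf fg]] [f' [g' [gf' fg']]].
exists (bimap f 0 0 f'), (bimap g 0 0 g').
move: gf fg gf' fg' => /= gf fg gf' fg'.
by split; rewrite /= bimapM !comp0l !comp0r !add0r !addr0 ?gf ?fg ?gf' ?fg' bimap1.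
Qed.

Lemma isomorphic_refl (C : category) (X : C) : isomorphic X X.
Proof. by exists (cat_id X), (cat_id X); rewrite !cat_idl. Qed.

Lemma isomorphic_sym (C : category) (X Y : C) : isomorphic X Y -> isomorphic Y X.
Proof. by case=> f [g [gf fg]]; exists g, f. Qed.

Lemma isomorphic_trans (C : category) (X Y Z : C) :
  isomorphic X Y -> isomorphic Y Z -> isomorphic X Z.
Proof.
case=> f [g [gf fg]] [f' [g' [gf' fg']]].
exists (cat_comp f' f), (cat_comp g g'); split.
  by rewrite -cat_assoc (cat_assoc g') gf' cat_idl.
by rewrite -cat_assoc (cat_assoc f) fg cat_idl.
Qed.

Lemma coprime_torsion (V : zmodType) (v : V) (m n : nat) :
  coprime m n -> v *+ m = 0 -> v *+ n = 0 -> v = 0.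
Proof.
case: n => [|n] cmn vm vn.
  by move: cmn; rewrite /coprime gcdn0 => /eqP m1; rewrite m1 in vm.
have [m0 | m_gt0] := posnP m.
  by move: cmn vn; rewrite m0 /coprime gcd0n => /eqP->.
case: (egcdnP n.+1 m_gt0) => p q e _.
move: cmn; rewrite /coprime => /eqP g; rewrite g in e.
have := congr1 (GRing.natmul v) e.
by rewrite mulnC mulrnA vm mul0rn mulrnDr mulnC mulrnA vn mul0rn add0r mulr1n.
Qed.

(** * Squares with coprime multiplicities *)

Section Square.
Variables (X Y Z W : D) (m n : nat).
Variables (u1 : add_hom X Y) (v1 : add_hom Y X).
Variables (u2 : add_hom X Z) (v2 : add_hom Z X).
Variables (u1' : add_hom Z W) (v1' : add_hom W Z).
Variables (u2' : add_hom Y W) (v2' : add_hom W Y).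
Hypothesis mn : coprime m n.
Hypotheses (vu1 : v1 ∘ u1 = add_id X *+ m) (uv1 : u1 ∘ v1 = add_id Y *+ m).
Hypotheses (vu2 : v2 ∘ u2 = add_id X *+ n) (uv2 : u2 ∘ v2 = add_id Z *+ n).
Hypotheses (vu1' : v1' ∘ u1' = add_id Z *+ m) (uv1' : u1' ∘ v1' = add_id W *+ m).
Hypotheses (vu2' : v2' ∘ u2' = add_id Y *+ n) (uv2' : u2' ∘ v2' = add_id W *+ n).
Hypotheses (u1v2 : u1 ∘ v2 = v2' ∘ u1') (u2v1 : u2 ∘ v1 = v1' ∘ u2').

(* Both remaining faces commute up to m- and n-torsion. *)
Lemma square_uu : u1' ∘ u2 = u2' ∘ u1.
Proof.
apply/eqP; rewrite -subr_eq0; apply/eqP; apply: (coprime_torsion mn).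
  apply/eqP; rewrite mulrnBl subr_eq0; apply/eqP.
  (* m times u1' u2 is u1' u2 v1 u1; the mixed face turns u2 v1 into v1' u2', and u1' v1' is m. *)
  rewrite -[u1' ∘ u2]add_idr -compMnr -vu1 !add_assoc -(add_assoc u1') u2v1.
  by rewrite !add_assoc uv1' !compMnl add_idl.
apply/eqP; rewrite mulrnBl subr_eq0; apply/eqP.
rewrite -[u2' ∘ u1]add_idr -[RHS]compMnr -vu2 !add_assoc -(add_assoc u2' u1) u1v2.
by rewrite !add_assoc uv2' !compMnl add_idl.
Qed.

Lemma square_vv : v1 ∘ v2' = v2 ∘ v1'.
Proof.
apply/eqP; rewrite -subr_eq0; apply/eqP; apply: (coprime_torsion mn).
  apply/eqP; rewrite mulrnBl subr_eq0; apply/eqP.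
  rewrite -[v1 ∘ v2']add_idr -compMnr -uv1' !add_assoc -(add_assoc v1) -u1v2.
  by rewrite !add_assoc vu1 !compMnl add_idl.
apply/eqP; rewrite mulrnBl subr_eq0; apply/eqP.
rewrite -[v2 ∘ v1']add_idr -[RHS]compMnr -uv2' !add_assoc -(add_assoc v2 v1') -u2v1.
by rewrite !add_assoc vu2 !compMnl add_idl.
Qed.

(* With p m + q n = 1, the matrices [[u1, q v2'], [u2, - p v1']] and
   [[p v1, q v2], [u2', - u1']] are inverse to each other. *)
Lemma coprime_square_iso : @isomorphic D (X ⊕ W) (Y ⊕ Z).
Proof.
have [p [q pq]] : exists p q : int, p * m%:Z + q * n%:Z = 1.
  have [p [q e]] := Bezoutz m n.
  by exists p, q; rewrite e; move: mn; rewrite /coprime /gcdz /= => /eqP->.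
have pq1 (T : D) : add_id T *+ m *~ p + add_id T *+ n *~ q = add_id T.
  by rewrite !pmulrn -!mulrzA -mulrzDr mulrC [n%:Z * q]mulrC pq.
have uu := square_uu; have vv := square_vv.
exists (bimap u1 (v2' *~ q) u2 (- (v1' *~ p))).
exists (bimap (v1 *~ p) (v2 *~ q) u2' (- u1')).
split; rewrite /= bimapM; rewrite !(compNl, compNr, compMzl, compMzr).
  rewrite vu1 vu2 uv1' uv2' vv uu pq1 subrr opprK [_ *~ q + _]addrC pq1.
  by rewrite -!mulrzA [q * p]mulrC subrr bimap1.
rewrite uv1 vu2' u1v2 u2v1 uv2 vu1' pq1 subrr opprK subrr [_ *~ q + _]addrC pq1.
by rewrite bimap1.
Qed.

End Square.

End AdditiveCategories.

(** * Action of free bimodules on an additive invariant *)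

Lemma dgfunctor_alg_eq (k : fieldType) (A : dgcat k) (R : algType k)
    (F G : dgfunctor A (lin_dgcat (alg_lin R))) :
  (forall x y n (f : dg_hom x y n), dgf_hom F f = dgf_hom G f :> deg0 R n) ->
  F = G.
Proof.
case: F G => [F Fh FP] [G Gh GP] /= FG.
have e : F = G by apply/funext => x; case: (F x) (G x) => [] [].
by case: _ / e in Gh GP FG *; apply: dgfunctor_eq.
Qed.

Section AdditiveInvariant.
Variables (k : fieldType) (D : additive_category).
Variable E : functor (dgcat_category k) D.
Hypothesis hE : additive_invariant E.
Implicit Types R S T : algType k.

Definition Emap (A B : dgcat k) (F : dgfunctor A B) : add_hom (E A) (E B) :=
  fun_hom E (F : @cat_hom (dgcat_category k) A B).

Lemma Emap_comp (A B C : dgcat k) (G : dgfunctor B C) (F : dgfunctor A B) :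
  Emap (dgfunctor_comp G F) = Emap G ∘ Emap F.
Proof. exact: (@fun_comp (dgcat_category k) D E A B C G F). Qed.

Lemma Emap_id (A : dgcat k) : Emap (dgfunctor_id A) = add_id (E A).
Proof. exact: (@fun_id (dgcat_category k) D E A). Qed.

Lemma Emap_morita (A B : dgcat k) (F : dgfunctor A B) : morita_equivalence F ->
  exists g, g ∘ Emap F = add_id (E A) /\ Emap F ∘ g = add_id (E B).
Proof. by move=> mF; have [g gP] := hE.1 _ _ _ mF; exists g. Qed.

Definition Elin (L M : lincat k) (F : linfunctor L M) :
    add_hom (E (lin_dgcat L)) (E (lin_dgcat M)) := Emap (lin_dgfunctor F).

Lemma Elin_comp (L M N : lincat k) (G : linfunctor M N) (F : linfunctor L M) :
  Elin (linfunctor_comp G F) = Elin G ∘ Elin F.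
Proof. by rewrite /Elin lin_dgfunctor_comp Emap_comp. Qed.

Local Notation Ealg R := (E (lin_dgcat (alg_lin R))).

(* Both functors extend to the category with two isomorphic objects, whose
   inclusions are inverted by E and have a common left inverse. *)
Lemma Elin_iso_functors R (M : lincat k) (m m' : M)
    (u : lin_hom m m') (v : lin_hom m' m) h h' hl hl' h1 h1' hM hM' :
  lin_comp v u = lin_id m -> lin_comp u v = lin_id m' ->
  (forall x, lin_comp u (h x) = lin_comp (h' x) u) ->
  Elin (@alg_functor k R M m h hl h1 hM) =
  Elin (@alg_functor k R M m' h' hl' h1' hM').
Proof.
move=> vu uv uh.
have rK b : Elin (double_out R) ∘ Elin (double_in R b) = add_id _.
  rewrite -Elin_comp /Elin -Emap_id; congr Emap; rewrite -lin_dgfunctor_id.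
  by apply: dgfunctor_alg_eq => x y n f; rewrite /= /deg0_map !deg0_outK.
have jj : Elin (double_in R false) = Elin (double_in R true).
  have [g [_ jg]] := Emap_morita (double_morita R false).
  have r : Elin (double_out R) = g.
    by rewrite -[LHS]add_idr -jg add_assoc rK add_idl.
  by rewrite -[RHS]add_idl -jg -r -add_assoc rK add_idr.
pose F := double_functor hl h1 hM vu uv.
transitivity (Elin F ∘ Elin (double_in R false)).
  rewrite -Elin_comp /Elin; congr Emap; apply: dgfunctor_eq => x y n f.
  by rewrite /= /deg0_map /= lin_idl lin_idr.
rewrite jj -Elin_comp /Elin; congr Emap; apply: dgfunctor_eq => x y n f.
by rewrite /= /deg0_map /= lin_assoc uh -lin_assoc uv lin_idr.
Qed.

(** Let Z be the zero category. The retraction [r] of T(Z) onto Z is left inverse to both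
    inclusions, and [E] inverts the first of them, hence also [r]. Composing [r] with the
    isomorphism of the additivity axiom gives the codiagonal of E(Z), which is therefore injective;
    it identifies the two injections of E(Z) into its double, so the identity of E(Z) is 0. *)
Lemma Ezero (A B : dgcat k) (G : dgfunctor (lin_dgcat (zero_lin k)) B)
    (F : dgfunctor A (lin_dgcat (zero_lin k))) : Emap G ∘ Emap F = 0.
Proof.
set Z := lin_dgcat (zero_lin k).
suff z : add_id (E Z) = 0 by rewrite -[Emap F]add_idl z comp0l comp0r.
have [g [gi ig]] := Emap_morita (zero_morita k).
have z n (u v : deg0 (cx_trivial k) n) : u = v.
  by case: n u v => [[|n]|n] u v; apply/rowP => -[].
have rP : is_dgfunctor (A := tri_dgcat Z) (B := Z) (F := fun _ => tt)
    (fun _ _ _ _ => 0).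
  split=> [X Y|X|X Y Y' m n p e b a]; try exact: z.
  by split=> [n c a b|n a]; apply: z.
pose r := DGFunctor rP.
have rK b : Emap r ∘ Emap (tri_incl Z b) = add_id _.
  rewrite -Emap_comp -Emap_id; congr Emap.
  have e : dgf_ob (dgfunctor_comp r (tri_incl Z b)) = id.
    by apply/funext => -[].
  move: (dgfunctor_comp r (tri_incl Z b)) e => -[F' Fh FP] /= e.
  by case: _ / (esym e) in Fh FP *; apply: dgfunctor_eq => x y n f; apply: z.
have [c [ci ic]] := hE.2 Z.
have rg : Emap r = g by rewrite -[LHS]add_idr -ig add_assoc rK add_idl.
rewrite -{}rg in gi ig.
have e : Emap r ∘ (copair (D := D) (Emap (tri_incl Z false))
    (Emap (tri_incl Z true))) = add_pr1 (E Z) (E Z) + add_pr2 _ _.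
  by rewrite add_compDr !add_assoc !rK !add_idl.
have inj (a b : add_hom (E Z) (E Z ⊕ E Z)) :
    (add_pr1 (E Z) (E Z) + add_pr2 _ _) ∘ a =
    (add_pr1 (E Z) (E Z) + add_pr2 _ _) ∘ b -> a = b.
  rewrite -e => ab; rewrite -[a]add_idl -[b]add_idl.
  have -> : add_id (E Z ⊕ E Z) = (c : add_hom _ _) ∘ (Emap (tri_incl Z false) ∘
      (Emap r ∘ copair (D := D) (Emap (tri_incl Z false)) (Emap (tri_incl Z true)))).
    by rewrite (add_assoc _ (Emap r)) ig add_idl; apply/esym; apply: ci.
  by rewrite -!add_assoc [X in _ ∘ (_ ∘ X)]add_assoc ab !add_assoc.
have := inj (add_in1 _ _) (add_in2 _ _).
rewrite !add_compDl add_pr1in1 add_pr1in2 add_pr2in1 add_pr2in2 addr0 add0r.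
by move=> /(_ erefl) i12; rewrite -(add_pr1in1 (E Z) (E Z)) i12 add_pr1in2.
Qed.

Definition rep_hom R S (f : rep R S) : add_hom (Ealg R) (E (lin_dgcat (mat_lin S))) :=
  Elin (rep_functor f).

Lemma rep_hom_iso R S (f g : rep R S) (P : mat S (rep_idx f) (rep_idx g))
    (Q : mat S (rep_idx g) (rep_idx f)) :
  mmul P Q = mone _ -> mmul Q P = mone _ ->
  (forall x, mmul (f x) P = mmul P (g x)) -> rep_hom f = rep_hom g.
Proof.
move=> PQ QP fP; apply/esym;
  apply: (Elin_iso_functors (M := mat_lin S) (u := P) (v := Q)) => //.
by move=> x; rewrite /= fP.
Qed.

Lemma unit_hom_iso R : exists g, g ∘ rep_hom (rep_id R) = add_id (Ealg R)
  /\ rep_hom (rep_id R) ∘ g = add_id _.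
Proof. exact: Emap_morita (rep_id_morita R). Qed.

(* E applied to the bimodule underlying f. *)
Definition cls R S (f : rep R S) : add_hom (Ealg R) (Ealg S) :=
  sval (cid (unit_hom_iso S)) ∘ rep_hom f.

Lemma clsE R S (f : rep R S) : rep_hom (rep_id S) ∘ cls f = rep_hom f.
Proof.
by rewrite /cls add_assoc; case: cid => g [/= _ ->]; rewrite add_idl.
Qed.

Lemma rep_id_inj R X (a b : add_hom X (Ealg R)) :
  rep_hom (rep_id R) ∘ a = rep_hom (rep_id R) ∘ b -> a = b.
Proof.
have [g [gj _]] := unit_hom_iso R.
by move=> ab; rewrite -[a]add_idl -[b]add_idl -gj -!add_assoc ab.
Qed.

Lemma clsP R S (f g : rep R S) : rep_hom f = rep_hom g -> cls f = cls g.
Proof. by rewrite /cls => ->. Qed.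

Lemma rep_hom_bij R S (f g : rep R S) (s : rep_idx f -> rep_idx g) :
  bijective s -> (forall x i j, f x i j = g x (s i) (s j)) ->
  rep_hom f = rep_hom g.
Proof.
case=> t sK tK fg.
have st : bijective s by exists t.
apply: (rep_hom_iso (P := fun i j => (s i == j)%:R) (Q := fun j i => (s i == j)%:R)).
- by apply: matP => i j; rewrite /mmul sum_delta (can_eq sK).
- apply: matP => i j; rewrite /mmul (reindex t) /=; last first.
    by exists s => l _; [apply: tK | apply: sK].
  under eq_bigr => l _ do rewrite !tK ![l == _]eq_sym.
  exact: sum_delta.
- move=> x; apply: matP => i j; rewrite /mmul (reindex t) /=; last first.
    by exists s => l _; [apply: tK | apply: sK].
  rewrite (bigD1 j) //= tK eqxx mulr1 big1 ?addr0 => [|l lj]; last first.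
    by rewrite tK (negPf lj) mulr0.
  rewrite (bigD1 (s i)) //= eqxx mul1r big1 ?addr0 ?fg ?tK // => l li.
  by rewrite eq_sym (negPf li) mul0r.
Qed.

Lemma mext_rep_hom R S (f : rep R S) :
  Elin (mext_functor f) ∘ rep_hom (rep_id R) = rep_hom f.
Proof.
rewrite -Elin_comp; transitivity (rep_hom (rep_comp f (rep_id R))).
  by congr Emap; apply: dgfunctor_eq.
apply: (@rep_hom_bij R S (rep_comp f (rep_id R)) f (fun x => x.2)) => //.
by exists (pair tt) => // -[[]].
Qed.

(** [mext_functor g] extends the action of [g] from S to all of [mat_lin S], and its composite with
    the functor of [f] is that of [rep_comp g f] strictly. No inverse has to be computed once both
    sides are mapped to [mat_lin T]. *)
Lemma cls_comp R S T (g : rep S T) (f : rep R S) :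
  cls (rep_comp g f) = cls g ∘ cls f.
Proof.
apply: rep_id_inj; rewrite clsE add_assoc clsE -(mext_rep_hom g) -add_assoc clsE.
by rewrite /rep_hom -Elin_comp; congr Emap; apply: dgfunctor_eq.
Qed.

Lemma cls_iso R S (f : rep R S) : (0 < #|rep_idx f|)%N -> bijective f ->
  @isomorphic D (Ealg R) (Ealg S).
Proof.
move=> f0 fbij; have [g [gf fg]] := Emap_morita (rep_morita f0 fbij).
have [h [hj jh]] := unit_hom_iso S.
exists (cls f), (g ∘ rep_hom (rep_id S)); split; rewrite /=.
  by rewrite -add_assoc clsE; apply: gf.
by apply: rep_id_inj; rewrite add_assoc clsE add_assoc fg add_idl add_idr.
Qed.

(** The object [void] has only the zero endomorphism, so the functor factors through the zero
    category. *)
Lemma rep_hom_zero R S : rep_hom (rep_zero R S) = 0.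
Proof.
have h0 : linear (fun _ : R => 0 : cx_trivial k).
  by move=> c x y; apply/rowP => -[].
pose F := @alg_functor k R (zero_lin k) tt (fun _ => 0) h0 erefl (fun _ _ => erefl).
have m0 (x y : zero_lin k) :
    linear (fun _ : lin_hom x y => mat0 void void : mat S void void).
  by move=> c u v; apply: matP => -[].
have m1 : mat0 void void = mone void :> mat S void void by apply: matP => -[].
pose G := @LinFunctor k (zero_lin k) (mat_lin S) (fun _ => void : finType)
  (fun x y _ => mat0 void void) m0 (fun _ => m1)
  (fun _ _ _ _ _ => @matP _ _ _ _ _ _ (fun i : void => match i with end)).
rewrite -(Ezero (lin_dgfunctor G) (lin_dgfunctor F)) -Emap_comp.
rewrite -lin_dgfunctor_comp; congr Emap; apply: dgfunctor_eq => x y n f.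
by congr deg0_in; apply: matP => -[].
Qed.

(* By the hypothesis on T(S), E of the pair (f, g) : R -> tri_mat_lin S is
   determined by its two diagonal components. *)
Lemma rep_hom_sum R S (f g : rep R S) :
  rep_hom (rep_sum f g) = rep_hom f + rep_hom g.
Proof.
pose A := lin_dgcat (alg_lin S); pose h := hull S.
have [t' [t't tt']] := Emap_morita (hull_morita S).
pose i1 : add_hom (E A) (E (tri_dgcat A)) := Emap (tri_incl A false).
pose i2 : add_hom (E A) (E (tri_dgcat A)) := Emap (tri_incl A true).
have [c' cc'] : exists c', copair (D := D) i1 i2 ∘ c' = add_id _.
  by have [c [_ ?]] := hE.2 A; exists c.
have hl : linear (fun x => (f x, g x, 0) :
    tri_mat S (rep_idx f, rep_idx g) (rep_idx f, rep_idx g)).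
  move=> s x y; transitivity (s *: f x + f y, s *: g x + g y,
    s *: 0 + 0 : mat S (rep_idx g) (rep_idx f)); last by [].
  by rewrite !rep_lin scaler0 addr0.
have h1 : (f 1, g 1, 0) = tri_mone S (rep_idx f, rep_idx g).
  by rewrite !rep1.
have hM x y : (f (x * y), g (x * y), 0) = @tri_mmul k S
    (rep_idx f, rep_idx g) (rep_idx f, rep_idx g) (rep_idx f, rep_idx g)
    (f x, g x, 0) (f y, g y, 0).
  by rewrite !repM /tri_mmul /= mmul0l mmul0r addr0.
pose H := @alg_functor k R (tri_mat_lin S) (rep_idx f, rep_idx g) _ hl h1 hM.
pose w : add_hom (Ealg R) (E A ⊕ E A) := c' ∘ (t' ∘ Elin H).
(* As [t'] and [c'] are right inverses, any morphism into E of the hull is a sum of one through each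
   inclusion. *)
have Hw : Elin H = Emap h ∘ i1 ∘ (add_pr1 _ _ ∘ w) + Emap h ∘ i2 ∘ (add_pr2 _ _ ∘ w).
  rewrite -!add_assoc -add_compDr !(add_assoc _ (add_pr1 _ _)) !(add_assoc _ (add_pr2 _ _)).
  rewrite -add_compDl -/(copair (D := D) i1 i2) /w !add_assoc -(add_assoc _ _ c') cc'.
  by rewrite add_idr tt' add_idl.
set a := _ ∘ w in Hw; set b := _ ∘ w in Hw.
pose J := rep_hom (rep_id S).
have comp_hull s (G : linfunctor (tri_mat_lin S) (mat_lin S)) :
    Elin G ∘ (Emap h ∘ Emap (tri_incl A s)) =
    Emap (dgfunctor_comp (lin_dgfunctor G) (dgfunctor_comp h (tri_incl A s))).
  by rewrite !Emap_comp.
have p11 : Elin (tri_pr1 S) ∘ (Emap h ∘ i1) = J.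
  rewrite comp_hull; congr Emap; apply: dgfunctor_eq => x y n s.
  by congr deg0_in; rewrite /= hull_homE.
have p12 : Elin (tri_pr1 S) ∘ (Emap h ∘ i2) = 0.
  rewrite comp_hull -(rep_hom_zero S S); congr Emap.
  by apply: dgfunctor_eq => x y n s; congr deg0_in; apply: matP => -[].
have p21 : Elin (tri_pr2 S) ∘ (Emap h ∘ i1) = 0.
  rewrite comp_hull -(rep_hom_zero S S); congr Emap.
  by apply: dgfunctor_eq => x y n s; congr deg0_in; apply: matP => -[].
have p22 : Elin (tri_pr2 S) ∘ (Emap h ∘ i2) = J.
  rewrite comp_hull; congr Emap; apply: dgfunctor_eq => x y n s.
  by congr deg0_in; rewrite /= hull_homE.
(* Along either inclusion [tri_total] yields the identity bimodule enlarged by an empty block, which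
   a reindexing removes. *)
have t1 : Elin (tri_total S) ∘ (Emap h ∘ i1) = J.
  transitivity (rep_hom (rep_sum (rep_id S) (rep_zero S S))).
    rewrite comp_hull; congr Emap; apply: dgfunctor_eq => x y n s.
    by congr deg0_in; rewrite /= hull_homE; apply: matP => -[[]|[]] [[]|[]].
  apply: (@rep_hom_bij S S (rep_sum (rep_id S) (rep_zero S S)) (rep_id S)
    (fun _ => tt)).
    by exists inl => [[[]|[]]|[]].
  by move=> x [[]|[]] [[]|[]].
have t2 : Elin (tri_total S) ∘ (Emap h ∘ i2) = J.
  transitivity (rep_hom (rep_sum (rep_zero S S) (rep_id S))).
    rewrite comp_hull; congr Emap; apply: dgfunctor_eq => x y n s.
    by congr deg0_in; rewrite /= hull_homE; apply: matP => -[[]|[]] [[]|[]].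
  apply: (@rep_hom_bij S S (rep_sum (rep_zero S S) (rep_id S)) (rep_id S)
    (fun _ => tt)).
    by exists inr => [[[]|[]]|[]].
  by move=> x [[]|[]] [[]|[]].
(* The two diagonal functors isolate [a] and [b], and the total functor gives their sum. Composed
   with [H] these functors are those of [f], [g] and [rep_sum f g]. *)
have Ha : Elin (tri_pr1 S) ∘ Elin H = J ∘ a.
  by rewrite Hw add_compDr (add_assoc _ _ a) (add_assoc _ _ b)
    p11 p12 comp0l addr0.
have Hb : Elin (tri_pr2 S) ∘ Elin H = J ∘ b.
  by rewrite Hw add_compDr (add_assoc _ _ a) (add_assoc _ _ b)
    p21 p22 comp0l add0r.
have Hs : Elin (tri_total S) ∘ Elin H = J ∘ a + J ∘ b.
  by rewrite Hw add_compDr (add_assoc _ _ a) (add_assoc _ _ b)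
    t1 t2.
have Ef : rep_hom f = Elin (tri_pr1 S) ∘ Elin H.
  by rewrite -Elin_comp; congr Emap; apply: dgfunctor_eq.
have Eg : rep_hom g = Elin (tri_pr2 S) ∘ Elin H.
  by rewrite -Elin_comp; congr Emap; apply: dgfunctor_eq.
rewrite Ef Eg Ha Hb -Hs -Elin_comp.
by congr Emap; apply: dgfunctor_eq.
Qed.

Lemma rep_hom_diag R n : rep_hom (rep_diag R 'I_n) = rep_hom (rep_id R) *+ n.
Proof.
elim: n => [|n IHn].
  rewrite mulr0n -(rep_hom_zero R R).
  apply: (@rep_hom_iso R R (rep_diag R 'I_0) (rep_zero R R) (mat0 _ _) (mat0 _ _)).
  - by apply: matP => -[].
  - by apply: matP => -[].
  - by move=> x; apply: matP => -[].
rewrite mulrS -IHn -rep_hom_sum; apply/esym.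
apply: (@rep_hom_bij R R (rep_sum (rep_id R) (rep_diag R 'I_n)) (rep_diag R 'I_n.+1)
  (fun l => if l is inr i then lift ord0 i else ord0)).
  exists (fun i => if unlift ord0 i is Some j then inr j else inl tt).
    by case=> [[]|i]; rewrite ?unlift_none ?liftK.
  by move=> i; case: unliftP => [j|] ->.
by move=> x [[]|i] [[]|j].
Qed.

(** The last hypothesis says that [P] conjugates [f] to the diagonal action, i.e. that the bimodule
    of [f] is a sum of n copies of R. *)
Lemma cls_diag R (f : rep R R) n (P : mat R (rep_idx f) 'I_n)
    (Q : mat R 'I_n (rep_idx f)) :
  mmul P Q = mone _ -> mmul Q P = mone _ ->
  (forall x i j, mmul (f x) P i j = P i j * x) -> cls f = add_id (Ealg R) *+ n.
Proof.
move=> PQ QP fP; apply: rep_id_inj; rewrite clsE compMnr add_idr -rep_hom_diag.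
apply: (rep_hom_iso (g := rep_diag R 'I_n) PQ QP) => x.
apply: matP => i j; rewrite fP /mmul (bigD1 j) //= eqxx.
by rewrite big1 ?addr0 // => l lj; rewrite (negPf lj) mulr0.
Qed.

End AdditiveInvariant.

(** * Central division algebras *)

Lemma linear_inj_surj (k : fieldType) (V : vectType k) (f : V -> V) :
  linear f -> injective f -> forall w, exists v, f v = w.
Proof.
move=> fl fi w.
pose F : {linear V -> V} := HB.pack f (GRing.isLinear.Build _ _ _ _ f fl).
have k0 : lker (linfun F) == 0%VS.
  by apply/lker0P => u v; rewrite !lfunE; apply: fi.
by exists ((linfun F)^-1%VF w); have := lker0_lfunVK k0 w; rewrite lfunE.
Qed.

Section Coordinates.
Import VectorInternalTheory.
Variables (k : fieldType) (A : falgType k).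

Definition adim : nat := dim A.

Lemma adimE : adim = \dim {:A}.
Proof. by rewrite dimvf. Qed.

Local Notation n := (dim A).

Definition bvec (i : 'I_n) : A := r2v (delta_mx 0 i).
Definition coord_of (a : A) (i : 'I_n) : k := v2r a 0 i.

Lemma coord_ofE (a : A) : a = \sum_i coord_of a i *: bvec i.
Proof. exact: v2r_sum. Qed.

Lemma coord_of_lin i : linear (fun a => coord_of a i : k^o).
Proof. by move=> c a b; rewrite /coord_of linearP !mxE. Qed.

Lemma coord_of_sum (c : 'I_n -> k) i : coord_of (\sum_j c j *: bvec j) i = c i.
Proof.
have -> : \sum_j c j *: bvec j = r2v (\row_j c j).
  by rewrite [RHS]v2r_sum r2vK; apply: eq_bigr => j _; rewrite mxE.
by rewrite /coord_of r2vK mxE.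
Qed.

Definition reg (a : A) (i j : 'I_n) : k := coord_of (a * bvec j) i.

Lemma regE a j : a * bvec j = \sum_i reg a i j *: bvec i.
Proof. exact: coord_ofE. Qed.

Lemma reg_lin i j : linear (fun a => reg a i j : k^o).
Proof. by move=> c a b; rewrite /reg mulrDl -scalerAl; apply: coord_of_lin. Qed.

Lemma reg1 i j : reg 1 i j = (i == j)%:R.
Proof.
rewrite /reg mul1r -(coord_of_sum (fun i => (i == j)%:R)); congr coord_of.
rewrite (bigD1 j) //= eqxx scale1r big1 ?addr0 // => l lj.
by rewrite (negPf lj) scale0r.
Qed.

Lemma regM a b i j : reg (a * b) i j = \sum_l reg a i l * reg b l j.
Proof.
rewrite {1}/reg -mulrA (regE b) mulr_sumr.
under eq_bigr => l _ do rewrite -scalerAr.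
rewrite (lin_sum (@coord_of_lin i)); apply: eq_bigr => l _.
by rewrite (linZ (@coord_of_lin i)) mulrC.
Qed.

End Coordinates.

(** For z central in D the scalar matrix z is central in the matrix algebra, hence comes from the
    center of A, which is k; an entry of the matrix gives z. *)
Lemma center_matrix_algebra (k : fieldType) (A D : falgType k) n (z : D) :
  'Z({:A})%VS = 1%VS -> matrix_algebra_over A D n ->
  (forall x, z * x = x * z) -> exists c : k, z = c%:A.
Proof.
move=> ZA [phi [psi phiK psiK] phiZ] zx.
have : psi z%:M \in 'Z({:A})%VS.
  rewrite memv_cap memvf /=; apply/centvP => a _.
  apply: (can_inj phiK); rewrite !rmorphM psiK; apply/matrixP => i j.
  rewrite -!mulmxE mul_scalar_mx !mxE (bigD1 j) //= big1 => [|l lj].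
    by rewrite !mxE eqxx mulr1n addr0 zx.
  by rewrite !mxE (negPf lj) mulr0.
rewrite ZA => /vlineP[c e]; exists c.
have := congr1 phi e; rewrite psiK phiZ rmorph1 => /matrixP/(_ 0 0).
by rewrite !mxE eqxx !mulr1n mulr1.
Qed.

Section CentralDivision.
Variables (k : fieldType) (D : falgType k).
Hypothesis hD : division_algebra D.
Hypothesis hZ : forall z : D, (forall x, z * x = x * z) -> exists c : k, z = c%:A.
Local Notation n := (adim D).

(* A relation of minimal length may be normalized to have a coefficient 1; its
   commutators are shorter, so its coefficients are central. *)
Lemma bimodule_indep (l : 'I_n -> D) :
  (forall x, \sum_i l i * x * bvec i = 0) -> forall i, l i = 0.
Proof.
elim: {l}_.+1 {-2}l (ltnSn #|[pred i | l i != 0]|) => // m IHm l lm lx i.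
apply/eqP; apply: contraT => li.
pose u j := (l i)^-1 * l j.
have ui : u i = 1 by rewrite /u mulVr ?hD.
have ux x : \sum_j u j * x * bvec j = 0.
  transitivity ((l i)^-1 * \sum_j l j * x * bvec j); last by rewrite lx mulr0.
  by rewrite mulr_sumr; apply: eq_bigr => j _; rewrite !mulrA.
have uc j t : u j * t = t * u j.
  apply/eqP; rewrite -subr_eq0; apply/eqP; move: j.
  apply: (IHm (fun j => u j * t - t * u j)) => [|x].
    rewrite ltnS in lm; apply: leq_trans lm; apply: proper_card; apply/properP; split.
      apply/subsetP => j; rewrite !inE; apply: contraNneq => lj.
      by rewrite /u lj !mulr0 mul0r subrr.
    by exists i; rewrite !inE ?li // ui mul1r mulr1 subrr eqxx.
  transitivity (\sum_j u j * (t * x) * bvec j - t * \sum_j u j * x * bvec j).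
    rewrite mulr_sumr -sumrB; apply: eq_bigr => j _.
    by rewrite !mulrBl !mulrA.
  by rewrite !ux mulr0 subrr.
have [c uE] := fin_all_exists (fun j => hZ (uc j)).
(* The coefficients now lie in k, so the relation at x = 1 is a linear relation among basis vectors,
   contradicting u_i = 1. *)
have := ux 1; under eq_bigr => j _ do rewrite mulr1 uE -scalerAl mul1r.
move=> /(congr1 (fun v => coord_of v i)).
rewrite coord_of_sum (lin0 (@coord_of_lin k D i)) => ci.
by have := oner_neq0 D; rewrite -ui uE ci scale0r eqxx.
Qed.

(** The order of the factors matters: a row l times column j is the sum of the l_i e_j e_i, the
    value at x = e_j of the map x |-> sum of the l_i x e_i treated in [bimodule_indep]. *)
Definition sep_mx : mat D 'I_n 'I_n := fun i j => bvec j * bvec i.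

Lemma sep_mx_reg a i j :
  \sum_l reg a l j *: sep_mx i l = a * sep_mx i j.
Proof.
rewrite /sep_mx mulrA (regE a j) mulr_suml.
by apply: eq_bigr => l _; rewrite scalerAl.
Qed.

(* The left multiplication of D on itself and the scalar matrices are conjugate
   over D, by the inverse of [sep_mx]. *)
Lemma sep_mx_inv : exists Q : mat D 'I_n 'I_n,
  [/\ mmul sep_mx Q = mone _, mmul Q sep_mx = mone _ &
    forall a i j, \sum_l reg a i l *: Q l j = Q i j * a].
Proof.
(* Multiplication of rows by [sep_mx] is k-linear on a finite-dimensional space, so injectivity
   yields surjectivity; the preimages of the unit rows are the rows of Q. *)
pose f (l : {ffun 'I_n -> D}) : {ffun 'I_n -> D} :=
  [ffun j => \sum_i l i * sep_mx i j].
have fl : linear f.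
  move=> c l l'; apply/ffunP => j; rewrite !ffunE scaler_sumr -big_split.
  by apply: eq_bigr => i _; rewrite !ffunE mulrDl scalerAl.
have f_inj (l : 'I_n -> D) : (forall j, \sum_i l i * sep_mx i j = 0) -> forall i, l i = 0.
  move=> l0; apply: bimodule_indep => x.
  rewrite [x]coord_ofE; under eq_bigr => i _ do rewrite mulr_sumr mulr_suml.
  rewrite exchange_big big1 // => j _.
  transitivity (coord_of x j *: \sum_i l i * sep_mx i j); last first.
    by rewrite l0 scaler0.
  by rewrite scaler_sumr; apply: eq_bigr => i _; rewrite -scalerAr -scalerAl mulrA.
have fi : injective f.
  move=> l l' /ffunP ll'; apply/ffunP => i; apply/eqP; rewrite -subr_eq0; apply/eqP.
  move: i.
  apply: (f_inj (fun i => l i - l' i)) => j; have := ll' j; rewrite !ffunE => e.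
  under eq_bigr => i _ do rewrite mulrBl.
  by rewrite sumrB e subrr.
have h i := linear_inj_surj fl fi [ffun j => (i == j)%:R].
have [Q QP] := fin_all_exists h.
have {}QP : mmul (fun i j => Q i j) sep_mx = mone _.
  apply: matP => i j; have := congr1 (fun l : {ffun _} => l j) (QP i).
  by rewrite !ffunE.
pose Q' : mat D 'I_n 'I_n := fun i j => Q i j; rewrite -/Q' in QP.
(* The left inverse is two-sided: each row of [sep_mx] Q' - 1 is killed by right multiplication by
   [sep_mx], which is injective. *)
have PQ : mmul sep_mx Q' = mone _.
  apply: matP => i j; apply/eqP; rewrite -subr_eq0; apply/eqP; move: j.
  apply: (f_inj (fun j => mmul sep_mx Q' i j - mone _ i j)) => j.
  under eq_bigr => l _ do rewrite mulrBl.
  rewrite sumrB -[X in X - _]/(mmul (mmul sep_mx Q') sep_mx i j).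
  by rewrite -mmulA QP mmul1r -[X in _ - X]/(mmul (mone _) sep_mx i j) mmul1l subrr.
exists Q'; split=> // a i j.
pose ra : mat D 'I_n 'I_n := fun i j => (reg a i j)%:A.
pose da : mat D 'I_n 'I_n := fun i j => if i == j then a else 0.
(* [sep_mx] intertwines the regular matrices, with entries in k, and the diagonal matrices of [a];
   conjugating by it gives the identity for Q. *)
have Pra : mmul sep_mx ra = mmul da sep_mx.
  apply: matP => i' j'; rewrite /mmul (bigD1 i' (F := fun l => da i' l * _)) //=.
  rewrite /da eqxx [X in _ = _ + X]big1 ?addr0 -?sep_mx_reg => [|l li].
    by apply: eq_bigr => l _; rewrite -scalerAr mulr1.
  by rewrite eq_sym (negPf li) mul0r.
have raQ : mmul ra Q' = mmul Q' da.
  by rewrite -[ra]mmul1l -QP -(mmulA Q') Pra -!mmulA PQ mmul1r.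
transitivity (mmul ra Q' i j).
  by apply: eq_bigr => l _; rewrite -scalerAl mul1r.
rewrite raQ /mmul (bigD1 j) //= /da eqxx big1 ?addr0 // => l lj.
by rewrite (negPf lj) mulr0.
Qed.

End CentralDivision.

(** * Tensor products *)

Section TensorLift.
Import VectorInternalTheory.
Variables (k : fieldType) (A B : falgType k) (V : lmodType k).
Variable f : A -> B -> V.
Hypothesis fl : forall b, linear (f^~ b).
Hypothesis fr : forall a, linear (f a).

Definition tens_lift (t : A ⊗ B) : V :=
  \sum_i \sum_j t i j *: f (r2v (delta_mx 0 i)) (r2v (delta_mx 0 j)).

Lemma tens_lift_lin : linear tens_lift.
Proof.
move=> c t s; rewrite /tens_lift scaler_sumr -big_split; apply: eq_bigr => i _.
rewrite /= scaler_sumr -big_split; apply: eq_bigr => j _.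
by rewrite /= !mxE scalerDl scalerA.
Qed.

Lemma tens_liftE a b : tens_lift (tens a b) = f a b.
Proof.
rewrite {2}[a]v2r_sum (lin_sum (@fl b)); apply: eq_bigr => i _.
rewrite (linZ (@fl b)) {2}[b]v2r_sum (lin_sum (@fr _)) scaler_sumr.
apply: eq_bigr => j _; rewrite (linZ (@fr _)) scalerA; congr (_ *: _).
by rewrite !mxE big_ord1 !mxE.
Qed.

End TensorLift.

Section TensorFacts.
Variables (k : fieldType) (A B : falgType k).

Lemma tens_lin_eq (V : lmodType k) (f g : A ⊗ B -> V) : linear f -> linear g ->
  (forall a b, f (tens a b) = g (tens a b)) -> f =1 g.
Proof.
move=> fl gl fg; apply: tens_ind => [c x y fx fy|]; last exact: fg.
by rewrite fl gl fx fy.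
Qed.

Lemma tensM (a a' : A) (b b' : B) :
  tens a b * tens a' b' = tens (a * a') (b * b').
Proof. exact: tens_mulE. Qed.

Lemma tens_lift_mul (U : lmodType k) (f : A -> B -> U)
    (fl : forall b, linear (f^~ b)) (fr : forall a, linear (f a))
    (mu : U -> U -> U) (mul : forall v, linear (mu^~ v)) (mur : forall u, linear (mu u)) :
  (forall a a' b b', f (a * a') (b * b') = mu (f a b) (f a' b')) ->
  forall s t, tens_lift f (s * t) = mu (tens_lift f s) (tens_lift f t).
Proof.
move=> fM s t; move: s; apply: tens_ind => [c x y ex ey|a b].
  by rewrite mulrDl -scalerAl !tens_lift_lin ex ey -mul.
move: t; apply: tens_ind => [c x y ex ey|a' b'].
  by rewrite mulrDr -scalerAr !tens_lift_lin ex ey -mur.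
by rewrite tensM !tens_liftE.
Qed.

Definition rep_of_tens (R : algType k) (I : finType) (f : A -> B -> mat R I I)
    (fl : forall b, linear (f^~ b)) (fr : forall a, linear (f a))
    (f1 : f 1 1 = mone I)
    (fM : forall a a' b b', f (a * a') (b * b') = mmul (f a b) (f a' b')) :
  rep (A ⊗ B) R.
Proof.
refine (@Rep k (A ⊗ B) R I (tens_lift f) (tens_lift_lin f) _ _).
- by rewrite -f1 -(tens_liftE fl fr).
- exact: (@tens_lift_mul (mat R I I) f fl fr (@mmul _ _ I I I)
    (@mmul_linl k R I I I) (@mmul_linr k R I I I) fM).
Defined.

Lemma rep_of_tensE (R : algType k) (I : finType) (f : A -> B -> mat R I I)
    fl fr f1 fM a b : @rep_of_tens R I f fl fr f1 fM (tens a b) = f a b.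
Proof. exact: tens_liftE. Qed.

End TensorFacts.

(** * Free bimodules between tensor products *)

Section TensorRep.
Variables (k : fieldType).

Section MapTensor.
Variables (R S B : falgType k) (f : rep R S).

Definition rep_tensl : rep (R ⊗ B) (S ⊗ B).
Proof.
refine (@rep_of_tens k R B (S ⊗ B) (rep_idx f)
  (fun r b => fun i j => tens (f r i j) b) _ _ _ _).
- by move=> b c r r'; apply: matP => i j; rewrite rep_lin mat_linE tens_linearl.
- by move=> r c b b'; apply: matP => i j; rewrite tens_linearr.
- apply: matP => i j; rewrite rep1 /mone.
  by case: eqP => // _; apply: lin0 (fun c x y => tens_linearl 1 c x y).
- move=> r r' b b'; apply: matP => i j; rewrite repM /mmul.
  rewrite (lin_sum (fun c x y => tens_linearl (b * b') c x y)).
  by apply: eq_bigr => l _; rewrite tensM.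
Defined.

Lemma rep_tenslE r b i j : rep_tensl (tens r b) i j = tens (f r i j) b.
Proof. by rewrite /rep_tensl rep_of_tensE. Qed.

Definition rep_tensr : rep (B ⊗ R) (B ⊗ S).
Proof.
refine (@rep_of_tens k B R (B ⊗ S) (rep_idx f)
  (fun b r => fun i j => tens b (f r i j)) _ _ _ _).
- by move=> r c b b'; apply: matP => i j; rewrite tens_linearl.
- by move=> b c r r'; apply: matP => i j; rewrite rep_lin mat_linE tens_linearr.
- apply: matP => i j; rewrite rep1 /mone.
  by case: eqP => // _; apply: lin0 (fun c x y => tens_linearr 1 c x y).
- move=> b b' r r'; apply: matP => i j; rewrite repM /mmul.
  rewrite (lin_sum (fun c x y => tens_linearr (b * b') c x y)).
  by apply: eq_bigr => l _; rewrite tensM.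
Defined.

Lemma rep_tensrE b r i j : rep_tensr (tens b r) i j = tens b (f r i j).
Proof. by rewrite /rep_tensr rep_of_tensE. Qed.

End MapTensor.

Section Action.
Variables (D X : falgType k).
Local Notation I := ('I_(adim D)).

Definition rep_actl : rep (D ⊗ X) X.
Proof.
refine (@rep_of_tens k D X X I (fun d x => fun i j => reg d i j *: x) _ _ _ _).
- by move=> x c d d'; apply: matP => i j; rewrite mat_linE reg_lin scalerDl scalerA.
- by move=> d c x x'; apply: matP => i j; rewrite mat_linE scalerDr scalerA mulrC -scalerA.
- by apply: matP => i j; rewrite reg1 /mone; case: eqP; rewrite ?scale1r ?scale0r.
- move=> d d' x x'; apply: matP => i j; rewrite regM scaler_suml.
  by apply: eq_bigr => l _; rewrite -scalerAl -scalerAr scalerA.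
Defined.

Lemma rep_actlE d x i j : rep_actl (tens d x) i j = reg d i j *: x.
Proof. by rewrite /rep_actl rep_of_tensE. Qed.

Definition rep_actr : rep (X ⊗ D) X.
Proof.
refine (@rep_of_tens k X D X I (fun x d => fun i j => reg d i j *: x) _ _ _ _).
- by move=> d c x x'; apply: matP => i j; rewrite mat_linE scalerDr scalerA mulrC -scalerA.
- by move=> x c d d'; apply: matP => i j; rewrite mat_linE reg_lin scalerDl scalerA.
- by apply: matP => i j; rewrite reg1 /mone; case: eqP; rewrite ?scale1r ?scale0r.
- move=> x x' d d'; apply: matP => i j; rewrite regM scaler_suml.
  by apply: eq_bigr => l _; rewrite -scalerAl -scalerAr scalerA.
Defined.

Lemma rep_actrE x d i j : rep_actr (tens x d) i j = reg d i j *: x.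
Proof. by rewrite /rep_actr rep_of_tensE. Qed.

Definition rep_inl : rep X (X ⊗ D).
Proof.
refine (@rep_of_alg k X (X ⊗ D) (fun x => tens x 1) _ _ _).
- exact: tens_linearl.
- by [].
- by move=> x y; rewrite tensM mulr1.
Defined.

Definition rep_inr : rep X (D ⊗ X).
Proof.
refine (@rep_of_alg k X (D ⊗ X) (fun x => tens 1 x) _ _ _).
- exact: tens_linearr.
- by [].
- by move=> x y; rewrite tensM mulr1.
Defined.

End Action.

End TensorRep.

(** * Tensoring an isomorphism with a matrix algebra *)

Section MatrixUnits.
Variables (k : fieldType) (S : algType k) (I : finType).

Definition mdelta (i j : I) (s : S) : mat S I I :=
  fun i' j' => if (i' == i) && (j' == j) then s else 0.

Lemma mdelta_lin i j : linear (mdelta i j).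
Proof.
move=> c s t; apply: matP => i' j'; rewrite mat_linE /mdelta.
by case: ifP; rewrite // scaler0 addr0.
Qed.

Lemma mat_sum_delta (a : mat S I I) : a = \sum_i \sum_j mdelta i j (a i j).
Proof.
apply: matP => i j; rewrite mat_sumE (bigD1 i) //= mat_sumE (bigD1 j) //=.
rewrite /mdelta !eqxx big1 ?addr0 => [|j' jj']; last first.
  by rewrite [j == _]eq_sym (negPf jj') andbF.
rewrite big1 ?addr0 // => i' ii'; rewrite mat_sumE big1 // => j' _.
by rewrite eq_sym (negPf ii').
Qed.

Lemma mat_bij (V : lmodType k) (f : V -> mat S I I) (g : I -> I -> S -> V) :
  linear f -> (forall i j s, f (g i j s) = mdelta i j s) ->
  (forall v, \sum_i \sum_j g i j (f v i j) = v) -> bijective f.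
Proof.
move=> fl fg gf; exists (fun a => \sum_i \sum_j g i j (a i j)) => [v|a].
  exact: gf.
rewrite (lin_sum fl) [RHS]mat_sum_delta; apply: eq_bigr => i _.
by rewrite (lin_sum fl); apply: eq_bigr => j _.
Qed.

End MatrixUnits.

Section BijectiveTensor.
Variables (k : fieldType) (R S B : falgType k) (f : rep R S).
Local Notation I := (rep_idx f).
Variable g : mat S I I -> R.
Hypotheses (fK : cancel f g) (gK : cancel g f).

Let gl : linear g.
Proof. by move=> c a b; apply: (can_inj fK); rewrite rep_lin !gK. Qed.

Let unit_l (i j : I) (s : S) (b : B) : R ⊗ B := tens (g (mdelta i j s)) b.
Let unit_r (i j : I) (b : B) (s : S) : B ⊗ R := tens b (g (mdelta i j s)).

Let unit_l1 i j b : linear (fun s => unit_l i j s b).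
Proof. by move=> c s t; rewrite /unit_l mdelta_lin gl tens_linearl. Qed.
Let unit_l2 i j s : linear (unit_l i j s).
Proof. exact: tens_linearr. Qed.
Let unit_r1 i j s : linear (fun b => unit_r i j b s).
Proof. exact: tens_linearl. Qed.
Let unit_r2 i j b : linear (unit_r i j b).
Proof. by move=> c s t; rewrite /unit_r mdelta_lin gl tens_linearr. Qed.

Let unit_sum r : \sum_i \sum_j g (mdelta i j (f r i j)) = r.
Proof.
rewrite -[RHS]fK [in RHS](mat_sum_delta (f r)) (lin_sum gl).
by apply: eq_bigr => i _; rewrite (lin_sum gl).
Qed.

(** The matrix unit with entry s ⊗ b is the image of [g (mdelta i j s)] ⊗ b. Linear extension in s ⊗
    b gives an inverse defined on all matrices. *)
Lemma rep_tensl_bij : bijective (rep_tensl B f).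
Proof.
apply: (mat_bij (g := fun i j => tens_lift (unit_l i j))) => [|i j|].
- exact: (@rep_lin _ _ _ (rep_tensl B f)).
- apply: tens_lin_eq => [||s b].
  + by move=> c x y; rewrite tens_lift_lin rep_lin.
  + exact: mdelta_lin.
  + rewrite (tens_liftE (@unit_l1 i j) (@unit_l2 i j)); apply: matP => i' j'.
    rewrite rep_tenslE gK /mdelta; case: ifP => // _.
    exact: lin0 (fun c x y => tens_linearl b c x y).
- apply: tens_lin_eq => // [c x y|r b].
  + rewrite scaler_sumr -big_split; apply: eq_bigr => i _ /=.
    rewrite scaler_sumr -big_split; apply: eq_bigr => j _ /=.
    rewrite -tens_lift_lin; congr tens_lift.
    exact: (congr1 (fun a : mat _ I I => a i j) (rep_lin (rep_tensl B f) c x y)).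
  + rewrite -[in RHS](unit_sum r) (lin_sum (fun c x y => tens_linearl b c x y)).
    apply: eq_bigr => i _; rewrite (lin_sum (fun c x y => tens_linearl b c x y)).
    by apply: eq_bigr => j _; rewrite rep_tenslE (tens_liftE (@unit_l1 i j) (@unit_l2 i j)).
Qed.

Lemma rep_tensr_bij : bijective (rep_tensr B f).
Proof.
apply: (mat_bij (g := fun i j => tens_lift (unit_r i j))) => [|i j|].
- exact: (@rep_lin _ _ _ (rep_tensr B f)).
- apply: tens_lin_eq => [||b s].
  + by move=> c x y; rewrite tens_lift_lin rep_lin.
  + exact: mdelta_lin.
  + rewrite (tens_liftE (@unit_r1 i j) (@unit_r2 i j)); apply: matP => i' j'.
    rewrite rep_tensrE gK /mdelta; case: ifP => // _.
    exact: lin0 (fun c x y => tens_linearr b c x y).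
- apply: tens_lin_eq => // [c x y|b r].
  + rewrite scaler_sumr -big_split; apply: eq_bigr => i _ /=.
    rewrite scaler_sumr -big_split; apply: eq_bigr => j _ /=.
    rewrite -tens_lift_lin; congr tens_lift.
    exact: (congr1 (fun a : mat _ I I => a i j) (rep_lin (rep_tensr B f) c x y)).
  + rewrite -[in RHS](unit_sum r) (lin_sum (fun c x y => tens_linearr b c x y)).
    apply: eq_bigr => i _; rewrite (lin_sum (fun c x y => tens_linearr b c x y)).
    by apply: eq_bigr => j _; rewrite rep_tensrE (tens_liftE (@unit_r1 i j) (@unit_r2 i j)).
Qed.

End BijectiveTensor.

Lemma rep_of_matrix_algebra (k : fieldType) (A D : falgType k) n :
  matrix_algebra_over A D n ->
  exists2 f : rep A D, bijective f & (0 < #|rep_idx f|)%N.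
Proof.
case=> phi [psi phiK psiK] phiZ.
have fl : linear (fun a => (fun i j => phi a i j) : mat D 'I_n.+1 'I_n.+1).
  move=> c a b; apply: matP => i j.
  by rewrite mat_linE rmorphD phiZ !mxE -scalerAl mul1r.
have f1 : (fun i j => phi 1 i j) = mone 'I_n.+1 :> mat D _ _.
  by apply: matP => i j; rewrite rmorph1 !mxE.
have fM a b : (fun i j => phi (a * b) i j) =
    mmul (fun i j => phi a i j) (fun i j => phi b i j) :> mat D 'I_n.+1 'I_n.+1.
  by apply: matP => i j; rewrite rmorphM mxE.
exists (Rep fl f1 fM); last by rewrite card_ord.
exists (fun a : mat D 'I_n.+1 'I_n.+1 => psi (\matrix_(i, j) a i j)) => a /=.
  by rewrite -[RHS]phiK; congr psi; apply/matrixP => i j; rewrite mxE.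
by apply: matP => i j; rewrite psiK mxE.
Qed.

(** * Central division algebras and additive invariants *)

Definition central_division (k : fieldType) (D : falgType k) : Prop :=
  division_algebra D /\
  forall z : D, (forall x, z * x = x * z) -> exists c : k, z = c%:A.

Lemma rep_linE (k : fieldType) (R S : algType k) (f : rep R S) c x y i j :
  f (c *: x + y) i j = c *: f x i j + f y i j.
Proof. by rewrite rep_lin. Qed.

Section Main.
Variables (k : fieldType) (C : additive_category).
Variable E : functor (dgcat_category k) C.
Hypothesis hE : additive_invariant E.
Local Notation Ealg R := (E (lin_dgcat (alg_lin R))).
Local Notation cls := (cls hE).

(** * Inclusion and regular representation for a central division algebra *)

Section CentralDivisionAction.
Variables (D : falgType k) (X Y : algType k).
Hypothesis hD : central_division D.
Local Notation n := (adim D).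
Variables (u : rep X Y) (o : rep_idx u) (v : rep Y X).
Variables (s : rep_idx v -> 'I_n) (d : D -> Y).
Hypothesis uo : forall i, i = o.
Hypothesis sb : bijective s.
Hypotheses (dl : linear d) (d1 : d 1 = 1).
Hypothesis dM : forall a b, d (a * b) = d a * d b.
Hypothesis du : forall a x, d a * u x o o = u x o o * d a.
Hypothesis Yspan : forall f g : Y -> Y, linear f -> linear g ->
  (forall a x, f (d a * u x o o) = g (d a * u x o o)) -> f =1 g.
Hypothesis vE : forall a x i j, v (d a * u x o o) i j = reg a (s i) (s j) *: x.

(** Restricted to X, the representation [v] is diagonal, because the regular matrix of 1 is the
    identity. *)
Lemma cls_vu : cls v ∘ cls u = add_id (Ealg X) *+ n.
Proof.
rewrite -cls_comp; apply: (rep_id_inj hE); rewrite clsE compMnr add_idr -(rep_hom_diag hE).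
apply: (@rep_hom_bij _ _ _ hE X X (rep_comp v u) (rep_diag X 'I_n) (fun p => s p.2)).
  case: sb => t sK tK; exists (fun i => (o, t i)) => [[i j]|i] /=.
    by rewrite sK (uo i).
  by rewrite tK.
move=> x [i i'] [j j'] /=; rewrite /mext /= (uo i) (uo j).
rewrite -[u x o o]mul1r -d1 vE reg1.
by case: eqP; rewrite ?scale1r ?scale0r.
Qed.

(** The composite sends d(a) u(x) to the regular matrix of a with entries multiplied by u(x). The
    image under [d] of the inverse of [sep_mx] conjugates it to the diagonal action of d(a) u(x),
    since d(D) commutes with u(X); as these products span Y, this determines the whole action. *)
Lemma cls_uv : cls u ∘ cls v = add_id (Ealg Y) *+ n.
Proof.
have [t sK tK] := sb.
have [Q [PQ QP regQ]] := sep_mx_inv hD.1 hD.2.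
have d0 := lin0 dl.
have dmone (I : finType) (i j : I) : d (mone I i j) = (i == j)%:R.
  by rewrite /mone; case: eqP.
have dmul (I J K : finType) (a : mat D I J) (b : mat D J K) i j :
    d (mmul a b i j) = \sum_l d (a i l) * d (b l j).
  by rewrite (lin_sum dl); apply: eq_bigr => l _; rewrite dM.
have sumE (F : rep_idx v * rep_idx u -> Y) : \sum_p F p = \sum_l F (t l, o).
  rewrite (reindex (fun l => (t l, o))) //=.
  exists (fun p => s p.1) => [l _|[i j] _] /=; first exact: tK.
  by rewrite sK (uo j).
rewrite -cls_comp.
apply: (@cls_diag _ _ _ hE Y (rep_comp u v) n (fun p j => d (Q (s p.1) j))
  (fun j p => d (@sep_mx k D j (s p.1)))).
- apply: matP => -[i o1] [j o2]; rewrite /mmul -dmul QP dmone /mone.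
  by rewrite xpair_eqE (can_eq sK) (uo o1) (uo o2) eqxx andbT.
- apply: matP => i j; rewrite /mmul sumE.
  by under eq_bigr => l _ do rewrite /= tK; rewrite -dmul PQ dmone.
- move=> y [i o1] j; rewrite /= /mmul sumE /mext /= (uo o1).
  under eq_bigr => l _ do rewrite tK.
  move: y; apply: Yspan => [c y y'|c y y'|a x].
  + rewrite scaler_sumr -big_split; apply: eq_bigr => l _ /=.
    by rewrite rep_lin mat_linE rep_lin mat_linE mulrDl scalerAl.
  + by rewrite mulrDr scalerAr.
  + rewrite mulrA -dM -regQ (lin_sum dl) mulr_suml; apply: eq_bigr => l _.
    rewrite vE tK (linZ dl) -scalerAl du.
    have -> : u (reg a (s i) l *: x) o o = reg a (s i) l *: u x o o.
      exact: (congr1 (fun a : mat Y _ _ => a o o) (linZ (rep_lin u) _ _)).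
    by rewrite -scalerAl.
Qed.

End CentralDivisionAction.

Lemma cls_act (D X : falgType k) : central_division D ->
  cls (rep_actl D X) ∘ cls (rep_inr D X) = add_id (Ealg X) *+ adim D /\
  cls (rep_inr D X) ∘ cls (rep_actl D X) = add_id (Ealg (D ⊗ X)) *+ adim D.
Proof.
move=> hD.
have dl : linear (fun a : D => tens a (1 : X)) by exact: tens_linearl.
have dM (a b : D) : tens (a * b) (1 : X) = tens a 1 * tens b 1.
  by rewrite tensM mulr1.
have du (a : D) (x : X) : tens a 1 * tens 1 x = tens 1 x * tens a 1.
  by rewrite !tensM !mulr1 !mul1r.
have vE (a : D) (x : X) i j :
    rep_actl D X (tens a 1 * tens 1 x) i j = reg a i j *: x.
  by rewrite tensM mulr1 mul1r rep_actlE.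
have sp (f g : D ⊗ X -> D ⊗ X) : linear f -> linear g ->
    (forall a x, f (tens a 1 * tens 1 x) = g (tens a 1 * tens 1 x)) -> f =1 g.
  move=> fl gl fg; apply: tens_lin_eq => // a x.
  by have := fg a x; rewrite tensM mulr1 mul1r.
have uo (i : unit) : i = tt by case: i.
have sb : bijective (fun i : 'I_(adim D) => i) by exists id.
split.
- exact: (@cls_vu D X (D ⊗ X) (rep_inr D X) tt (rep_actl D X) id _ uo sb erefl vE).
- exact: (@cls_uv D X (D ⊗ X) hD (rep_inr D X) tt (rep_actl D X) id _ uo sb
    dl erefl dM du sp vE).
Qed.

(** * The edges and the mixed faces of the square *)

Section ThreeFactors.
Variables (A B X : falgType k).

Lemma tens3_lin_eq (V : lmodType k) (f g : A ⊗ B ⊗ X -> V) :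
  linear f -> linear g ->
  (forall a b x, f (tens (tens a b) x) = g (tens (tens a b) x)) -> f =1 g.
Proof.
move=> fl gl fg; apply: tens_lin_eq => // t x; move: t.
apply: tens_lin_eq => // c t t'; first by rewrite tens_linearl fl.
by rewrite tens_linearl gl.
Qed.

(** [A ⊗ B ⊗ X] is bracketed to the left, so A is not its outer factor and [cls_act] does not apply
    directly. Here [d] and [u] embed A and [B ⊗ X] as commuting subalgebras that span it. *)
Lemma cls_act3l : central_division A ->
  cls (rep_tensl X (rep_actl A B)) ∘ cls (rep_tensl X (rep_inr A B))
    = add_id (Ealg (B ⊗ X)) *+ adim A /\
  cls (rep_tensl X (rep_inr A B)) ∘ cls (rep_tensl X (rep_actl A B))
    = add_id (Ealg (A ⊗ B ⊗ X)) *+ adim A.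
Proof.
move=> hA.
pose d (a : A) : A ⊗ B ⊗ X := tens (tens a 1) 1.
pose u (t : B ⊗ X) : A ⊗ B ⊗ X := rep_tensl X (rep_inr A B) t tt tt.
have dl : linear d by move=> c a b; rewrite /d !tens_linearl.
have dM a b : d (a * b) = d a * d b by rewrite /d !tensM !mulr1.
have ul : linear u.
  by move=> c t t'; rewrite /u rep_lin mat_linE.
have uE b x : u (tens b x) = tens (tens 1 b) x by rewrite /u rep_tenslE.
have duE a b x : d a * u (tens b x) = tens (tens a b) x.
  by rewrite uE !tensM !mulr1 !mul1r.
have du a t : d a * u t = u t * d a.
  move: t; apply: tens_lin_eq => [c t t'|c t t'|b x].
  - by rewrite ul mulrDr scalerAr.
  - by rewrite ul mulrDl scalerAl.
  - by rewrite duE uE !tensM !mulr1 !mul1r.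
have vE a t i j :
    rep_tensl X (rep_actl A B) (d a * u t) i j = reg a i j *: t.
  move: t; apply: tens_lin_eq => [c t t'|c t t'|b x].
  - rewrite ul mulrDr -scalerAr.
    exact: (congr1 (fun a : mat (B ⊗ X) _ _ => a i j)
      (rep_lin (rep_tensl X (rep_actl A B)) c _ _)).
  - by rewrite scalerDr !scalerA mulrC.
  - by rewrite duE rep_tenslE rep_actlE (linZ (fun c x y => tens_linearl _ c x y)).
have sp (f g : A ⊗ B ⊗ X -> A ⊗ B ⊗ X) : linear f -> linear g ->
    (forall a t, f (d a * u t) = g (d a * u t)) -> f =1 g.
  move=> fl gl fg; apply: tens3_lin_eq => // a b x.
  by rewrite -duE fg.
have uo (i : unit) : i = tt by case: i.
have sb : bijective (fun i : 'I_(adim A) => i) by exists id.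
split.
- exact: (@cls_vu A _ _ (rep_tensl X (rep_inr A B)) tt
    (rep_tensl X (rep_actl A B)) id d uo sb erefl vE).
- exact: (@cls_uv A _ _ hA (rep_tensl X (rep_inr A B)) tt
    (rep_tensl X (rep_actl A B)) id d uo sb dl erefl dM du sp vE).
Qed.

Lemma cls_act3r : central_division B ->
  cls (rep_tensl X (rep_actr B A)) ∘ cls (rep_tensl X (rep_inl B A))
    = add_id (Ealg (A ⊗ X)) *+ adim B /\
  cls (rep_tensl X (rep_inl B A)) ∘ cls (rep_tensl X (rep_actr B A))
    = add_id (Ealg (A ⊗ B ⊗ X)) *+ adim B.
Proof.
move=> hB.
pose d (b : B) : A ⊗ B ⊗ X := tens (tens 1 b) 1.
pose u (t : A ⊗ X) : A ⊗ B ⊗ X := rep_tensl X (rep_inl B A) t tt tt.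
have dl : linear d by move=> c a b; rewrite /d tens_linearr tens_linearl.
have dM a b : d (a * b) = d a * d b by rewrite /d !tensM !mulr1.
have ul : linear u.
  by move=> c t t'; rewrite /u rep_lin mat_linE.
have uE a x : u (tens a x) = tens (tens a 1) x by rewrite /u rep_tenslE.
have duE a b x : d b * u (tens a x) = tens (tens a b) x.
  by rewrite uE !tensM !mulr1 !mul1r.
have du b t : d b * u t = u t * d b.
  move: t; apply: tens_lin_eq => [c t t'|c t t'|a x].
  - by rewrite ul mulrDr scalerAr.
  - by rewrite ul mulrDl scalerAl.
  - by rewrite duE uE !tensM !mulr1 !mul1r.
have vE b t i j :
    rep_tensl X (rep_actr B A) (d b * u t) i j = reg b i j *: t.
  move: t; apply: tens_lin_eq => [c t t'|c t t'|a x].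
  - rewrite ul mulrDr -scalerAr.
    exact: (congr1 (fun a : mat (A ⊗ X) _ _ => a i j)
      (rep_lin (rep_tensl X (rep_actr B A)) c _ _)).
  - by rewrite scalerDr !scalerA mulrC.
  - by rewrite duE rep_tenslE rep_actrE (linZ (fun c x y => tens_linearl _ c x y)).
have sp (f g : A ⊗ B ⊗ X -> A ⊗ B ⊗ X) : linear f -> linear g ->
    (forall b t, f (d b * u t) = g (d b * u t)) -> f =1 g.
  move=> fl gl fg; apply: tens3_lin_eq => // a b x.
  by rewrite -duE fg.
have uo (i : unit) : i = tt by case: i.
have sb : bijective (fun i : 'I_(adim B) => i) by exists id.
split.
- exact: (@cls_vu B _ _ (rep_tensl X (rep_inl B A)) tt
    (rep_tensl X (rep_actr B A)) id d uo sb erefl vE).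
- exact: (@cls_uv B _ _ hB (rep_tensl X (rep_inl B A)) tt
    (rep_tensl X (rep_actr B A)) id d uo sb dl erefl dM du sp vE).
Qed.

(** Adjoining A and representing B on itself concern different tensor factors, so they can be done
    in either order; the two index types differ by exchanging a factor [unit]. *)
Lemma cls_mixed_l :
  cls (rep_inr A X) ∘ cls (rep_actl B X) =
  cls (rep_tensl X (rep_actr B A)) ∘ cls (rep_tensl X (rep_inr A B)).
Proof.
rewrite -!cls_comp; apply: clsP.
apply: (@rep_hom_bij _ _ _ hE _ _ (rep_comp (rep_inr A X) (rep_actl B X))
  (rep_comp (rep_tensl X (rep_actr B A)) (rep_tensl X (rep_inr A B)))
  (fun p => (p.2, p.1))).
  by exists (fun p => (p.2, p.1)) => -[].
move=> t [i []] [j []]; move: t.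
suff h (t : B ⊗ X) : tens (1 : A) (rep_actl B X t i j) =
    rep_tensl X (rep_actr B A) (rep_tensl X (rep_inr A B) t tt tt) i j by exact: h.
move: t; apply: tens_lin_eq => [c t t'|c t t'|b x].
- by rewrite rep_linE tens_linearr.
- by rewrite !rep_linE.
rewrite rep_actlE !rep_tenslE rep_actrE.
by rewrite (linZ (fun c x y => tens_linearl _ c x y))
  (linZ (fun c x y => tens_linearr _ c x y)).
Qed.

Lemma cls_mixed_r :
  cls (rep_inr B X) ∘ cls (rep_actl A X) =
  cls (rep_tensl X (rep_actl A B)) ∘ cls (rep_tensl X (rep_inl B A)).
Proof.
rewrite -!cls_comp; apply: clsP.
apply: (@rep_hom_bij _ _ _ hE _ _ (rep_comp (rep_inr B X) (rep_actl A X))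
  (rep_comp (rep_tensl X (rep_actl A B)) (rep_tensl X (rep_inl B A)))
  (fun p => (p.2, p.1))).
  by exists (fun p => (p.2, p.1)) => -[].
move=> t [i []] [j []]; move: t.
suff h (t : A ⊗ X) : tens (1 : B) (rep_actl A X t i j) =
    rep_tensl X (rep_actl A B) (rep_tensl X (rep_inl B A) t tt tt) i j by exact: h.
move: t; apply: tens_lin_eq => [c t t'|c t t'|a x].
- by rewrite rep_linE tens_linearr.
- by rewrite !rep_linE.
rewrite rep_actlE !rep_tenslE rep_actlE.
by rewrite (linZ (fun c x y => tens_linearl _ c x y))
  (linZ (fun c x y => tens_linearr _ c x y)).
Qed.

End ThreeFactors.

Lemma central_division_square (A B X : falgType k) :
  central_division A -> central_division B -> coprime (adim A) (adim B) ->
  @isomorphic C (Ealg X ⊕ Ealg (A ⊗ B ⊗ X)) (Ealg (A ⊗ X) ⊕ Ealg (B ⊗ X)).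
Proof.
move=> hA hB cop.
have [vu1 uv1] := cls_act X hA; have [vu2 uv2] := cls_act X hB.
have [vu1' uv1'] := cls_act3l B X hA; have [vu2' uv2'] := cls_act3r A X hB.
exact: (coprime_square_iso cop vu1 uv1 vu2 uv2 vu1' uv1' vu2' uv2'
  (cls_mixed_l A B X) (cls_mixed_r A B X)).
Qed.

Lemma iso_of_cls (R S : algType k) (f : rep R S) (g : rep S R) :
  cls f ∘ cls g = add_id _ -> cls g ∘ cls f = add_id _ ->
  @isomorphic C (Ealg R) (Ealg S).
Proof. by move=> fg gf; exists (cls f), (cls g). Qed.

(** The two composites of [cls_act] are then identities. This serves the case where one index takes
    the default value 0, as coprimality forces the other to be 1. *)
Lemma degree1_iso (D X : falgType k) : central_division D -> adim D = 1%N ->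
  @isomorphic C (Ealg (D ⊗ X)) (Ealg X).
Proof.
by move=> hD D1; have [vu uv] := cls_act X hD; rewrite D1 in vu uv;
  apply: iso_of_cls vu uv.
Qed.

Lemma degree1_iso3l (D B X : falgType k) : central_division D -> adim D = 1%N ->
  @isomorphic C (Ealg (D ⊗ B ⊗ X)) (Ealg (B ⊗ X)).
Proof.
by move=> hD D1; have [vu uv] := cls_act3l B X hD; rewrite D1 in vu uv;
  apply: iso_of_cls vu uv.
Qed.

Lemma degree1_iso3r (A D X : falgType k) : central_division D -> adim D = 1%N ->
  @isomorphic C (Ealg (A ⊗ D ⊗ X)) (Ealg (A ⊗ X)).
Proof.
by move=> hD D1; have [vu uv] := cls_act3r A X hD; rewrite D1 in vu uv;
  apply: iso_of_cls vu uv.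
Qed.

(** * Replacing a matrix algebra by its division algebra *)

Section MatrixAlgebra.
Variables (A D : falgType k) (m : nat).
Hypothesis AD : matrix_algebra_over A D m.

Lemma matrix_iso (X : falgType k) :
  @isomorphic C (Ealg (A ⊗ X)) (Ealg (D ⊗ X)).
Proof.
have [f [g fK gK] f0] := rep_of_matrix_algebra AD.
exact: (cls_iso hE (f := rep_tensl X f) f0 (rep_tensl_bij X fK gK)).
Qed.

Lemma matrix_iso3l (B X : falgType k) :
  @isomorphic C (Ealg (A ⊗ B ⊗ X)) (Ealg (D ⊗ B ⊗ X)).
Proof.
have [f [g fK gK] f0] := rep_of_matrix_algebra AD.
have [g' fK' gK'] := rep_tensl_bij B fK gK.
exact: (cls_iso hE (f := rep_tensl X (rep_tensl B f)) f0 (rep_tensl_bij X fK' gK')).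
Qed.

Lemma matrix_iso3r (B X : falgType k) :
  @isomorphic C (Ealg (B ⊗ A ⊗ X)) (Ealg (B ⊗ D ⊗ X)).
Proof.
have [f [g fK gK] f0] := rep_of_matrix_algebra AD.
have [g' fK' gK'] := rep_tensr_bij B fK gK.
exact: (cls_iso hE (f := rep_tensl X (rep_tensr B f)) f0 (rep_tensl_bij X fK' gK')).
Qed.

End MatrixAlgebra.

End Main.

(* The default value 0 of [ind] is not excluded: to do so one would need that
   the dimension of a central division algebra is a square. *)
Lemma indP (k : fieldType) (A : falgType k) : 'Z({:A})%VS = 1%VS ->
  ind A = 0%N \/ exists (D : falgType k) (m : nat),
    [/\ central_division D, matrix_algebra_over A D m & adim D = (ind A ^ 2)%N].
Proof.
move=> ZA; rewrite /ind.
case: classical_sets.xgetP => [d _ [D [m [hD AD dD]]]|]; last by left.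
right; exists D, m; split=> //; last by rewrite adimE.
by split=> // z; apply: center_matrix_algebra ZA AD.
Qed.

Theorem proposition3p5 (k : fieldType) (A B C : falgType k)
    (hA : central_simple A) (hB : central_simple B) (hC : central_simple C)
    (D : additive_category) (E : functor (dgcat_category k) D)
    (hE : additive_invariant E) (hAB : coprime (ind A) (ind B)) :
  @isomorphic D (E (alg_dgcat C) ⊕ E (alg_dgcat (A ⊗ B ⊗ C)))
                (E (alg_dgcat (A ⊗ C)) ⊕ E (alg_dgcat (B ⊗ C))).
Proof.
rewrite !alg_dgcatE.
have tr := @isomorphic_trans D; have sy := @isomorphic_sym D.
have [A0 | [DA [m [hDA AD dA]]]] := indP hA.1.
  (* Being coprime to 0, the index of B is 1, so its division algebra has dimension 1. Then E(B ⊗ C)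
     is E(C) and E(A ⊗ B ⊗ C) is E(A ⊗ C), and the two summands are merely exchanged. *)
  move: hAB; rewrite A0 /coprime gcd0n => /eqP B1.
  have [B0 | [DB [n [hDB BD dB]]]] := indP hB.1; first by rewrite B0 in B1.
  rewrite B1 in dB.
  have i1 := tr _ _ _ (matrix_iso hE BD C) (degree1_iso hE C hDB dB).
  have i2 := tr _ _ _ (matrix_iso3r hE BD A C) (degree1_iso3r hE A C hDB dB).
  exact: tr _ _ _ (sum_iso (sy _ _ i1) i2) (sum_isoC _ _).
have [B0 | [DB [n [hDB BD dB]]]] := indP hB.1.
  move: hAB; rewrite B0 /coprime gcdn0 => /eqP A1; rewrite A1 in dA.
  have i1 := tr _ _ _ (matrix_iso hE AD C) (degree1_iso hE C hDA dA).
  have i2 := tr _ _ _ (matrix_iso3l hE AD B C) (degree1_iso3l hE B C hDA dA).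
  exact: sum_iso (sy _ _ i1) i2.
(* The multiplicities in the square are the dimensions, i.e. the squares of the coprime indices. *)
have cop : coprime (adim DA) (adim DB) by rewrite dA dB coprimeXl ?coprimeXr.
have sq := central_division_square hE C hDA hDB cop.
have iA := sy _ _ (matrix_iso hE AD C); have iB := sy _ _ (matrix_iso hE BD C).
have iAB := tr _ _ _ (matrix_iso3l hE AD B C) (matrix_iso3r hE BD DA C).
exact: tr _ _ _ (sum_iso (isomorphic_refl _) iAB)
  (tr _ _ _ sq (sum_iso iA iB)).
Qed.
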